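(* Assume the axiom of determinacy $\mathsf{AD}$. Let $d\ge1$ be an integer and let $\delta$ be a real number. Then any wellordered union of subsets of $\mathbb{R}^d$, each of which has Hausdorff dimension at most $\delta$, has Hausdorff dimension at most $\delta$. That is, if $\theta$ is any ordinal and $(A_\alpha)_{\alpha<\theta}$ is a sequence of subsets of $\mathbb{R}^d$ with $\mathrm{HD}(A_\alpha)\le\delta$ for all $\alpha<\theta$, then $\mathrm{HD}\left(\bigcup_{\alpha<\theta}A_\alpha\right)\le\delta$.
   Context: $\mathrm{HD}$ denotes Hausdorff dimension, defined for arbitrary subsets of $\mathbb{R}^d$ and satisfying $0\le\mathrm{HD}(A)\le d$ for all $A\subseteq\mathbb{R}^d$. $\mathsf{AD}$ is the statement that every two-player perfect-information game of length $\omega$ on $\omega=\mathbb{N}$ is determined. As $\mathsf{AD}$ contradicts the full axiom of choice, the result is understood over $\mathsf{ZF}$ without the full axiom of choice.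
   Formalization: The case of the empty family (θ = 0) with δ < 0 is excluded, because there the claim as worded fails: the union is empty and has Hausdorff dimension 0 > δ. *)

(* Defs.v *)
From Stdlib Require Import ClassicalEpsilon.

(* The ambient logic proves the axiom of choice and hence refutes determinacy
   for its own functions nat -> nat.  The theorem is a theorem of ZF + AD, so it
   is stated here for an arbitrary first-order model M of ZF in which AD holds.
   Every quantifier in the definitions below ranges over elements of M (or over
   option M, or tuples of elements of M), so each of them is the interpretation
   in M of a first-order formula of set theory.  In particular natural numbers,
   reals, functions, ordinals and strategies are those of M. *)

Record set_structure := SetStructure {
  carrier :> Type;
  mem : carrier -> carrier -> Prop;
  carrier_inhabited : inhabited carrier
}.

Arguments mem {s} _ _.

Declare Scope zf_scope.
Notation "x ∈ y" := (mem x y) (at level 70, no associativity) : zf_scope.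
Notation "x ∉ y" := (~ mem x y) (at level 70, no associativity) : zf_scope.
Local Open Scope zf_scope.

(* First-order formulas in the language {∈, =}; variables are de Bruijn
   indices, an assignment being an infinite sequence of which a formula only
   reads finitely many entries. *)
Inductive formula : Type :=
  | FMem (i j : nat)
  | FEq (i j : nat)
  | FFalse
  | FImp (p q : formula)
  | FAll (p : formula).

Definition scons {T : Type} (x : T) (rho : nat -> T) (n : nat) : T :=
  match n with 0 => x | S m => rho m end.

Fixpoint sat (M : set_structure) (rho : nat -> M) (p : formula) : Prop :=
  match p with
  | FMem i j => rho i ∈ rho j
  | FEq i j => rho i = rho j
  | FFalse => False
  | FImp p q => sat M rho p -> sat M rho q
  | FAll p => forall x : M, sat M (scons x rho) p
  end.

Record ZF (M : set_structure) : Prop := {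
  zf_extensionality : forall a b : M, (forall x, x ∈ a <-> x ∈ b) -> a = b;
  zf_foundation : forall a : M,
    (exists x, x ∈ a) -> exists x, x ∈ a /\ forall y, y ∈ x -> y ∉ a;
  zf_pairing : forall a b : M, exists c, forall x, x ∈ c <-> x = a \/ x = b;
  zf_union : forall a : M,
    exists c, forall x, x ∈ c <-> exists y, y ∈ a /\ x ∈ y;
  zf_powerset : forall a : M,
    exists c, forall x, x ∈ c <-> forall y, y ∈ x -> y ∈ a;
  zf_infinity : exists w : M,
    (exists e, e ∈ w /\ forall y, y ∉ e) /\
    forall x, x ∈ w ->
      exists y, y ∈ w /\ forall z, z ∈ y <-> z ∈ x \/ z = x;
  zf_separation : forall (p : formula) (rho : nat -> M) (a : M),
    exists c, forall x, x ∈ c <-> x ∈ a /\ sat M (scons x rho) p;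
  zf_replacement : forall (p : formula) (rho : nat -> M) (a : M),
    (forall x, x ∈ a -> exists! y, sat M (scons y (scons x rho)) p) ->
    exists c, forall y, y ∈ c <->
      exists x, x ∈ a /\ sat M (scons y (scons x rho)) p
}.

(* Definite description: the unique x with P x, or x0 if there is none. *)
Definition the_or {T : Type} (x0 : T) (P : T -> Prop) : T :=
  epsilon (inhabits x0)
    (fun x => unique P x \/ (~ (exists! y, P y)) /\ x = x0).

Section Sets.

Context {M : set_structure}.
Implicit Types a b c f n x y X Y : M.

Definition empty : M :=
  epsilon (carrier_inhabited M) (fun e => forall x, x ∉ e).

Definition the (P : M -> Prop) : M := the_or empty P.

(* {x | P x}; only used for classes which are sets by the axioms of ZF. *)
Definition set_of (P : M -> Prop) : M := the (fun b => forall x, x ∈ b <-> P x).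

Definition subset a b : Prop := forall x, x ∈ a -> x ∈ b.
Definition power a : M := set_of (fun x => subset x a).
Definition upair a b : M := set_of (fun x => x = a \/ x = b).
Definition opair a b : M := upair (upair a a) (upair a b).
Definition prod_set X Y : M :=
  set_of (fun p => exists x y, x ∈ X /\ y ∈ Y /\ p = opair x y).

Definition is_fun X Y f : Prop :=
  subset f (prod_set X Y) /\ forall x, x ∈ X -> exists! y, opair x y ∈ f.
Definition fun_set X Y : M := set_of (is_fun X Y).
Definition app f x : M := the (fun y => opair x y ∈ f).
Definition restrict f X : M :=
  set_of (fun p => p ∈ f /\ exists x y, x ∈ X /\ p = opair x y).

Definition succ n : M := set_of (fun x => x ∈ n \/ x = n).
Definition omega : M :=
  set_of (fun n => forall X, empty ∈ X ->
    (forall k, k ∈ X -> succ k ∈ X) -> n ∈ X).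

Definition transitive a : Prop := forall x, x ∈ a -> subset x a.
(* With foundation, these are exactly the von Neumann ordinals. *)
Definition ordinal a : Prop := transitive a /\ forall x, x ∈ a -> transitive x.

End Sets.

Section Determinacy.

Context {M : set_structure}.
Implicit Types A n x sigma tau : M.

Definition even n : Prop :=
  forall X : M, empty ∈ X -> (forall k, k ∈ X -> succ (succ k) ∈ X) -> n ∈ X.

Definition finite_sequences : M :=
  set_of (fun u => exists n, n ∈ omega /\ is_fun n omega u).

Definition strategy sigma : Prop := is_fun finite_sequences omega sigma.

Definition follows_I sigma x : Prop :=
  forall n, n ∈ omega -> even n -> app x n = app sigma (restrict x n).
Definition follows_II tau x : Prop :=
  forall n, n ∈ omega -> ~ even n -> app x n = app tau (restrict x n).

(* In the game with payoff A the players alternately choose the values of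
   x : omega -> omega, player I moving first; player I wins iff x ∈ A. *)
Definition determined A : Prop :=
  (exists sigma, strategy sigma /\
     forall x, is_fun omega omega x -> follows_I sigma x -> x ∈ A) \/
  (exists tau, strategy tau /\
     forall x, is_fun omega omega x -> follows_II tau x -> x ∉ A).

End Determinacy.

Definition AD (M : set_structure) : Prop :=
  forall A : M, subset A (fun_set omega omega) -> determined A.

Record field_data (M : set_structure) := FieldData {
  reals : M;
  radd_graph : M;
  rmul_graph : M;
  rzero : M;
  rone : M;
  rle_graph : M
}.

Arguments reals {M} _.
Arguments radd_graph {M} _.
Arguments rmul_graph {M} _.
Arguments rzero {M} _.
Arguments rone {M} _.
Arguments rle_graph {M} _.

Section Reals.

Context {M : set_structure} (R : field_data M).
Implicit Types x y z r s : M.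

Definition radd x y : M := app (radd_graph R) (opair x y).
Definition rmul x y : M := app (rmul_graph R) (opair x y).
Definition rle x y : Prop := opair x y ∈ rle_graph R.
Definition rlt x y : Prop := rle x y /\ x <> y.
Definition rsub x y : M := the (fun z => z ∈ reals R /\ radd z y = x).

(* R is the field of real numbers of M: an ordered field with the least upper
   bound property for the subsets belonging to M.  ZF proves that there is one
   and that it is unique up to isomorphism. *)
Record is_real_field : Prop := {
  radd_fun : is_fun (prod_set (reals R) (reals R)) (reals R) (radd_graph R);
  rmul_fun : is_fun (prod_set (reals R) (reals R)) (reals R) (rmul_graph R);
  rle_rel : subset (rle_graph R) (prod_set (reals R) (reals R));
  rzero_in : rzero R ∈ reals R;
  rone_in : rone R ∈ reals R;
  raddA : forall x y z, x ∈ reals R -> y ∈ reals R -> z ∈ reals R ->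
    radd x (radd y z) = radd (radd x y) z;
  raddC : forall x y, x ∈ reals R -> y ∈ reals R -> radd x y = radd y x;
  radd0 : forall x, x ∈ reals R -> radd x (rzero R) = x;
  raddN : forall x, x ∈ reals R ->
    exists y, y ∈ reals R /\ radd x y = rzero R;
  rmulA : forall x y z, x ∈ reals R -> y ∈ reals R -> z ∈ reals R ->
    rmul x (rmul y z) = rmul (rmul x y) z;
  rmulC : forall x y, x ∈ reals R -> y ∈ reals R -> rmul x y = rmul y x;
  rmul1 : forall x, x ∈ reals R -> rmul x (rone R) = x;
  rmulV : forall x, x ∈ reals R -> x <> rzero R ->
    exists y, y ∈ reals R /\ rmul x y = rone R;
  rmulDr : forall x y z, x ∈ reals R -> y ∈ reals R -> z ∈ reals R ->
    rmul x (radd y z) = radd (rmul x y) (rmul x z);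
  rone_neq0 : rone R <> rzero R;
  rle_refl : forall x, x ∈ reals R -> rle x x;
  rle_antisym : forall x y, rle x y -> rle y x -> x = y;
  rle_trans : forall x y z, rle x y -> rle y z -> rle x z;
  rle_total : forall x y, x ∈ reals R -> y ∈ reals R -> rle x y \/ rle y x;
  rle_add : forall x y z, z ∈ reals R -> rle x y -> rle (radd x z) (radd y z);
  rle_mul : forall x y,
    rle (rzero R) x -> rle (rzero R) y -> rle (rzero R) (rmul x y);
  rcomplete : forall X : M, subset X (reals R) -> (exists x, x ∈ X) ->
    (exists b, b ∈ reals R /\ forall x, x ∈ X -> rle x b) ->
    exists b, b ∈ reals R /\ (forall x, x ∈ X -> rle x b) /\
      forall c, c ∈ reals R -> (forall x, x ∈ X -> rle x c) -> rle b c
}.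

(* psum n F is the sum of F i over i < n, for n a natural number of M. *)
Definition psum (n : M) (F : M -> M) : M :=
  the (fun v => exists S, is_fun (succ n) (reals R) S /\
    app S empty = rzero R /\
    (forall i, i ∈ n -> app S (succ i) = radd (app S i) (F i)) /\
    v = app S n).

(* rpow r s is r ^ s for r, s >= 0, with 0 ^ 0 = 1: for r > 0 the map
   s |-> r ^ s is the only monotone p with p (a + b) = p a * p b and p 1 = r. *)
Definition rpow r s : M :=
  the (fun v =>
    (r = rzero R /\ s = rzero R /\ v = rone R) \/
    (r = rzero R /\ s <> rzero R /\ v = rzero R) \/
    (r <> rzero R /\ exists p, is_fun (reals R) (reals R) p /\
      (forall a b, a ∈ reals R -> b ∈ reals R ->
         app p (radd a b) = rmul (app p a) (app p b)) /\
      ((forall a b, rle a b -> rle (app p a) (app p b)) \/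
       (forall a b, rle a b -> rle (app p b) (app p a))) /\
      app p (rone R) = r /\ v = app p s)).

(* [0, +oo] is represented in option M, None standing for +oo. *)
Definition extended (u : option M) : Prop :=
  match u with None => True | Some x => x ∈ reals R /\ rle (rzero R) x end.

Definition ele (u v : option M) : Prop :=
  match u, v with
  | _, None => True
  | None, Some _ => False
  | Some x, Some y => rle x y
  end.

Definition esup (P : option M -> Prop) : option M :=
  the_or None (fun v => extended v /\ (forall u, P u -> ele u v) /\
    forall w, extended w -> (forall u, P u -> ele u w) -> ele v w).

Definition einf (P : option M -> Prop) : option M :=
  the_or None (fun v => extended v /\ (forall u, P u -> ele v u) /\
    forall w, extended w -> (forall u, P u -> ele w u) -> ele w v).

Definition eseries (F : M -> M) : option M :=
  esup (fun u => exists n, n ∈ omega /\ u = Some (psum n F)).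

End Reals.

Section Hausdorff.

(* d is a natural number of M, i.e. the set of its predecessors; a point of
   R^d is a function from d to the reals. *)
Context {M : set_structure} (R : field_data M) (d : M).
Implicit Types A U s eta x y : M.

Definition space : M := fun_set d (reals R).

Definition dist x y : M :=
  the (fun r => r ∈ reals R /\ rle R (rzero R) r /\
    rmul R r r =
    psum R d (fun i => rmul R (rsub R (app x i) (app y i))
                              (rsub R (app x i) (app y i)))).

Definition diam U : option M :=
  esup R (fun u => exists x y, x ∈ U /\ y ∈ U /\ u = Some (dist x y)).

(* diam(U) ^ s for U of finite diameter; the empty set contributes 0, even for
   s = 0. *)
Definition diam_pow U s : M :=
  the (fun v => (U = empty /\ v = rzero R) \/
    (U <> empty /\ exists r, diam U = Some r /\ v = rpow R r s)).

Definition is_cover eta A (U : M) : Prop :=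
  is_fun omega (power space) U /\
  (forall i, i ∈ omega -> ele R (diam (app U i)) (Some eta)) /\
  (forall x, x ∈ A -> exists i, i ∈ omega /\ x ∈ app U i).

Definition hausdorff_premeasure s eta A : option M :=
  einf R (fun u => exists U, is_cover eta A U /\
    u = eseries R (fun i => diam_pow (app U i) s)).

Definition hausdorff_measure s A : option M :=
  esup R (fun u => exists eta, rlt R (rzero R) eta /\
    u = hausdorff_premeasure s eta A).

Definition HD A : option M :=
  einf R (fun u => exists s, rle R (rzero R) s /\
    hausdorff_measure s A = Some (rzero R) /\ u = Some s).

End Hausdorff.

(* Main.v *)
From HB Require Import structures.
From mathcomp Require Import all_boot all_order all_algebra ring lra.
From mathcomp Require Import boolp.
Require Import Defs.

(** Why wellordered unions do not raise the dimension.

    Suppose that all A_a, for a below theta, have dimension at most delta, and let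
    s > delta.  Each A_a is s-null; it has to be shown that their union is s-null.
    Arranging the half-open dyadic boxes of R^d in a binary tree, a point becomes a
    branch and a finite measure on branches becomes a flow, that is a nonnegative
    function on the nodes which at each node is the sum of its values at the two
    children.  Covers are replaced by superflows, for which this sum is only bounded
    by the value at the node: a superflow that reaches a capacity w somewhere along
    each branch of a set encodes a cover of this set by nodes, whose total capacity
    is at most the value at the root (antichain_sum).

    Determinacy enters through one dichotomy (flow_or_cover), a substitute for
    Frostman's lemma that holds for arbitrary sets X of branches.  In a game, player I
    splits a mass v along the tree while player II descends; a winning strategy of
    player I is a flow of mass v below w all of whose positive branches are in X, and
    a winning strategy of player II yields a superflow that covers X and has a value at
    the root arbitrarily close to v.  Taking side^s as the capacity of a small box
    and infinity elsewhere, either the union of the A_a has an s-cover of small cost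
    (cover_of_superflow) or it carries a flow mu below side^s.  In the latter case
    each A_a is mu-null, because its dimension is below s (cover_null_null).

    So it remains to see that wellordered unions of mu-null sets are mu-null
    (wellordered_null), which is Sierpinski's argument.  For a shortest union that is
    not null, the dichotomy gives a flow h living on it (flow_in_not_null).  Let E x y
    mean that x appears no later than y in the union.  By the dichotomy for the
    product of h with itself, E or its complement carries some mass
    (product_dichotomy), so that some section of E, or some section of its complement
    along the other axis, is not null (fubini).  But such sections are contained
    in the union up to the index of one point, which is null.

    The axiom of choice is not available in the model, and countable choice is never
    used: covers are read off from superflows, hence are chosen by the game all at
    once, and a covering set is replaced by the corner of its hull instead of one of
    its points.  As the union need not be bounded, the tree starts with a spine from
    which the cubes [-2^k, 2^k)^d branch off.

    All this happens inside a model of ZF, where induction, recursion and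
    separation are available for definable predicates only.  This
    calls for a calculus of definability: a set a of the model is the type El a, internal
    functions are applied to its elements, and the predicates built from such
    operations are definable by a recursion on their shape.  The reals of the model
    then form an ordered field in the usual sense, over which the sums, powers and
    logarithms that the definition of the Hausdorff measure refers to are
    developed. *)

Set Implicit Arguments.
Unset Strict Implicit.
Unset Printing Implicit Defensive.
Import Order.TTheory GRing.Theory Num.Theory.
Local Open Scope zf_scope.

(** * Definability with parameters *)

Section Formulas.
Variable M : set_structure.
Implicit Types (p q : formula) (rho : nat -> M).

Fixpoint rename (f : nat -> nat) p : formula :=
  match p with
  | FMem i j => FMem (f i) (f j)
  | FEq i j => FEq (f i) (f j)
  | FFalse => FFalse
  | FImp p q => FImp (rename f p) (rename f q)
  | FAll p => FAll (rename (fun i => if i is j.+1 then (f j).+1 else 0%N) p)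
  end.

Lemma sat_rename p f rho : sat M rho (rename f p) <-> sat M (rho \o f) p.
Proof.
elim: p f rho => //= [p IHp q IHq|p IH] f rho.
  by rewrite IHp IHq.
have E x : scons x rho \o (fun i => if i is j.+1 then (f j).+1 else 0%N) =
           scons x (rho \o f).
  by apply: funext; case.
by split=> H x; move/(_ x): H; rewrite IH E.
Qed.

End Formulas.

Section Definability.
Variable M : set_structure.

(** A type whose elements are coded by sets of the model, the codes forming a definable
    class: quantifiers over it become relativized quantifiers. *)
Class Rep (X : Type) := {
  code : X -> M;
  code_inj : forall x y, code x = code y -> x = y;
  code_img : exists p (rho : nat -> M),
    forall m, (exists x, code x = m) <-> sat M (scons m rho) p
}.

(** A context is a nested product of coded types; its atoms, the parameters and the
    codes of the components, are what the variables of a formula may stand for. *)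
Class Ctx (G : Type) := {
  atom : (G -> M) -> Prop;
  atom_const : forall c : M, atom (fun=> c)
}.

Global Program Instance Ctx_unit : Ctx unit := {| atom := fun _ => True |}.

Global Program Instance Ctx_prod G X (cG : Ctx G) (rX : Rep X) : Ctx (G * X) :=
  {| atom v := (exists2 w, atom w & forall g x, v (g, x) = w g)
               \/ (forall g x, v (g, x) = code x) |}.
Next Obligation. by left; exists (fun=> c) => //; apply: atom_const. Qed.

(** Definability by a formula with parameters.  Separation and induction are available
    in the model for such predicates only. *)
Definition Def G {cG : Ctx G} (P : G -> Prop) : Prop :=
  exists p (v : nat -> G -> M), (forall i, atom (v i)) /\
    forall g, P g <-> sat M (v ^~ g) p.

Global Program Instance Rep_M : Rep M := {| code := id |}.
Next Obligation.
exists (FImp FFalse FFalse), (fun=> empty) => m.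
by split=> [_ []|_]; exists m.
Qed.

Definition DefT G {cG : Ctx G} X {rX : Rep X} (t : G -> X) : Prop :=
  Def (fun h : G * M => h.2 = code (t h.1)).

Section Rules.
Context G {cG : Ctx G}.
Implicit Types P Q : G -> Prop.

Lemma Def_ext P Q : (forall g, P g <-> Q g) -> Def P -> Def Q.
Proof. by move=> E [p [v [av H]]]; exists p, v; split=> // g; rewrite -E. Qed.

Lemma Def_False : Def (fun _ : G => False).
Proof. by exists FFalse, (fun _ _ => empty); split=> // i; apply: atom_const. Qed.

Lemma Def_imp P Q : Def P -> Def Q -> Def (fun g => P g -> Q g).
Proof.
move=> [p [v [av H]]] [q [w [aw K]]].
exists (FImp (rename double p) (rename (fun i => i.*2.+1) q)).
exists (fun i => if odd i then w i./2 else v i./2); split.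
  by move=> i; case: ifP.
move=> g /=; rewrite !sat_rename H K.
have -> : ((fun i => (if odd i then w i./2 else v i./2) g) \o double) = v ^~ g.
  by apply: funext => i /=; rewrite odd_double doubleK.
have -> : ((fun i => (if odd i then w i./2 else v i./2) g) \o
          (fun i => i.*2.+1)) = w ^~ g.
  by apply: funext => i /=; rewrite odd_double /= uphalf_double.
by [].
Qed.

Lemma Def_not P : Def P -> Def (fun g => ~ P g).
Proof. by move=> H; apply: Def_imp => //; apply: Def_False. Qed.

Lemma Def_True : Def (fun _ : G => True).
Proof. by apply: Def_ext (Def_not Def_False) => g; split=> // _ []. Qed.

Lemma Def_const (A : Prop) : Def (fun _ : G => A).
Proof.
have [a|na] := pselect A; first by apply: Def_ext Def_True.
by apply: Def_ext Def_False.
Qed.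

Lemma Def_and P Q : Def P -> Def Q -> Def (fun g => P g /\ Q g).
Proof.
move=> HP HQ; apply: Def_ext (Def_not (Def_imp HP (Def_not HQ))) => g.
by split=> [/not_implyP[? /contrapT]|[p q] /(_ p)].
Qed.

Lemma Def_or P Q : Def P -> Def Q -> Def (fun g => P g \/ Q g).
Proof.
move=> HP HQ; apply: Def_ext (Def_imp (Def_not HP) HQ) => g.
by split=> [H|[|//]]; [have [|/H] := pselect (P g); [left|right]|move=> p /(_ p)].
Qed.

Lemma Def_iff P Q : Def P -> Def Q -> Def (fun g => P g <-> Q g).
Proof. by move=> HP HQ; apply: Def_and; apply: Def_imp. Qed.

(** Quantifiers and the axiom of separation bind the variable 0, so the last component
    of the context has to become that variable, and nothing else may refer to it. *)
Lemma Def_normal X {rX : Rep X} (P : G * X -> Prop) : Def P ->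
  exists p (w : nat -> G -> M), (forall i, atom (w i)) /\
    forall g x, P (g, x) <-> sat M (scons (code x) (w ^~ g)) p.
Proof.
move=> [p [v [av H]]].
pose Q (i : nat) (w : G -> M) := @atom G cG w /\ forall g x, v i (g, x) = w g.
pose w i := if pselect (exists u, Q i u) is left e then projT1 (cid e)
            else fun=> empty.
exists (rename (fun i => if `[< exists u, Q i u >] then i.+1 else 0%N) p), w.
split=> [i|g x].
  rewrite /w; case: pselect => [e|_]; last exact: atom_const.
  by case: (projT2 (cid e)).
rewrite sat_rename H; set r := _ \o _; suff : v ^~ (g, x) = r by move=> ->.
apply: funext => i; rewrite /r /=; case: asboolP => [[u Qu]|nQ] /=.
  rewrite /w; case: pselect => [e|[]]; last by exists u.
  by case: (projT2 (cid e)).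
by case: (av i) => [[u au e]|-> //]; case: nQ; exists u.
Qed.

Lemma Def_all X {rX : Rep X} (P : G -> X -> Prop) :
  Def (fun h : G * X => P h.1 h.2) -> Def (fun g => forall x, P g x).
Proof.
move=> /Def_normal[p [w [aw H]]].
have [q [rho K]] := code_img (X := X).
pose v i := if odd i then (fun=> rho i./2) else w i./2.
exists (FAll (FImp
   (rename (fun i => if i is j.+1 then j.*2.+2 else 0%N) q)
   (rename (fun i => if i is j.+1 then j.*2.+1 else 0%N) p))), v.
split=> [i|g]; first by rewrite /v; case: ifP => // _; apply: atom_const.
have E1 m : scons m (v ^~ g) \o (fun i => if i is j.+1 then j.*2.+2 else 0%N)
  = scons m rho.
  by apply: funext => -[|i] //=; rewrite /v /= odd_double /= uphalf_double.
have E2 m : scons m (v ^~ g) \o (fun i => if i is j.+1 then j.*2.+1 else 0%N)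
  = scons m (w ^~ g).
  by apply: funext => -[|i] //=; rewrite /v /= odd_double /= doubleK.
split=> /= [Pg m|Pg x].
  by rewrite !sat_rename E1 E2 => /K[x <-]; apply: (proj1 (H _ _)).
apply/H; have := Pg (@code X rX x); rewrite !sat_rename E1 E2; apply.
by apply/K; exists x.
Qed.

End Rules.

Section Exists.
Context G {cG : Ctx G}.

Lemma Def_ex X {rX : Rep X} (P : G -> X -> Prop) :
  Def (fun h : G * X => P h.1 h.2) -> Def (fun g => exists x, P g x).
Proof.
move=> H; apply: Def_ext (Def_not (Def_all (P := fun g x => ~ P g x) _)).
  by move=> g; split=> [/existsNP[x /contrapT]|[x Px] /(_ x)] //; exists x.
exact: (Def_not H).
Qed.

Lemma Def_ex2 X {rX : Rep X} (P Q : G -> X -> Prop) :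
  Def (fun h : G * X => P h.1 h.2 /\ Q h.1 h.2) ->
  Def (fun g => exists2 x, P g x & Q g x).
Proof.
move/(Def_ex (P := fun g x => P g x /\ Q g x)); apply: Def_ext => g.
by split=> [[x []]|[x]]; exists x.
Qed.

End Exists.

(** The maps along which formulas can be pulled back. *)
Definition ctx_map G D {cG : Ctx G} {cD : Ctx D} (s : G -> D) :=
  forall v, atom v -> atom (v \o s).

Lemma Def_map G D {cG : Ctx G} {cD : Ctx D} (s : G -> D) (P : D -> Prop) :
  ctx_map s -> Def P -> Def (P \o s).
Proof.
move=> cs [p [v [av H]]]; exists p, (fun i => v i \o s).
by split=> [i|g] //=; apply: cs.
Qed.

Lemma ctx_map_tt G {cG : Ctx G} : ctx_map (fun _ : G => tt).
Proof.
move=> v _; rewrite (_ : _ \o _ = fun=> v tt); first exact: atom_const.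
by apply: funext.
Qed.

Lemma ctx_map_fst G X {cG : Ctx G} {rX : Rep X} : ctx_map (@fst G X).
Proof. by move=> v av; left; exists v. Qed.

Lemma atom_ext G {cG : Ctx G} (v w : G -> M) : v =1 w -> atom w -> atom v.
Proof. by move/funext=> ->. Qed.

Lemma ctx_map_ext G D X {cG : Ctx G} {cD : Ctx D} {rX : Rep X} (s : G -> D)
  (t : G -> X) : ctx_map s -> atom (code \o t) -> ctx_map (fun g => (s g, t g)).
Proof.
move=> cs at_ v [[w aw e]|e]; first by apply: atom_ext (cs _ aw) => g /=.
by apply: atom_ext at_ => g /=.
Qed.

Lemma ctx_map_pair G D X {cG : Ctx G} {cD : Ctx D} {rX : Rep X} (s : G -> D) :
  ctx_map s -> ctx_map (fun h : G * X => (s h.1, h.2)).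
Proof.
move=> cs; apply: ctx_map_ext; last by right.
by move=> v /cs av; left; exists (v \o s).
Qed.

Lemma ctx_map_code G X {cG : Ctx G} {rX : Rep X} :
  ctx_map (fun h : G * X => (h.1, code h.2)).
Proof.
move=> v [[w aw e]|e]; first by left; exists w => // g x /=; rewrite e.
by right=> g x /=; rewrite e.
Qed.

Section TermRules.
Context G {cG : Ctx G} X {rX : Rep X}.

Lemma Def_subst (P : G -> X -> Prop) (t : G -> X) :
  Def (fun h : G * X => P h.1 h.2) -> DefT t -> Def (fun g => P g (t g)).
Proof.
move=> HP Ht; apply: (@Def_ext _ _ (fun g => exists x, x = t g /\ P g x)).
  by move=> g; split=> [[_ [-> //]]|Pg]; exists (t g).
apply: (Def_ex (P := fun g x => x = t g /\ P g x)); apply: Def_and => //.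
apply: Def_ext (Def_map (ctx_map_code (X := X)) Ht) => -[g x] /=.
by split=> [e|->] //; apply: code_inj.
Qed.

Lemma DefT_graph (t : G -> X) :
  Def (fun h : G * X => h.2 = t h.1) -> DefT t.
Proof.
move=> /(Def_map (ctx_map_pair (X := X) (ctx_map_fst (X := M)))) /= H.
apply: Def_ext (Def_ex (P := fun (g : G * M) x => x = t g.1 /\ g.2 = code x) _).
  by move=> [g m] /=; split=> [[_ [-> //]]|->]; exists (t g).
apply: Def_and; first exact: H.
pose v0 (h : G * M * X) := h.1.2; pose v1 (h : G * M * X) := @code X rX h.2.
exists (FEq 0 1), (fun i => if i is 0%N then v0 else v1).
split=> //; case=> [|_]; last by right.
by left; exists (fun h => h.2) => //; right.
Qed.

Lemma DefT_unique (P : G -> X -> Prop) (t : G -> X) :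
  (forall g, P g (t g)) -> (forall g x, P g x -> x = t g) ->
  Def (fun h : G * X => P h.1 h.2) -> DefT t.
Proof.
move=> H K; move=> HP; apply/DefT_graph/(Def_ext _ HP) => -[g x] /=.
by split=> [Pgx|->]; [apply: K|apply: H].
Qed.

Lemma DefT_const (c : X) : DefT (fun _ : G => c).
Proof.
exists (FEq 0 1), (fun i => if i is 0%N then snd else fun=> code c); split=> //.
by case=> [|_]; [right|left; exists (fun=> code c) => //; apply: atom_const].
Qed.

Lemma Def_map1 D {cD : Ctx D} (s : D -> G) (t : G -> X) :
  ctx_map s -> DefT t -> DefT (t \o s).
Proof. by move=> cs /(Def_map (ctx_map_pair (X := M) cs)). Qed.

End TermRules.

Lemma DefT_var G {cG : Ctx G} X {rX : Rep X} : DefT (@snd G X).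
Proof.
exists (FEq 0 1), (fun i => if i is 0%N then snd else code \o snd \o fst).
split=> //; case=> [|_]; first by right.
by left; exists (code \o snd) => //; right.
Qed.

Lemma DefT_weak G {cG : Ctx G} X {rX : Rep X} Y {rY : Rep Y} (t : G -> X) :
  DefT t -> DefT (fun h : G * Y => t h.1).
Proof. exact/Def_map1/ctx_map_fst. Qed.

(** Substituting terms for all the variables of a closed relation, the last
   variable first so that the remaining terms only have to be weakened. *)
Section Composition.
Context G {cG : Ctx G} X {rX : Rep X} Y {rY : Rep Y} Z {rZ : Rep Z} W {rW : Rep W}.
Variables (t : G -> X) (u : G -> Y) (w : G -> Z) (k : G -> W).

Lemma Def_comp1 (P : X -> Prop) :
  Def (fun h : unit * X => P h.2) -> DefT t -> Def (fun g => P (t g)).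
Proof.
move=> HP; apply: (Def_subst (P := fun _ => P)).
exact: Def_map (ctx_map_pair (ctx_map_tt (G := G))) HP.
Qed.

Lemma Def_comp2 (P : X -> Y -> Prop) :
  Def (fun h : unit * X * Y => P h.1.2 h.2) -> DefT t -> DefT u ->
  Def (fun g => P (t g) (u g)).
Proof.
move=> HP Ht Hu; apply: (Def_subst (P := fun g x => P x (u g)) _ Ht).
apply: (Def_subst (P := fun (h : G * X) y => P h.2 y) _ (DefT_weak Hu)).
exact: Def_map (ctx_map_pair (ctx_map_pair (ctx_map_tt (G := G)))) HP.
Qed.

Lemma Def_comp3 (P : X -> Y -> Z -> Prop) :
  Def (fun h : unit * X * Y * Z => P h.1.1.2 h.1.2 h.2) ->
  DefT t -> DefT u -> DefT w -> Def (fun g => P (t g) (u g) (w g)).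
Proof.
move=> HP Ht Hu Hw; apply: (Def_subst (P := fun g x => P x (u g) (w g)) _ Ht).
apply: (Def_subst (P := fun (h : G * X) y => P h.2 y (w h.1)) _ (DefT_weak Hu)).
apply: (Def_subst (P := fun (h : G * X * Y) z => P h.1.2 h.2 z) _ (DefT_weak (DefT_weak Hw))).
exact: Def_map (ctx_map_pair (ctx_map_pair (ctx_map_pair (ctx_map_tt (G := G))))) HP.
Qed.

Lemma Def_comp4 (P : X -> Y -> Z -> W -> Prop) :
  Def (fun h : unit * X * Y * Z * W => P h.1.1.1.2 h.1.1.2 h.1.2 h.2) ->
  DefT t -> DefT u -> DefT w -> DefT k -> Def (fun g => P (t g) (u g) (w g) (k g)).
Proof.
move=> HP Ht Hu Hw Hk.
apply: (Def_subst (P := fun g x => P x (u g) (w g) (k g)) _ Ht).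
apply: (Def_subst (P := fun (h : G * X) y => P h.2 y (w h.1) (k h.1)) _ (DefT_weak Hu)).
apply: (Def_subst (P := fun (h : G * X * Y) z => P h.1.2 h.2 z (k h.1.1)) _ (DefT_weak (DefT_weak Hw))).
apply: (Def_subst (P := fun (h : G * X * Y * Z) z => P h.1.1.2 h.1.2 h.2 z) _
  (DefT_weak (DefT_weak (DefT_weak Hk)))).
exact: Def_map (ctx_map_pair (ctx_map_pair (ctx_map_pair (ctx_map_pair (ctx_map_tt (G := G)))))) HP.
Qed.

End Composition.

Section FunctionComposition.
Context G {cG : Ctx G} X {rX : Rep X} Y {rY : Rep Y} Z {rZ : Rep Z} W {rW : Rep W}.
Variables (t : G -> X) (u : G -> Y) (w : G -> Z).

Let var0 : atom (fun h : G * M => h.2). Proof. by right. Qed.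

Lemma DefT_comp1 (c : X -> W) :
  DefT (fun h : unit * X => c h.2) -> DefT t -> DefT (fun g => c (t g)).
Proof.
move=> Hc Ht.
apply: (Def_comp2 (P := fun x (m : M) => m = code (c x)) (t := fun h => t h.1) Hc).
- exact: DefT_weak.
- exact: DefT_var.
Qed.

Lemma DefT_comp2 (c : X -> Y -> W) :
  DefT (fun h : unit * X * Y => c h.1.2 h.2) -> DefT t -> DefT u ->
  DefT (fun g => c (t g) (u g)).
Proof.
move=> Hc Ht Hu.
apply: (Def_comp3 (P := fun x y (m : M) => m = code (c x y)) (t := fun h => t h.1)
  (u := fun h => u h.1) Hc).
- exact: DefT_weak.
- exact: DefT_weak.
- exact: DefT_var.
Qed.

Lemma DefT_comp3 (c : X -> Y -> Z -> W) :
  DefT (fun h : unit * X * Y * Z => c h.1.1.2 h.1.2 h.2) -> DefT t -> DefT u ->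
  DefT w -> DefT (fun g => c (t g) (u g) (w g)).
Proof.
move=> Hc Ht Hu Hw.
apply: (Def_comp4 (P := fun x y z (m : M) => m = code (c x y z)) (t := fun h => t h.1)
  (u := fun h => u h.1) (w := fun h => w h.1) Hc).
- exact: DefT_weak.
- exact: DefT_weak.
- exact: DefT_weak.
- exact: DefT_var.
Qed.

End FunctionComposition.

Section BasicTerms.
Context G {cG : Ctx G} X {rX : Rep X}.
Implicit Types t u : G -> X.

Lemma Def_eqM : Def (fun h : unit * M * M => h.1.2 = h.2).
Proof.
exists (FEq 0 1), (fun i h => if i is 0%N then h.1.2 else h.2); split=> //.
by case=> [|_]; [left; exists (fun h => h.2) => //; right|right].
Qed.

Lemma Def_memM : Def (fun h : unit * M * M => h.1.2 ∈ h.2).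
Proof.
exists (FMem 0 1), (fun i h => if i is 0%N then h.1.2 else h.2); split=> //.
by case=> [|_]; [left; exists (fun h => h.2) => //; right|right].
Qed.

Lemma Def_eq t u : DefT t -> DefT u -> Def (fun g => t g = u g).
Proof.
move=> Ht Hu.
apply: (@Def_ext _ _ (fun g => code (t g) = code (u g))).
  by move=> g; split=> [e|->] //; apply: code_inj.
exact: (Def_comp2 (P := fun x y : M => x = y) Def_eqM).
Qed.

Lemma Def_mem (t u : G -> M) : DefT t -> DefT u -> Def (fun g => t g ∈ u g).
Proof. exact: (Def_comp2 (P := fun x y : M => x ∈ y) Def_memM). Qed.

End BasicTerms.

Lemma DefT_if G {cG : Ctx G} X {rX : Rep X} (b : G -> Prop) (t u : G -> X) : Def b -> DefT t -> DefT u ->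
  DefT (fun g => if `[< b g >] then t g else u g).
Proof.
move=> Hb Ht Hu.
pose P g x := (b g /\ x = t g) \/ (~ b g /\ x = u g).
apply: (@DefT_unique _ _ _ _ P).
- by move=> g; rewrite /P; case: asboolP; [left|right].
- by move=> g x; rewrite /P => -[[bg ->]|[bg ->]]; case: asboolP.
apply: Def_or; apply: Def_and; try apply: Def_eq; try exact: DefT_weak; try exact: DefT_var.
- exact: (Def_map (ctx_map_fst (X := X)) Hb).
- exact: (Def_not (Def_map (ctx_map_fst (X := X)) Hb)).
Qed.

End Definability.

Lemma separation (M : set_structure) (hZF : ZF M) (P : M -> Prop) (a : M) :
  Def (fun h : unit * M => P h.2) ->
  exists c : M, forall x, x ∈ c <-> x ∈ a /\ P x.
Proof.
move=> /Def_normal[p [w [_ H]]].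
have [c cP] := zf_separation M hZF p (w ^~ tt) a; exists c => x.
by rewrite cP; split=> -[xa Px]; split=> //; apply/(H tt).
Qed.

(** * Elements of a set as a type *)

Section ContextVariables.
Context {M : set_structure} G {cG : @Ctx M G}.
Context X {rX : @Rep M X} Y {rY : @Rep M Y} Z {rZ : @Rep M Z} W {rW : @Rep M W}.
Context V {rV : @Rep M V} U {rU : @Rep M U} T {rT : @Rep M T} S {rS : @Rep M S}.

Lemma DefT_var1 : DefT (fun h : G * X * Y => h.1.2).
Proof. exact: (DefT_weak (Y := Y) (@DefT_var _ G cG X rX)). Qed.
Lemma DefT_var2 : DefT (fun h : G * X * Y * Z => h.1.1.2).
Proof. exact: (DefT_weak (Y := Z) DefT_var1). Qed.
Lemma DefT_var3 : DefT (fun h : G * X * Y * Z * W => h.1.1.1.2).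
Proof. exact: (DefT_weak (Y := W) DefT_var2). Qed.
Lemma DefT_var4 : DefT (fun h : G * X * Y * Z * W * V => h.1.1.1.1.2).
Proof. exact: (DefT_weak (Y := V) DefT_var3). Qed.
Lemma DefT_var5 : DefT (fun h : G * X * Y * Z * W * V * U => h.1.1.1.1.1.2).
Proof. exact: (DefT_weak (Y := U) DefT_var4). Qed.
Lemma DefT_var6 : DefT (fun h : G * X * Y * Z * W * V * U * T => h.1.1.1.1.1.1.2).
Proof. exact: (DefT_weak (Y := T) DefT_var5). Qed.
Lemma DefT_var7 : DefT (fun h : G * X * Y * Z * W * V * U * T * S => h.1.1.1.1.1.1.1.2).
Proof. exact: (DefT_weak (Y := S) DefT_var6). Qed.

End ContextVariables.

(** Sets of the model as types, so that internal functions act as functions and internal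
    reals can form an algebraic structure. *)
Definition El {M : set_structure} (a : M) : Type := {x : M | x ∈ a}.

Lemma El_inj {M : set_structure} (a : M) (x y : El a) : proj1_sig x = proj1_sig y -> x = y.
Proof.
by case: x y => [x xa] [y ya] /= e; subst y; rewrite (Prop_irrelevance xa ya).
Qed.

Global Program Instance Rep_El {M : set_structure} (a : M) : @Rep M (El a) :=
  {| code := @proj1_sig _ _ |}.
Next Obligation. exact: El_inj. Qed.
Next Obligation.
exists (FMem 0 1), (fun=> a) => m; split=> [[[x xa] /= <- //]|ma].
by exists (exist _ m ma).
Qed.

Lemma DefT_val {M : set_structure} G {cG : @Ctx M G} (a : M) (t : G -> El a) :
  DefT t -> DefT (fun g => proj1_sig (t g)).
Proof. by []. Qed.

Lemma Def_asbool_eq {M : set_structure} G {cG : @Ctx M G} (P Q : G -> Prop) :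
  Def P -> Def Q -> Def (fun g => `[< P g >] = `[< Q g >]).
Proof.
by move=> dP dQ; apply: Def_ext (Def_iff dP dQ) => g; split=> h; [apply: asbool_equiv_eq|apply: asbool_eq_equiv].
Qed.

(** Definability goals are closed by recursion on the shape of the predicate or
   the term; def_user is extended as new definable operations are introduced. *)
Ltac def_user := fail.
Ltac def_hyp :=
  match goal with
  | h : DefT (fun k : unit * _ => ?t k.2) |- DefT (fun g => ?t _) =>
      apply: (DefT_comp1 h)
  | h : DefT (fun k : unit * _ * _ => ?t k.1.2 k.2) |- DefT (fun g => ?t _ _) =>
      apply: (DefT_comp2 h)
  | h : DefT (fun k : unit * _ * _ * _ => ?t k.1.1.2 k.1.2 k.2)
    |- DefT (fun g => ?t _ _ _) => apply: (DefT_comp3 h)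
  | h : Def (fun k : unit * _ => ?t k.2) |- Def (fun g => ?t _) =>
      apply: (Def_comp1 h)
  | h : Def (fun k : unit * _ * _ => ?t k.1.2 k.2) |- Def (fun g => ?t _ _) =>
      apply: (Def_comp2 h)
  | h : Def (fun k : unit * _ * _ * _ => ?t k.1.1.2 k.1.2 k.2)
    |- Def (fun g => ?t _ _ _) => apply: (Def_comp3 h)
  end.
Ltac def_step :=
  lazymatch goal with
  | |- @Def _ _ _ _ =>
    first [ apply: Def_const
          | def_hyp | def_user
          | apply: Def_and | apply: Def_or | apply: Def_iff | apply: Def_not
          | apply: Def_imp | apply: Def_ex2 | apply: Def_all | apply: Def_ex
          | apply: Def_mem
          | lazymatch goal with |- Def (fun g => asbool _ = asbool _) => apply Def_asbool_eq end
          | apply: Def_eq ]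
  | |- @DefT _ _ _ _ _ _ =>
    first [ apply: DefT_const
          | apply: DefT_var | apply: DefT_var1 | apply: DefT_var2
          | apply: DefT_var3 | apply: DefT_var4 | apply: DefT_var5
          | apply: DefT_var6 | apply: DefT_var7
          | def_hyp | def_user
          | lazymatch goal with |- DefT (fun g => proj1_sig _) => apply: DefT_val end
          | lazymatch goal with |- DefT (fun g => if _ then _ else _) => apply DefT_if end ]
  end; cbv beta.
Ltac def := cbv beta; repeat (assumption || def_step).

Lemma the_or_unique T (x0 : T) P v : unique P v -> the_or x0 P = v.
Proof.
move=> [Pv uv]; rewrite /the_or.
have := @ClassicalEpsilon.epsilon_spec _ (inhabits x0)
  (fun x => unique P x \/ ~ (exists! y, P y) /\ x = x0) _.
case=> [|[Pe _]|[n _]]; first by exists v; left; split.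
- by rewrite (uv _ Pe).
- by exfalso; apply: n; exists v; split.
Qed.

Lemma the_or_cases T (x0 : T) P :
  unique P (the_or x0 P) \/ ~ (exists! y, P y) /\ the_or x0 P = x0.
Proof.
have [[v uv]|n] := pselect (exists! y, P y); first by left; rewrite (the_or_unique x0 uv).
right; split=> //; rewrite /the_or.
have := @ClassicalEpsilon.epsilon_spec _ (inhabits x0)
  (fun x => unique P x \/ ~ (exists! y, P y) /\ x = x0) _.
case=> [|u|[_ //]]; first by exists x0; right.
by exfalso; apply: n; exists (ClassicalEpsilon.epsilon (inhabits x0)
  (fun x => unique P x \/ ~ (exists! y, P y) /\ x = x0)).
Qed.

Lemma the_unique {M : set_structure} (P : M -> Prop) v : unique P v -> the P = v.
Proof. exact: the_or_unique. Qed.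

Section BasicSets.
Context {M : set_structure} (hZF : ZF M).
Implicit Types a b c f n x y X Y : M.

Lemma set_of_ex (P : M -> Prop) :
  (exists c, forall x, x ∈ c <-> P x) -> forall x, x ∈ set_of P <-> P x.
Proof.
move=> [c cP]; rewrite /set_of (@the_unique _ _ c) //; split=> // d dP.
by apply: (zf_extensionality M hZF) => x; rewrite cP dP.
Qed.

Lemma set_of_sep (P : M -> Prop) a : (forall x, P x -> x ∈ a) ->
  Def (fun h : unit * M => P h.2) -> forall x, x ∈ set_of P <-> P x.
Proof.
move=> Pa dP; apply: set_of_ex; have [c cP] := separation hZF a dP.
by exists c => x; rewrite cP; split=> [[]|Px] //; split=> //; apply: Pa.
Qed.

Lemma in_empty x : x ∉ empty.
Proof.
rewrite /empty; apply: (@ClassicalEpsilon.epsilon_spec _ _ (fun e => forall x, x ∉ e)).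
by have [w [[e [_ He]] _]] := zf_infinity M hZF; exists e.
Qed.

Lemma empty_eq x : (forall y, y ∉ x) -> x = empty.
Proof. by move=> H; apply: (zf_extensionality M hZF) => y; split=> [/H|/in_empty]. Qed.

Lemma upairP a b x : x ∈ upair a b <-> x = a \/ x = b.
Proof. exact/set_of_ex/(zf_pairing M hZF). Qed.

Lemma opairP a b x : x ∈ opair a b <-> x = upair a a \/ x = upair a b.
Proof. exact: upairP. Qed.

Lemma opair_inj a b c d : opair a b = opair c d -> a = c /\ b = d.
Proof.
move=> e.
have E x : (x = upair a a \/ x = upair a b) <-> (x = upair c c \/ x = upair c d).
  by rewrite -!opairP e.
have in1 (u v : M) : u ∈ upair u v by apply/upairP; left.
have in2 (u v : M) : v ∈ upair u v by apply/upairP; right.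
have ac : a = c.
  case: (proj1 (E (upair a a)) (or_introl erefl)) => u.
    by have := in1 a a; rewrite u => /upairP[].
  by have := in1 c d; rewrite -u => /upairP[].
subst c; split=> //.
case: (proj1 (E (upair a b)) (or_intror erefl)) => u.
  have ba : b = a by have := in2 a b; rewrite u => /upairP[].
  subst b; case: (proj2 (E (upair a d)) (or_intror erefl)) => v;
    by have := in2 a d; rewrite v => /upairP[].
have := in2 a b; rewrite u => /upairP[ba|//].
by have := in2 a d; rewrite -u => /upairP[->|].
Qed.

Lemma powerP a x : x ∈ power a <-> subset x a.
Proof. exact/set_of_ex/(zf_powerset M hZF). Qed.

Lemma cup_ex a b : exists c, forall x, x ∈ c <-> x ∈ a \/ x ∈ b.
Proof.
have [c cP] := zf_union M hZF (upair a b); exists c => x; rewrite cP.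
split=> [[y [/upairP[->|->]]]|[|]]; [by left|by right| |].
- by exists a; split=> //; apply/upairP; left.
- by exists b; split=> //; apply/upairP; right.
Qed.

Lemma DefT_upair : DefT (fun h : unit * M * M => upair h.1.2 h.2).
Proof.
apply: (@DefT_unique _ _ _ _ _ (fun (h : unit * M * M) m =>
  forall x, x ∈ m <-> x = h.1.2 \/ x = h.2)).
- by move=> [[_ a] b] x /=; rewrite upairP.
- move=> [[_ a] b] m /= H; apply: (zf_extensionality M hZF) => x.
  by rewrite H upairP.
- by def.
Qed.

Lemma DefT_opair : DefT (fun h : unit * M * M => opair h.1.2 h.2).
Proof.
by apply: (DefT_comp2 DefT_upair); apply: (DefT_comp2 DefT_upair); def.
Qed.

End BasicSets.

Ltac def_pair :=
  match goal with
  | h : ZF _ |- DefT (fun g => upair _ _) => apply: (DefT_comp2 (DefT_upair h))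
  | h : ZF _ |- DefT (fun g => opair _ _) => apply: (DefT_comp2 (DefT_opair h))
  end.

Ltac def_user ::= def_pair.

Section Functions.
Context {M : set_structure} (hZF : ZF M).
Implicit Types a b c f n x y X Y : M.

Lemma prod_setP X Y p :
  p ∈ prod_set X Y <-> exists x y, x ∈ X /\ y ∈ Y /\ p = opair x y.
Proof.
have [c cP] := cup_ex hZF X Y.
apply: (set_of_sep hZF (a := power (power c))); last by def.
move=> {}p [x [y [xX [yY ->]]]]; apply/(powerP hZF) => u /(opairP hZF) ue.
apply/(powerP hZF) => v vu; apply/cP.
have [->|->] : v = x \/ v = y; [|by left|by right].
by case: ue vu => -> /(upairP hZF); tauto.
Qed.

Lemma DefT_prod_set_ : DefT (fun h : unit * M * M => prod_set h.1.2 h.2).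
Proof.
apply: (@DefT_unique _ _ _ _ _ (fun (h : unit * M * M) m => forall p : M,
  p ∈ m <-> exists x y : M, x ∈ h.1.2 /\ y ∈ h.2 /\ p = opair x y)).
- by case=> [[u X] Y] p; apply: prod_setP.
- case=> [[u X] Y] m /= H; apply: (zf_extensionality M hZF) => p.
  by rewrite H prod_setP.
- by def.
Qed.

Lemma fun_setP X Y f : f ∈ fun_set X Y <-> is_fun X Y f.
Proof.
apply: (set_of_sep hZF (a := power (prod_set X Y))).
  by move=> {}f [H _]; apply/(powerP hZF).
by rewrite /is_fun /Defs.subset /unique; def.
Qed.

Lemma is_fun_ex X Y f x : is_fun X Y f -> x ∈ X -> exists2 y, y ∈ Y & opair x y ∈ f.
Proof.
move=> [s t] /t[y [xy _]]; exists y => //.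
by have /prod_setP[u [v [_ [vY /(opair_inj hZF)[_ ->]]]]] := s _ xy.
Qed.

Lemma is_fun_unique X Y f x y y' :
  is_fun X Y f -> opair x y ∈ f -> opair x y' ∈ f -> y = y'.
Proof.
move=> [s t] xy xy'; have /prod_setP[u [v [uX [_ /(opair_inj hZF)[e _]]]]] := s _ xy.
have xX : x ∈ X by rewrite e.
by have [z [_ uz]] := t _ xX; rewrite -(uz _ xy) -(uz _ xy').
Qed.

Lemma appP X Y f x y : is_fun X Y f -> opair x y ∈ f -> app f x = y.
Proof.
move=> hf xy; apply: the_unique; split=> // z xz.
exact: is_fun_unique hf xy xz.
Qed.

Lemma app_in X Y f x : is_fun X Y f -> x ∈ X -> app f x ∈ Y.
Proof. by move=> hf /(is_fun_ex hf)[y yY xy]; rewrite (appP hf xy). Qed.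

Lemma opair_app X Y f x : is_fun X Y f -> x ∈ X -> opair x (app f x) ∈ f.
Proof. by move=> hf /(is_fun_ex hf)[y yY xy]; rewrite (appP hf xy). Qed.

Lemma in_fun X Y f p : is_fun X Y f -> p ∈ f -> exists2 x, x ∈ X & p = opair x (app f x).
Proof.
move=> hf pf; have [s _] := hf.
have /prod_setP[x [y [xX [_ e]]]] := s _ pf; exists x => //.
by rewrite e in pf *; rewrite (appP hf pf).
Qed.

Lemma is_fun_ext X Y Z f g : is_fun X Y f -> is_fun X Z g ->
  (forall x, x ∈ X -> app f x = app g x) -> f = g.
Proof.
move=> hf hg H; apply: (zf_extensionality M hZF) => p; split.
- move=> /(in_fun hf)[x xX ->]; rewrite H //; exact: opair_app hg xX.
- move=> /(in_fun hg)[x xX ->]; rewrite -H //; exact: opair_app hf xX.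
Qed.

Definition ap X Y (f : El (fun_set X Y)) (x : El X) : El Y :=
  exist _ (app (proj1_sig f) (proj1_sig x))
    (app_in (proj1 (fun_setP X Y _) (proj2_sig f)) (proj2_sig x)).

Lemma val_ap X Y (f : El (fun_set X Y)) (x : El X) :
  proj1_sig (ap f x) = app (proj1_sig f) (proj1_sig x).
Proof. by []. Qed.

Lemma ap_ext X Y (f g : El (fun_set X Y)) : (forall x : El X, ap f x = ap g x) -> f = g.
Proof.
move=> H; apply: El_inj.
have hf := proj1 (fun_setP X Y _) (proj2_sig f).
have hg := proj1 (fun_setP X Y _) (proj2_sig g).
apply: (is_fun_ext hf hg) => x xX.
exact: (congr1 (@proj1_sig _ _) (H (exist _ x xX))).
Qed.

Lemma DefT_ap_ X Y : DefT (fun h : unit * El (fun_set X Y) * El X => ap h.1.2 h.2).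
Proof.
apply: (@DefT_unique _ _ _ _ _ (fun (h : unit * El (fun_set X Y) * El X) (y : El Y) =>
   opair (proj1_sig h.2) (proj1_sig y) ∈ proj1_sig h.1.2)).
- move=> [[_ f] x] /=.
  exact: opair_app (proj1 (fun_setP X Y _) (proj2_sig f)) (proj2_sig x).
- move=> [[_ f] x] y /= H; apply: El_inj => /=.
  by rewrite (appP (proj1 (fun_setP X Y _) (proj2_sig f)) H).
- by def.
Qed.

(** A function between such types is internal as soon as it is definable. *)
Lemma lam_ex X Y (t : El X -> El Y) : DefT (fun h : unit * El X => t h.2) ->
  exists f : El (fun_set X Y), forall x : El X, ap f x = t x.
Proof.
move=> dt; pose P p := exists x : El X, p = opair (proj1_sig x) (proj1_sig (t x)).
have [f fP] : exists f, forall p, p ∈ f <-> P p.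
  exists (set_of P); apply: (set_of_sep hZF (a := prod_set X Y)).
    move=> p [[x xX] ->] /=; apply/prod_setP; exists x, (proj1_sig (t (exist _ x xX))).
    by split=> //; split=> //; exact: (proj2_sig (t _)).
  by rewrite /P; def.
have hf : is_fun X Y f.
  split=> [p /fP[[x xX] ->]|x xX].
    apply/prod_setP; exists x, (proj1_sig (t (exist _ x xX))).
    by split=> //; split=> //; exact: (proj2_sig (t _)).
  exists (proj1_sig (t (exist _ x xX))); split; first by apply/fP; exists (exist _ x xX).
  move=> y /fP[[x' x'X] /= /(opair_inj hZF)[e ->]]; subst x'.
  by rewrite (Prop_irrelevance xX x'X).
exists (exist _ f (proj2 (fun_setP X Y f) hf)) => x; apply: El_inj => /=.
by apply: appP hf _; apply/fP; exists x.
Qed.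

Lemma DefT_fn_ G (cG : @Ctx M G) X Y (t : G -> El (fun_set X Y)) (t' : G -> El X -> El Y) :
  (forall g (x : El X), ap (t g) x = t' g x) ->
  DefT (fun h : G * El X => t' h.1 h.2) -> DefT t.
Proof.
move=> E dt.
apply: (@DefT_unique _ _ _ _ _ (fun g (f : El (fun_set X Y)) => forall x : El X, ap f x = t' g x)) => //.
- by move=> g f H; apply: ap_ext => x; rewrite H E.
- apply: Def_all; apply: Def_eq; first by apply (DefT_comp2 (DefT_ap_ X Y)); def.
  apply: (Def_map (s := fun h : G * El (fun_set X Y) * El X * M => (h.1.1.1, h.1.2, h.2)) _ dt).
  apply: (ctx_map_pair (s := fun h : G * El (fun_set X Y) * El X => (h.1.1, h.2))).
  exact: (ctx_map_pair (s := fun h : G * El (fun_set X Y) => h.1)) (@ctx_map_fst _ _ _ _ _).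
Qed.

End Functions.

(** * Natural numbers and recursion inside the model *)

Ltac def_ap :=
  match goal with
  | h : ZF _ |- DefT (fun g => ap _ _ _) => apply: (DefT_comp2 (DefT_ap_ h _ _))
  | h : ZF _ |- DefT (fun g => prod_set _ _) => apply: (DefT_comp2 (DefT_prod_set_ h))
  end.
Ltac def_user ::= first [def_pair | def_ap].

Section Naturals.
Context {M : set_structure} (hZF : ZF M).
Local Notation N := (El (M := M) omega).
Local Notation ap := (ap hZF).

Lemma not_mem_self (x : M) : x ∉ x.
Proof.
move=> xx; have [y] : exists y, y ∈ upair x x by exists x; apply/(upairP hZF); left.
move=> yx; case: (zf_foundation M hZF (upair x x)); first by exists y.
move=> z [/(upairP hZF) zx H]; apply: (H x); last by apply/(upairP hZF); left.
by case: zx => ->.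
Qed.

Lemma mem_asym (x y : M) : x ∈ y -> y ∉ x.
Proof.
move=> xy yx; case: (zf_foundation M hZF (upair x y)).
  by exists x; apply/(upairP hZF); left.
move=> z [/(upairP hZF)[->|->] H].
- by apply: (H _ yx); apply/(upairP hZF); right.
- by apply: (H _ xy); apply/(upairP hZF); left.
Qed.

Lemma succP (n x : M) : x ∈ succ n <-> x ∈ n \/ x = n.
Proof.
apply: set_of_ex => //.
have [c cP] := cup_ex hZF n (upair n n); exists c => {}x.
by rewrite cP; split=> -[|H]; [by left| |by left|];
  right; [case/(upairP hZF): H|apply/(upairP hZF); left].
Qed.

Lemma succ_eq (n y : M) : (forall z, z ∈ y <-> z ∈ n \/ z = n) -> y = succ n.
Proof. by move=> H; apply: (zf_extensionality M hZF) => x; rewrite H succP. Qed.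

Lemma DefT_succ_ : DefT (fun h : unit * M => succ h.2).
Proof.
apply: (@DefT_unique _ _ _ _ _ (fun (h : unit * M) m => forall x, x ∈ m <-> x ∈ h.2 \/ x = h.2)).
- by case=> u n x /=; apply: succP.
- by case=> u n m /= H; apply: succ_eq.
- by def.
Qed.

Lemma omegaP (n : M) : n ∈ omega <-> forall X, empty ∈ X ->
  (forall k, k ∈ X -> succ k ∈ X) -> n ∈ X.
Proof.
have [w [[e [ew He]] Hw]] := zf_infinity M hZF.
have ds := DefT_succ_.
apply: (set_of_sep hZF (a := w)); last by def.
move=> {}n H; apply: H; first by rewrite -(empty_eq hZF He).
by move=> k /Hw[y [yw /succ_eq <-]].
Qed.

Definition O : N. Proof. by exists empty; apply/omegaP. Defined.
Definition S (n : N) : N.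
Proof.
exists (succ (proj1_sig n)); apply/omegaP => X X0 XS; apply: (XS).
exact: (proj1 (omegaP _) (proj2_sig n)).
Defined.

Lemma DefT_S_ : DefT (fun h : unit * N => S h.2).
Proof.
have ds := DefT_succ_.
apply: DefT_graph; apply: (@Def_ext _ _ _ (fun h : unit * N * N => proj1_sig h.2 = succ (proj1_sig h.1.2))).
  by move=> [[_ n] m] /=; split=> [e|-> //]; apply: El_inj.
by def.
Qed.

(** The numbers of the model may be nonstandard: induction needs the set of the numbers
    with the property, which separation provides for definable ones. *)
Lemma N_ind (P : N -> Prop) : Def (fun h : unit * N => P h.2) ->
  P O -> (forall n, P n -> P (S n)) -> forall n, P n.
Proof.
move=> dP P0 PS [n nw].
pose Q x := exists m : N, proj1_sig m = x /\ P m.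
have XP x : x ∈ set_of Q <-> Q x.
  by apply: (set_of_sep hZF (a := omega)) => [_ [[m mw] [<- _]] //|]; rewrite /Q; def.
have /XP[[m mw] [/= e Pm]] : n ∈ set_of Q.
  apply: (proj1 (omegaP n) nw); first by apply/XP; exists O.
  by move=> k /XP[m [<- Pm]]; apply/XP; exists (S m); split=> //; apply: PS.
by subst m; rewrite (Prop_irrelevance nw mw).
Qed.

Definition Nlt (n m : N) : Prop := proj1_sig n ∈ proj1_sig m.
Definition Nle (n m : N) : Prop := Nlt n (S m).

Lemma Def_Nlt_ : Def (fun h : unit * N * N => Nlt h.1.2 h.2).
Proof. by rewrite /Nlt; def. Qed.

Lemma Def_Nle_ : Def (fun h : unit * N * N => Nle h.1.2 h.2).
Proof. by have dS := DefT_S_; rewrite /Nle /Nlt; def. Qed.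

Lemma NltS n m : Nlt n (S m) <-> Nlt n m \/ n = m.
Proof.
rewrite /Nlt /= succP; split=> -[]; [by left|by right; apply: El_inj|by left|].
by move=> ->; right.
Qed.

Lemma NleP n m : Nle n m <-> Nlt n m \/ n = m.
Proof. exact: NltS. Qed.

Lemma NltO n : ~ Nlt n O.
Proof. exact: in_empty. Qed.

Lemma NltnS n : Nlt n (S n).
Proof. by apply/NltS; right. Qed.

Lemma Nlt_irr n : ~ Nlt n n.
Proof. exact: not_mem_self. Qed.

Lemma Nlt_trans n m k : Nlt n m -> Nlt m k -> Nlt n k.
Proof.
move: k; apply: (N_ind (P := fun k => Nlt n m -> Nlt m k -> Nlt n k)).
- by have dl := Def_Nlt_; def.
- by move=> _ /NltO.
- move=> k IH nm /NltS[mk|<-]; apply/NltS; left => //; exact: IH.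
Qed.

Lemma S_neqO n : S n <> O.
Proof. by move=> e; case: (@NltO n); rewrite -e; apply: NltnS. Qed.

Lemma S_inj n m : S n = S m -> n = m.
Proof.
move=> e; have := NltnS n; rewrite e => /NltS[nm|//].
have := NltnS m; rewrite -e => /NltS[mn|//].
by case: (mem_asym nm mn).
Qed.

Lemma N_case n : n = O \/ exists m, n = S m.
Proof.
move: n; apply: N_ind => [|| n _]; [|by left|by right; exists n].
by have dS := DefT_S_; def.
Qed.

Lemma Nlt_0S n : Nlt O (S n).
Proof.
move: n; apply: N_ind => [||n IH]; [|exact: NltnS|by apply/NltS; left].
by have dS := DefT_S_; have dl := Def_Nlt_; def.
Qed.

Lemma Nlt_SS n m : Nlt n m -> Nlt (S n) (S m).
Proof.
move: m; apply: (N_ind (P := fun m => Nlt n m -> Nlt (S n) (S m))) => [||m IH].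
- by have dS := DefT_S_; have dl := Def_Nlt_; def.
- by move=> /NltO.
- by move=> /NltS[/IH|->]; [move=> H; apply/NltS; left|exact: NltnS].
Qed.

Lemma Nlt_total n m : Nlt n m \/ n = m \/ Nlt m n.
Proof.
move: n; apply: N_ind => [||n IH].
- by have dl := Def_Nlt_; def.
- by case: (N_case m) => [->|[k ->]]; [right; left|left; apply: Nlt_0S].
- case: IH => [/Nlt_SS/NltS[|]|[<-|mn]]; [by left|by right; left| |].
  + by right; right; apply: NltnS.
  + by right; right; apply/NltS; left.
Qed.

Lemma Nlt_le n m : Nlt n m -> Nle n m. Proof. by move=> h; apply/NleP; left. Qed.
Lemma Nle_refl n : Nle n n. Proof. exact: NltnS. Qed.
Lemma Nle_O n : Nle O n. Proof. exact: Nlt_0S. Qed.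
Lemma Nnot_le n m : ~ Nle n m <-> Nlt m n.
Proof.
split=> [H|mn /NleP[nm|e]]; last by subst m; case: (Nlt_irr mn).
  by case: (Nlt_total n m) => [nm|[e|//]]; case: H; apply/NleP; [left|right].
by case: (mem_asym mn nm).
Qed.
Lemma Nnot_lt n m : ~ Nlt n m <-> Nle m n.
Proof.
split=> [H|H nm]; last by apply: (proj2 (Nnot_le m n)) nm H.
by apply: contrapT => H'; apply: H; apply/Nnot_le.
Qed.
Lemma Nle_lt_trans n m k : Nle n m -> Nlt m k -> Nlt n k.
Proof. by move=> /NleP[nm|-> //]; apply: Nlt_trans. Qed.
Lemma Nlt_le_trans n m k : Nlt n m -> Nle m k -> Nlt n k.
Proof. by move=> nm /NleP[|<- //]; apply: Nlt_trans. Qed.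
Lemma Nle_trans n m k : Nle n m -> Nle m k -> Nle n k.
Proof. exact: Nle_lt_trans. Qed.
Lemma NleO n : Nle n O -> n = O.
Proof. by move=> /NleP[/NltO|]. Qed.
Lemma Nle_lt_S n m : Nle (S n) m <-> Nlt n m.
Proof.
split=> [/NleP[|<-]|/Nlt_SS //]; last exact: NltnS.
exact: Nlt_trans (NltnS n).
Qed.
Lemma NleS n m : Nle n (S m) <-> Nle n m \/ n = S m.
Proof. exact: NleP. Qed.

Lemma Nle_antisym n m : Nle n m -> Nle m n -> n = m.
Proof. by move=> /NleP[nm|//] /NleP[mn|//]; case: (mem_asym nm mn). Qed.

Lemma N_wf (P : N -> Prop) : Def (fun h : unit * N => P h.2) ->
  (exists n, P n) -> exists n, P n /\ forall k, Nlt k n -> ~ P k.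
Proof.
move=> dP [n Pn]; apply: contrapT => H.
have : forall m, ~ (exists2 k, Nlt k m & P k).
  apply: N_ind => [||m IH].
  - by have dl := Def_Nlt_; def.
  - by move=> [k /NltO].
  - move=> [k /NltS[km|->] Pk]; first by apply: IH; exists k.
    by apply: H; exists m; split=> // j jm Pj; apply: IH; exists j.
by move=> /(_ (S n)); apply; exists n => //; apply: NltnS.
Qed.

Lemma mem_N (n : N) x : x ∈ proj1_sig n -> exists2 k : N, x = proj1_sig k & Nlt k n.
Proof.
move=> xn; suff xw : x ∈ omega by exists (exist _ x xw).
move: n xn; apply: N_ind => [|/(in_empty hZF) //|n IH /succP[/IH //|->]].
  by def.
exact: (proj2_sig n).
Qed.

(** Course-of-values recursion: a step that depends only on the values already
    defined is iterated through approximations that are total functions. *)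
Lemma cov_rec a (x0 : El a) (G : N -> El (fun_set omega a) -> El a) :
  DefT (fun h : unit * N * El (fun_set omega a) => G h.1.2 h.2) ->
  (forall n f g, (forall k, Nle k n -> ap f k = ap g k) -> G n f = G n g) ->
  exists f, ap f O = x0 /\ forall n, ap f (S n) = G n f.
Proof.
move=> dG cG; have dS := DefT_S_; have dl := Def_Nlt_; have dle := Def_Nle_.
pose good n f := ap f O = x0 /\ forall k, Nlt k n -> ap f (S k) = G k f.
have good_ex n : exists f, good n f.
  move: n; apply: N_ind => [||n [f [f0 fS]]].
  - by rewrite /good; def.
  - have [f fP] := lam_ex hZF (t := fun _ : N => x0) (DefT_const (G := unit * N) x0).
    by exists f; split=> [|k /NltO]; rewrite ?fP.
  - have dt : DefT (fun h : unit * N => if `[< h.2 = S n >] then G n f else ap f h.2).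
      by def.
    have [f' fP] := lam_ex hZF (t := fun k => if `[< k = S n >] then G n f else ap f k) dt.
    have E k : Nle k n -> ap f' k = ap f k.
      move=> kn; rewrite fP; case: asboolP => // e; subst k.
      by case: (Nlt_irr (proj1 (Nle_lt_S _ _) kn)).
    exists f'; split; first by rewrite E ?f0 //; apply: Nle_O.
    move=> k /NltS[kn|->].
      rewrite E; last by apply/Nle_lt_S.
      rewrite fS //; apply: cG => j jk; rewrite E //.
      exact: Nlt_le (Nle_lt_trans jk kn).
    rewrite fP; case: asboolP => // _; apply: cG => j jn; by rewrite E.
have uniq f g n : good n f -> good n g -> forall k, Nle k n -> ap f k = ap g k.
  move=> [f0 fS] [g0 gS].
  suff H : forall k, Nle k n -> forall j, Nle j k -> ap f j = ap g j.
    by move=> k kn; apply: (H k) => //; apply: Nle_refl.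
  apply: N_ind => [||k IH kn j /NleS[jk|->]].
  - by def.
  - by move=> _ j /NleO ->; rewrite f0 g0.
  - by apply: IH => //; apply: Nle_trans kn; apply: Nlt_le; apply: NltnS.
  - have kn' : Nlt k n by apply/Nle_lt_S.
    rewrite fS // gS //; apply: cG => i ik; apply: IH => //; exact: Nlt_le.
have mono n m f : Nle n m -> good m f -> good n f.
  by move=> nm [f0 fS]; split=> // k kn; apply: fS; apply: Nlt_le_trans nm.
pose t k := ap (projT1 (cid (good_ex k))) k.
have tE n f : good n f -> forall k, Nle k n -> t k = ap f k.
  move=> gf k kn; rewrite /t; apply: (uniq _ _ k); last exact: Nle_refl.
    exact: projT2 (cid (good_ex k)).
  exact: mono gf.
have [h hP] := lam_ex hZF (t := t) ltac:(apply: (@DefT_unique _ _ _ _ _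
  (fun (h : unit * N) y => exists f, good h.2 f /\ ap f h.2 = y));
  [by move=> [_ k] /=; exists (projT1 (cid (good_ex k))); split=> //; apply: projT2 (cid (good_ex k))
  |by move=> [_ k] y /= [f [gf <-]]; rewrite (tE k f) //; apply: Nle_refl
  |by rewrite /good; def]).
exists h; split=> [|n].
  by have [f gf] := good_ex O; rewrite hP (tE _ _ gf) ?(proj1 gf) //; apply: Nle_refl.
have [f gf] := good_ex (S n); rewrite hP (tE _ _ gf); last exact: Nle_refl.
rewrite (proj2 gf) //; last exact: NltnS.
apply: cG => k kn; rewrite hP (tE _ _ gf) //; apply: Nle_trans kn _.
exact: Nlt_le (NltnS n).
Qed.

Lemma cov_unique a (G : N -> El (fun_set omega a) -> El a) (f g : El (fun_set omega a)) :
  (forall n f g, (forall k, Nle k n -> ap f k = ap g k) -> G n f = G n g) ->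
  ap f O = ap g O -> (forall n, ap f (S n) = G n f) -> (forall n, ap g (S n) = G n g) ->
  f = g.
Proof.
move=> cG e0 fS gS; suff H : forall n k, Nle k n -> ap f k = ap g k.
  by apply: ap_ext => n; apply: (H n); apply: Nle_refl.
have dle := Def_Nle_; apply: N_ind => [|k /NleO -> //|n IH k /NleS[/IH //|->]].
  by def.
by rewrite fS gS; apply: cG.
Qed.

Lemma rec_ex a (x0 : El a) (s : N -> El a -> El a) :
  DefT (fun h : unit * N * El a => s h.1.2 h.2) ->
  exists f, ap f O = x0 /\ forall n, ap f (S n) = s n (ap f n).
Proof.
move=> ds; apply: cov_rec; first by def.
by move=> n f g -> //; apply: Nle_refl.
Qed.

End Naturals.

Ltac def_nat :=
  match goal with
  | h : ZF _ |- DefT (fun g => S _ _) => apply: (DefT_comp1 (DefT_S_ h))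
  | h : ZF _ |- Def (fun g => Nlt _ _) => apply: (Def_comp2 (Def_Nlt_ (M := _)))
  | h : ZF _ |- Def (fun g => Nle _ _ _) => apply: (Def_comp2 (Def_Nle_ h))
  end.
Ltac def_user ::= first [def_pair | def_ap | def_nat].

(** * The binary tree *)

Section Tree.
Context {M : set_structure} (hZF : ZF M).
Local Notation N := (El (M := M) omega).
Local Notation "a ~> b" := (El (fun_set a b)) (at level 60, right associativity).
Local Notation ap := (ap hZF).
Local Notation O := (O hZF).
Local Notation S := (S hZF).
Local Notation Nle := (Nle hZF).

Definition dbl_fun : El (fun_set omega omega) :=
  projT1 (cid (rec_ex hZF (s := fun _ m : N => S (S m)) O ltac:(def))).
Definition dbl (n : N) : N := ap dbl_fun n.

Lemma dblO : dbl O = O.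
Proof. exact: proj1 (projT2 (cid (rec_ex _ _ _))). Qed.
Lemma dblS n : dbl (S n) = S (S (dbl n)).
Proof. exact: proj2 (projT2 (cid (rec_ex _ _ _))) n. Qed.

Lemma DefT_dbl_ : DefT (fun h : unit * N => dbl h.2).
Proof. by rewrite /dbl; def. Qed.

Lemma dbl_neqS n m : dbl n <> S (dbl m).
Proof.
have dd := DefT_dbl_; move: n m; apply: N_ind => [|m|n IH m]; first by def.
  by rewrite dblO => /esym/S_neqO.
rewrite dblS => /S_inj; case: (N_case hZF m) => [->|[k ->]].
  by rewrite dblO => /S_neqO.
by rewrite dblS => /S_inj; apply: IH.
Qed.

Lemma dbl_inj n m : dbl n = dbl m -> n = m.
Proof.
have dd := DefT_dbl_; move: n m; apply: N_ind => [|m|n IH m]; first by def.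
  case: (N_case hZF m) => [->|[k ->]] //.
  by rewrite dblO dblS => /esym/S_neqO.
case: (N_case hZF m) => [->|[k ->]]; first by rewrite dblO dblS => /S_neqO.
by rewrite !dblS => /S_inj/S_inj/IH ->.
Qed.

Lemma parity n : exists t, n = dbl t \/ n = S (dbl t).
Proof.
have dd := DefT_dbl_; move: n; apply: N_ind => [||n [t [->|->]]]; first by def.
- by exists O; left; rewrite dblO.
- by exists t; right.
- by exists (S t); left; rewrite dblS.
Qed.

Lemma le_dbl n : Nle n (dbl n).
Proof.
have dd := DefT_dbl_; move: n; apply: N_ind => [||n IH]; first by def.
- exact: Nle_O.
- rewrite dblS; apply/Nle_lt_S; apply: Nle_lt_trans IH _; exact/Nlt_le/NltnS.
Qed.

Lemma dbl_Nle n m : Nle n m -> Nle (dbl n) (dbl m).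
Proof.
have dd := DefT_dbl_; move: m; apply: N_ind => [||m IH]; first by def.
  by move=> /NleO ->; apply: Nle_refl.
move=> /NleS[/IH h|->]; last exact: Nle_refl.
rewrite dblS; apply: Nle_trans h _; apply: Nlt_le.
exact: Nlt_trans (NltnS _ _) (NltnS _ _).
Qed.

(** The nodes are coded by natural numbers, with root 0 and children 2 t + 1 and
   2 t + 2: every natural number is a node. *)
Definition ch (b : bool) (t : N) : N := if b then S (S (dbl t)) else S (dbl t).
Arguments ch : simpl never.

Lemma DefT_ch_ b : DefT (fun h : unit * N => ch b h.2).
Proof. by have dd := DefT_dbl_; rewrite /ch; case: b; def. Qed.

Lemma DefT_chb G (cG : @Ctx M G) (P : G -> Prop) (t : G -> N) :
  Def P -> DefT t -> DefT (fun g => ch `[< P g >] (t g)).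
Proof.
move=> dP dt; rewrite /ch; have dd := DefT_dbl_.
apply DefT_if => //; def.
Qed.

Lemma ch_inj b c t u : ch b t = ch c u -> b = c /\ t = u.
Proof.
by rewrite /ch; case: b c => -[] => [/S_inj/S_inj/dbl_inj|/S_inj/esym/dbl_neqS
  |/S_inj/dbl_neqS|/S_inj/dbl_inj] //.
Qed.

Lemma ch_neqO b t : ch b t <> O.
Proof. by case: b => /S_neqO. Qed.

Lemma lt_ch b t : Nlt t (ch b t).
Proof.
case: b; last exact: le_dbl.
exact: Nlt_trans (le_dbl t) (NltnS _ _).
Qed.

Lemma node_case n : n = O \/ exists b t, n = ch b t.
Proof.
case: (N_case hZF n) => [->|[m ->]]; [by left|right].
by have [t [->|->]] := parity m; [exists false|exists true]; exists t.
Qed.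

Lemma tree_ind (P : N -> Prop) : Def (fun h : unit * N => P h.2) ->
  P O -> (forall b t, P t -> P (ch b t)) -> forall t, P t.
Proof.
move=> dP P0 PS t; apply: contrapT => nP.
have [n [nPn H]] := N_wf hZF (P := fun n => ~ P n) ltac:(def) (ex_intro _ t nP).
case: (node_case n) => [e|[b [u e]]]; subst n; first by [].
by apply: nPn; apply: PS; apply: contrapT; apply: H; apply: lt_ch.
Qed.

Lemma par_ex n : exists t, (n = O /\ t = O) \/ n = ch false t \/ n = ch true t.
Proof.
case: (node_case n) => [->|[b [t ->]]]; first by exists O; left.
by exists t; right; case: b; [right|left].
Qed.
Definition par n := projT1 (cid (par_ex n)).

Lemma par_ch b t : par (ch b t) = t.
Proof.
rewrite /par; case: cid => u /= [[/ch_neqO //]|].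
by case=> /ch_inj[].
Qed.

Lemma DefT_par_ : DefT (fun h : unit * N => par h.2).
Proof.
have d b := DefT_ch_ b.
apply: (@DefT_unique _ _ _ _ _ (fun (h : unit * N) t =>
  (h.2 = O /\ t = O) \/ h.2 = ch false t \/ h.2 = ch true t)).
- by case=> u n /=; rewrite /par; case: cid.
- case=> u n t /= [[-> ->]|[->|->]]; rewrite ?par_ch //.
  by rewrite /par; case: cid => v /= [[]|[/esym/ch_neqO|/esym/ch_neqO]].
- by have df := d false; have dt := d true; def.
Qed.

Definition lastbit n : bool := `[< exists t, n = ch true t >].
Lemma lastbit_ch b t : lastbit (ch b t) = b.
Proof.
rewrite /lastbit; case: asboolP => [[u /ch_inj[-> //]]|H].
by case: b H => // H; case: H; exists t.
Qed.

(** Recursion along the tree is course-of-values recursion on the codes. *)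
Lemma tree_rec a (x0 : El a) (s : bool -> N -> El a -> El a) :
  (forall b, DefT (fun h : unit * N * El a => s b h.1.2 h.2)) ->
  exists f, ap f O = x0 /\ forall b t, ap f (ch b t) = s b t (ap f t).
Proof.
move=> ds; have dt := ds true; have df := ds false.
have dp := DefT_par_; have dc := DefT_ch_ true.
pose G n f := if `[< exists t, S n = ch true t >]
  then s true (par (S n)) (ap f (par (S n))) else s false (par (S n)) (ap f (par (S n))).
have par_le n : Nle (par (S n)) n.
  by case: (node_case (S n)) => [/S_neqO //|[b [t e]]]; rewrite e par_ch /Nle e; apply: lt_ch.
have [||f [f0 fS]] := @cov_rec _ hZF a x0 G.
- by rewrite /G; def.
- by move=> n f g E; rewrite /G !E.
exists f; split=> // b t.
have [/ch_neqO //|[n e]] := N_case hZF (ch b t).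
rewrite e fS /G -e par_ch; case: asboolP => [[u /ch_inj[-> //]]|H].
by case: b e H => // e H; case: H; exists t.
Qed.

(** A branch is coded by an internal function, the bit of a number being whether
   it is nonzero. *)
Definition bit (n : N) : bool := `[< n <> O >].

Lemma DefT_chbit G (cG : @Ctx M G) (n t : G -> N) :
  DefT n -> DefT t -> DefT (fun g => ch (bit (n g)) (t g)).
Proof. by move=> dn dt; apply: (DefT_chb (P := fun g => n g <> O)) => //; def. Qed.

End Tree.

Ltac def_tree :=
  match goal with
  | h : ZF _ |- DefT (fun g => ch _ (bit _ _) _) => apply (DefT_chbit h)
  | h : ZF _ |- DefT (fun g => ch _ (asbool _) _) => apply (DefT_chb h)
  | h : ZF _ |- DefT (fun g => ch _ ?b _) => apply: (DefT_comp1 (DefT_ch_ h b))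
  | h : ZF _ |- DefT (fun g => dbl _ _) => apply: (DefT_comp1 (DefT_dbl_ h))
  | h : ZF _ |- DefT (fun g => par _ _) => apply: (DefT_comp1 (DefT_par_ h))
  end.
Ltac def_user ::= first [def_pair | def_ap | def_nat | def_tree].

Section Branches.
Context {M : set_structure} (hZF : ZF M).
Local Notation N := (El (M := M) omega).
Local Notation Br := (El (M := M) (fun_set omega omega)).
Local Notation ap := (ap hZF).
Local Notation O := (O hZF).
Local Notation S := (S hZF).
Local Notation Nle := (Nle hZF).
Local Notation ch := (ch hZF).
Local Notation bit := (bit hZF).

Definition len_fun : El (fun_set omega omega) :=
  projT1 (cid (@tree_rec _ hZF omega O (fun _ _ m => S m) ltac:(move=> b; def))).
Definition len (t : N) : N := ap len_fun t.
Lemma lenO : len O = O.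
Proof. exact: proj1 (projT2 (cid (@tree_rec _ _ _ _ _ _))). Qed.
Lemma len_ch b t : len (ch b t) = S (len t).
Proof. exact: proj2 (projT2 (cid (@tree_rec _ _ _ _ _ _))) b t. Qed.
Lemma DefT_len_ : DefT (fun h : unit * N => len h.2).
Proof. by rewrite /len; def. Qed.

Lemma pre_ex (z : Br) : exists p : Br, ap p O = O /\
  forall n, ap p (S n) = ch (bit (ap z n)) (ap p n).
Proof.
apply: (@rec_ex _ hZF omega O (fun n t => ch (bit (ap z n)) t)).
by def.
Qed.
Definition path (z : Br) : Br := projT1 (cid (pre_ex z)).
Definition pre (z : Br) (n : N) : N := ap (path z) n.
Lemma preO z : pre z O = O.
Proof. exact: proj1 (projT2 (cid (pre_ex z))). Qed.
Lemma preS z n : pre z (S n) = ch (bit (ap z n)) (pre z n).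
Proof. exact: proj2 (projT2 (cid (pre_ex z))) n. Qed.

Lemma DefT_path_ : DefT (fun h : unit * Br => path h.2).
Proof.
apply: (@DefT_unique _ _ _ _ _ (fun (h : unit * Br) (p : Br) =>
  ap p O = O /\ forall n, ap p (S n) = ch (bit (ap h.2 n)) (ap p n))).
- by case=> u z; apply: (projT2 (cid (pre_ex z))).
- case=> u z p /= [p0 pS]; apply: ap_ext; apply: N_ind; first by def.
    by rewrite p0 -[RHS]/(pre z O) preO.
  by move=> n e; rewrite pS -[RHS]/(pre z _) preS e.
- by def.
Qed.

Lemma DefT_pre_ : DefT (fun h : unit * Br * N => pre h.1.2 h.2).
Proof. by have d := DefT_path_; rewrite /pre; def. Qed.

Lemma len_pre z n : len (pre z n) = n.
Proof.
have dl := DefT_len_; have dp := DefT_pre_.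
move: n; apply: N_ind => [||n IH]; [by def|by rewrite preO lenO|].
by rewrite preS len_ch IH.
Qed.

Lemma branch (P : N -> Prop) : Def (fun h : unit * N => P h.2) ->
  P O -> (forall t, P t -> exists b, P (ch b t)) ->
  exists z : Br, forall n, P (pre z n).
Proof.
move=> dP P0 PS.
have [|p [p0 pS]] := @rec_ex _ hZF omega O (fun _ t => ch `[< P (ch true t) >] t).
  by def.
have [|z zP] := @lam_ex _ hZF omega omega (fun n => if `[< P (ch true (ap p n)) >] then S O else O).
  by def.
have E n : pre z n = ap p n.
  have dp := DefT_pre_; move: n; apply: N_ind => [||n IH]; [by def|by rewrite preO|].
  rewrite preS pS IH; congr ch; rewrite /bit zP.
  case: ifP => _; apply/asboolP => //; exact: S_neqO.
exists z; apply: N_ind => [||n]; first by have dp := DefT_pre_; def.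
  by rewrite preO.
rewrite !E pS => /PS[b Pb]; case: asboolP => // H.
by case: b Pb.
Qed.

Definition upd_ex a (f : El (fun_set omega a)) (n : N) (x : El a) :
  exists g : El (fun_set omega a), forall k, ap g k = if `[< k = n >] then x else ap f k.
Proof. by apply: lam_ex; def. Qed.
Definition upd a (f : El (fun_set omega a)) (n : N) (x : El a) := projT1 (cid (upd_ex f n x)).
Lemma updE a (f : El (fun_set omega a)) n x k :
  ap (upd f n x) k = if `[< k = n >] then x else ap f k.
Proof. exact: projT2 (cid (upd_ex f n x)) k. Qed.
Lemma upd_eq a (f : El (fun_set omega a)) n x : ap (upd f n x) n = x.
Proof. by rewrite updE asboolT. Qed.
Lemma upd_neq a (f : El (fun_set omega a)) n x k : k <> n -> ap (upd f n x) k = ap f k.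
Proof. by move=> e; rewrite updE asboolF. Qed.
Lemma DefT_upd_ a : DefT (fun h : unit * El (fun_set omega a) * N * El a => upd h.1.1.2 h.1.2 h.2).
Proof.
apply: (DefT_fn_ (hZF := hZF) (t' := fun (h : unit * El (fun_set omega a) * N * El a) (k : N) =>
  if `[< k = h.1.2 >] then h.2 else ap h.1.1.2 k)).
- by case=> [[[u f] n] x] k; rewrite updE.
- by def.
Qed.

(** Compactness of the space of branches: some level misses a set of nodes that
    contains no branch.  [alive n t] says that t has a descendant n levels below
    it along which the set holds. *)
Section Konig.
Variables (Q : N -> Prop) (dQ : Def (fun h : unit * N => Q h.2)).
Lemma alive_ex : exists r : El (fun_set omega (fun_set omega omega)),
  (forall t, ap (ap r O) t = if `[< Q t >] then S O else O) /\
  forall n t, ap (ap r (S n)) t =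
    if `[< Q t /\ (ap (ap r n) (ch false t) <> O \/ ap (ap r n) (ch true t) <> O) >]
    then S O else O.
Proof.
have [|r0 r0P] := @lam_ex _ hZF omega omega (fun t => if `[< Q t >] then S O else O).
  by def.
pose stp (f : Br) (t : N) := if `[< Q t /\ (ap f (ch false t) <> O \/ ap f (ch true t) <> O) >]
    then S O else O.
have ds f : DefT (fun h : unit * N => stp f h.2) by rewrite /stp; def.
pose s (_ : N) (f : Br) : Br := projT1 (cid (lam_ex hZF (ds f))).
have sP n f t : ap (s n f) t = stp f t := projT2 (cid (lam_ex hZF (ds f))) t.
have [|r [rO rS]] := @rec_ex _ hZF _ r0 s.
  apply: (DefT_fn_ (hZF := hZF) (t' := fun (h : unit * N * Br) (k : N) => stp h.2 k)) => //.
  by rewrite /stp; def.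
by exists r; split=> [t|n t]; rewrite ?rO ?rS ?r0P ?sP.
Qed.
Definition alive (n t : N) : Prop := ap (ap (projT1 (cid alive_ex)) n) t <> O.

Lemma if_neqO (P : Prop) : (if `[< P >] then S O else O) <> O <-> P.
Proof. by case: asboolP => p; split=> // _; apply: S_neqO. Qed.
Lemma aliveO t : alive O t <-> Q t.
Proof. by rewrite /alive (proj1 (projT2 (cid alive_ex))) if_neqO. Qed.
Lemma aliveS n t : alive (S n) t <-> Q t /\ exists b, alive n (ch b t).
Proof.
rewrite /alive (proj2 (projT2 (cid alive_ex))) if_neqO.
split=> [[q [H|H]]|[q [b H]]]; split=> //; [by exists false|by exists true|].
by case: b H => H; [right|left].
Qed.
Lemma Def_alive_ : Def (fun h : unit * N * N => alive h.1.2 h.2).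
Proof. by rewrite /alive; def. Qed.

Lemma konig : (forall n, alive n O) -> exists z : Br, forall n, Q (pre z n).
Proof.
move=> H; have da := Def_alive_.
have mono1 n : forall t, alive (S n) t -> alive n t.
  move: n; apply: N_ind => [||n IH]; first by def.
    by move=> t /aliveS[q _]; apply/aliveO.
  by move=> t /aliveS[q [b /IH a]]; apply/aliveS; split=> //; exists b.
have mono m n t : Nle n m -> alive m t -> alive n t.
  move: m; apply: N_ind => [||m IH]; first by def.
    by move=> /NleO ->.
  by move=> /NleS[nm /mono1|-> //]; apply: IH.
have [|//|t Ht|z zP] := @branch (fun t => forall n, alive n t); first by def.
  apply: contrapT => /forallNP nH.
  have /existsNP[n0 H0] := nH false; have /existsNP[n1 H1] := nH true.
  have [m [m0 m1]] : exists m, Nle n0 m /\ Nle n1 m.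
    case: (Nlt_total hZF n0 n1) => [l|[->|l]].
    - by exists n1; split; [apply: Nlt_le|apply: Nle_refl].
    - by exists n1; split; apply: Nle_refl.
    - by exists n0; split; [apply: Nle_refl|apply: Nlt_le].
  by have /aliveS[_ [[] a]] := Ht (S m); [apply: H1; apply: mono m1 a|apply: H0; apply: mono m0 a].
by exists z => n; apply/aliveO/zP.
Qed.
End Konig.

End Branches.

Ltac def_branch :=
  match goal with
  | h : ZF _ |- DefT (fun g => len _ _) => apply: (DefT_comp1 (DefT_len_ h))
  | h : ZF _ |- DefT (fun g => pre _ _ _) => apply: (DefT_comp2 (DefT_pre_ h))
  | h : ZF _ |- DefT (fun g => path _ _) => apply: (DefT_comp1 (DefT_path_ h))
  | h : ZF _ |- DefT (fun g => upd _ _ _ _) => apply: (DefT_comp3 (DefT_upd_ h _))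
  end.
Ltac def_user ::= first [def_pair | def_ap | def_nat | def_tree | def_branch].

(** * The real numbers of the model as an ordered field *)

(** The hypotheses are arguments so that instances can be found from the type. *)
Definition PreReal {M : set_structure} (R : field_data M) (_ : ZF M)
  (_ : is_real_field R) : Type := El (reals R).

Section RealField.
Context {M : set_structure} (hZF : ZF M) (R : field_data M) (hR : is_real_field R).

Local Notation Real := (PreReal hZF hR).
Implicit Types x y z : Real.

Let mk (m : M) (h : m ∈ reals R) : Real := exist _ m h.
Let v (x : Real) : M := proj1_sig x.
Let vin (x : Real) : v x ∈ reals R := proj2_sig x.

Lemma opair_in (X Y x y : M) : x ∈ X -> y ∈ Y -> opair x y ∈ prod_set X Y.
Proof. by move=> xX yY; apply/(prod_setP hZF); exists x, y. Qed.

Lemma radd_in x y : radd R (v x) (v y) ∈ reals R.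
Proof. exact: (app_in hZF (radd_fun R hR) (opair_in (vin x) (vin y))). Qed.
Lemma rmul_in x y : rmul R (v x) (v y) ∈ reals R.
Proof. exact: (app_in hZF (rmul_fun R hR) (opair_in (vin x) (vin y))). Qed.

Definition real_add x y : Real := mk (radd_in x y).
Definition real_mul x y : Real := mk (rmul_in x y).
Definition real_zero : Real := mk (rzero_in R hR).
Definition real_one : Real := mk (rone_in R hR).

Lemma real_opp_ex x : exists y, real_add x y = real_zero.
Proof.
have [y [yR e]] := raddN R hR _ (vin x).
by exists (mk yR); apply: El_inj.
Qed.
Definition real_opp x : Real := projT1 (cid (real_opp_ex x)).

Lemma real_inv_ex x : exists y, (x <> real_zero -> real_mul x y = real_one) /\ (x = real_zero -> y = real_zero).
Proof.
have [->|n] := pselect (x = real_zero); first by exists real_zero.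
have [|y [yR e]] := rmulV R hR _ (vin x).
  by move=> e; apply: n; apply: El_inj.
by exists (mk yR); split=> // _; apply: El_inj.
Qed.
Definition real_inv x : Real := projT1 (cid (real_inv_ex x)).

Let addA : associative real_add.
Proof. by move=> x y z; apply: El_inj; apply: (raddA R hR); apply: vin. Qed.
Let addC : commutative real_add.
Proof. by move=> x y; apply: El_inj; apply: (raddC R hR); apply: vin. Qed.
Let add0 : left_id real_zero real_add.
Proof. by move=> x; rewrite addC; apply: El_inj; apply: (radd0 R hR); apply: vin. Qed.
Let addN : left_inverse real_zero real_opp real_add.
Proof. by move=> x; rewrite addC; apply: (projT2 (cid (real_opp_ex x))). Qed.
Let mulA : associative real_mul.
Proof. by move=> x y z; apply: El_inj; apply: (rmulA R hR); apply: vin. Qed.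
Let mulC : commutative real_mul.
Proof. by move=> x y; apply: El_inj; apply: (rmulC R hR); apply: vin. Qed.
Let mul1 : left_id real_one real_mul.
Proof. by move=> x; rewrite mulC; apply: El_inj; apply: (rmul1 R hR); apply: vin. Qed.
Let mulD : left_distributive real_mul real_add.
Proof.
move=> x y z; rewrite mulC (mulC x) (mulC y); apply: El_inj.
by apply: (rmulDr R hR); apply: vin.
Qed.

HB.instance Definition _ := gen_eqMixin Real.
HB.instance Definition _ := gen_choiceMixin Real.
HB.instance Definition _ := GRing.isZmodule.Build Real addA addC add0 addN.

Let one_neq0 : real_one != 0%R.
Proof. by apply/eqP => e; apply: (rone_neq0 R hR); apply: (congr1 v e). Qed.

HB.instance Definition _ :=
  GRing.Zmodule_isComNzRing.Build Real mulA mulC mul1 mulD one_neq0.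

Let mulV : forall x, x != 0%R -> (real_inv x * x)%R = 1%R.
Proof.
move=> x /eqP x0; rewrite mulrC; exact: (proj1 (projT2 (cid (real_inv_ex x)))).
Qed.
Let inv0 : real_inv 0%R = 0%R.
Proof. exact: (proj2 (projT2 (cid (real_inv_ex real_zero)))). Qed.

HB.instance Definition _ := GRing.ComNzRing_isField.Build Real mulV inv0.

Definition real_le x y : bool := `[< rle R (v x) (v y) >].
Let lt_ x y : bool := (y != x) && real_le x y.
Let norm x : Real := if real_le 0%R x then x else (- x)%R.

Let le_add z x y : real_le x y -> real_le (x + z)%R (y + z)%R.
Proof. by move=> /asboolP h; apply/asboolP; apply: (rle_add R hR _ _ _ (vin z)). Qed.
Let le_refl_ x : real_le x x.
Proof. by apply/asboolP; apply: (rle_refl R hR); apply: vin. Qed.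
Let le_tr x y z : real_le x y -> real_le y z -> real_le x z.
Proof. by move=> /asboolP h /asboolP k; apply/asboolP; apply: (rle_trans R hR _ _ _ h k). Qed.

Let le0_add x y : real_le 0%R x -> real_le 0%R y -> real_le 0%R (x + y)%R.
Proof.
move=> hx hy; apply: (le_tr hy); have := le_add y hx.
by rewrite add0r.
Qed.
Let le0_mul x y : real_le 0%R x -> real_le 0%R y -> real_le 0%R (x * y)%R.
Proof. by move=> /asboolP h /asboolP k; apply/asboolP; apply: (rle_mul R hR _ _ h k). Qed.
Let le0_anti x : real_le 0%R x -> real_le x 0%R -> x = 0%R.
Proof.
move=> /asboolP h /asboolP k; apply: El_inj; exact: (rle_antisym R hR _ _ k h).
Qed.
Let sub_ge0 x y : real_le 0%R (y - x)%R = real_le x y.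
Proof.
apply/idP/idP => [/(le_add x)|/(le_add (- x)%R)].
  by rewrite add0r subrK.
by rewrite subrr.
Qed.
Let le0_total x : real_le 0%R x || real_le x 0%R.
Proof.
case: (rle_total R hR _ _ (vin 0%R) (vin x)) => h; apply/orP; [left|right]; exact/asboolP.
Qed.
Let normN x : norm (- x)%R = norm x.
Proof.
rewrite /norm; have := le0_total x; have E : real_le 0%R (- x)%R = real_le x 0%R.
  by rewrite -(sub_ge0 x) sub0r.
rewrite E; case: ifP => h; case: ifP => k //= _; rewrite ?opprK //.
by rewrite (le0_anti k h) oppr0.
Qed.
Let ge0_norm x : real_le 0%R x -> norm x = x.
Proof. by rewrite /norm => ->. Qed.
Let lt_def x y : lt_ x y = (y != x) && real_le x y.
Proof. by []. Qed.

HB.instance Definition _ := Num.IntegralDomain_isLeReal.Build Real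
  le0_add le0_mul le0_anti sub_ge0 le0_total normN ge0_norm lt_def.

(** The field structure is sealed, so that no computation ever unfolds it. *)
Lemma real_field_ex : exists c : Num.RealField.axioms_ (El (reals R)),
  let F := Num.RealField.Pack c in
  [/\ forall x y : F, proj1_sig (x + y)%R = radd R (proj1_sig x) (proj1_sig y),
      forall x y : F, proj1_sig (x * y)%R = rmul R (proj1_sig x) (proj1_sig y),
      proj1_sig (0%R : F) = rzero R, proj1_sig (1%R : F) = rone R &
      forall x y : F, rle R (proj1_sig x) (proj1_sig y) <-> (x <= y)%R].
Proof.
exists (Num.RealField.class Real); split=> // x y.
by split=> [h|h]; apply/asboolP.
Qed.

End RealField.

Section SealedReals.
Context {M : set_structure} (hZF : ZF M) (R : field_data M) (hR : is_real_field R).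

Definition Real : realFieldType :=
  Num.RealField.Pack (projT1 (cid (real_field_ex hZF hR))).
Arguments Real : simpl never.
Implicit Types x y : Real.

Lemma code_add x y : proj1_sig (x + y)%R = radd R (proj1_sig x) (proj1_sig y).
Proof. by rewrite /Real; case: (projT2 (cid (real_field_ex hZF hR))). Qed.
Lemma code_mul x y : proj1_sig (x * y)%R = rmul R (proj1_sig x) (proj1_sig y).
Proof. by rewrite /Real; case: (projT2 (cid (real_field_ex hZF hR))). Qed.
Lemma code_0 : proj1_sig (0%R : Real) = rzero R.
Proof. by rewrite /Real; case: (projT2 (cid (real_field_ex hZF hR))). Qed.
Lemma code_1 : proj1_sig (1%R : Real) = rone R.
Proof. by rewrite /Real; case: (projT2 (cid (real_field_ex hZF hR))). Qed.
Lemma rleP x y : rle R (proj1_sig x) (proj1_sig y) <-> (x <= y)%R.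
Proof. by move: x y; rewrite /Real; case: (projT2 (cid (real_field_ex hZF hR))). Qed.

End SealedReals.
Arguments Real : simpl never.
Arguments Num.RealField.sort : simpl never.

Local Open Scope ring_scope.

Section RealDefinability.
Context {M : set_structure} (hZF : ZF M) (R : field_data M) (hR : is_real_field R).
Local Notation N := (El (M := M) omega).
Local Notation F := (Real hZF hR).
Local Notation SR := (El (M := M) (fun_set omega (reals R))).

Global Instance Rep_Real : @Rep M F := Rep_El (reals R).

Lemma DefT_radd_ : DefT (fun h : unit * F * F => h.1.2 + h.2).
Proof.
apply: (@DefT_unique _ _ _ _ _ (fun (h : unit * F * F) (y : F) =>
  opair (opair (proj1_sig h.1.2) (proj1_sig h.2)) (proj1_sig y) ∈ radd_graph R)).
- case=> [[u x] y] /=; rewrite code_add.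
  exact: (opair_app hZF (radd_fun R hR) (opair_in hZF (proj2_sig x) (proj2_sig y))).
- case=> [[u x] y] z /= H; apply: El_inj; rewrite code_add.
  by rewrite /radd (appP hZF (radd_fun R hR) H).
- by def.
Qed.

Lemma DefT_rmul_ : DefT (fun h : unit * F * F => h.1.2 * h.2).
Proof.
apply: (@DefT_unique _ _ _ _ _ (fun (h : unit * F * F) (y : F) =>
  opair (opair (proj1_sig h.1.2) (proj1_sig h.2)) (proj1_sig y) ∈ rmul_graph R)).
- case=> [[u x] y] /=; rewrite code_mul.
  exact: (opair_app hZF (rmul_fun R hR) (opair_in hZF (proj2_sig x) (proj2_sig y))).
- case=> [[u x] y] z /= H; apply: El_inj; rewrite code_mul.
  by rewrite /rmul (appP hZF (rmul_fun R hR) H).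
- by def.
Qed.

Lemma Def_rle_ : Def (fun h : unit * F * F => is_true (h.1.2 <= h.2)).
Proof.
apply: (@Def_ext _ _ _ (fun h : unit * F * F =>
  opair (proj1_sig h.1.2) (proj1_sig h.2) ∈ rle_graph R)); last by def.
by case=> [[u x] y]; apply: rleP.
Qed.

Lemma Def_rlt_ : Def (fun h : unit * F * F => is_true (h.1.2 < h.2)).
Proof.
have d := Def_rle_.
apply: (@Def_ext _ _ _ (fun h : unit * F * F => h.1.2 <> h.2 /\ is_true (h.1.2 <= h.2))).
  case=> [[u x] y] /=; rewrite lt_neqAle; split=> [[n ->]|/andP[/eqP n ->]].
    by rewrite andbT; apply/eqP.
  by split.
apply: Def_and; last exact: d.
by def.
Qed.

Lemma DefT_ropp_ : DefT (fun h : unit * F => - h.2).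
Proof.
have d := DefT_radd_.
apply: (@DefT_unique _ _ _ _ _ (fun (h : unit * F) (y : F) => h.2 + y = 0)).
- by case=> [u x] /=; rewrite subrr.
- by case=> [u x] y /= e; rewrite -[y]add0r -(addNr x) -addrA e addr0.
- by def.
Qed.

Lemma DefT_rinv_ : DefT (fun h : unit * F => (h.2)^-1).
Proof.
have d := DefT_rmul_.
apply: (@DefT_unique _ _ _ _ _ (fun (h : unit * F) (y : F) =>
  (h.2 <> 0 /\ h.2 * y = 1) \/ (h.2 = 0 /\ y = 0))).
- case=> [u x] /=; have [->|n] := eqVneq x 0; first by right; rewrite invr0.
  by left; split; [apply/eqP|rewrite mulfV].
- case=> [u x] y /= [[/eqP n e]|[-> ->]]; last by rewrite invr0.
  by rewrite -[y]mul1r -(mulVf n) -mulrA e mulr1.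
- by def.
Qed.

Definition rap (f : SR) (n : N) : F := ap hZF f n.

Lemma DefT_rap_ : DefT (fun h : unit * SR * N => rap h.1.2 h.2).
Proof. exact: (DefT_ap_ hZF omega (reals R)). Qed.

Lemma rap_ext (f g : SR) : (forall n, rap f n = rap g n) -> f = g.
Proof. exact: ap_ext. Qed.

End RealDefinability.

Ltac def_real :=
  match goal with
  | h : ZF _, r : is_real_field _ |- DefT (fun g => @GRing.add _ _ _) =>
      apply: (DefT_comp2 (DefT_radd_ h r))
  | h : ZF _, r : is_real_field _ |- DefT (fun g => @GRing.mul _ _ _) =>
      apply: (DefT_comp2 (DefT_rmul_ h r))
  | h : ZF _, r : is_real_field _ |- DefT (fun g => @GRing.opp _ _) =>
      apply: (DefT_comp1 (DefT_ropp_ h r))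
  | h : ZF _, r : is_real_field _ |- DefT (fun g => @GRing.inv _ _) =>
      apply: (DefT_comp1 (DefT_rinv_ h r))
  | h : ZF _, r : is_real_field _ |- DefT (fun g => rap _ _ _ _) =>
      apply: (DefT_comp2 (DefT_rap_ h r))
  | h : ZF _, r : is_real_field _ |- Def (fun g => is_true (_ <= _)) =>
      apply: (Def_comp2 (P := fun x y : Real h r => is_true (x <= y)) (Def_rle_ h r))
  | h : ZF _, r : is_real_field _ |- Def (fun g => is_true (_ < _)) =>
      apply: (Def_comp2 (P := fun x y : Real h r => is_true (x < y)) (Def_rlt_ h r))
  end.
Ltac def_user ::= first [def_pair | def_ap | def_nat | def_tree | def_branch | def_real].

(** * Suprema, sums and powers *)

Section RealAnalysis.
Context {M : set_structure} (hZF : ZF M) (R : field_data M) (hR : is_real_field R).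
Local Notation N := (El (M := M) omega).
Local Notation F := (Real hZF hR).
Local Notation SR := (El (M := M) (fun_set omega (reals R))).
Local Notation Br := (El (M := M) (fun_set omega omega)).
Local Notation ap := (ap hZF).
Local Notation rap := (rap hZF hR).
Local Notation O := (O hZF).
Local Notation S := (S hZF).
Local Notation Nle := (Nle hZF).
Local Notation ch := (ch hZF).
Local Notation dbl := (dbl hZF).
Implicit Types (x y z : F) (n m k : N) (f g : SR).

Lemma DefT_rmax_ : DefT (X := F) (fun h : unit * F * F => Num.max h.1.2 h.2).
Proof.
apply: (@DefT_unique _ _ _ _ _ (fun (h : unit * F * F) (y : F) =>
    (is_true (h.1.2 <= h.2) /\ y = h.2) \/ (is_true (h.2 <= h.1.2) /\ y = h.1.2))).
- by case=> [[u x] y] /=; case: (leP x y) => h; [left|right; split; rewrite ?ltW].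
- case=> [[u x] y] z /= [[h ->]|[h ->]].
    by apply/esym/max_idPr.
  by apply/esym/max_idPl.
- by def.
Qed.

Lemma rlam_ex (t : N -> F) : DefT (fun h : unit * N => t h.2) ->
  exists f : SR, forall n, rap f n = t n.
Proof. exact: lam_ex. Qed.

Lemma rrec_ex (x0 : F) (s : N -> F -> F) :
  DefT (fun h : unit * N * F => s h.1.2 h.2) ->
  exists f : SR, rap f O = x0 /\ forall n, rap f (S n) = s n (rap f n).
Proof. exact: rec_ex. Qed.

Lemma rtree_rec (x0 : F) (s : bool -> N -> F -> F) :
  (forall b, DefT (fun h : unit * N * F => s b h.1.2 h.2)) ->
  exists f : SR, rap f O = x0 /\ forall b t, rap f (ch b t) = s b t (rap f t).
Proof. exact: tree_rec. Qed.

Lemma rupdE f n x k : rap (upd hZF f n x) k = if `[< k = n >] then x else rap f k.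
Proof. exact: updE. Qed.

Lemma DefT_rfn G (cG : @Ctx M G) (t : G -> SR) (t' : G -> N -> F) :
  (forall (c : G) n, rap (t c) n = t' c n) -> DefT (fun h : G * N => t' h.1 h.2) -> DefT t.
Proof. exact: DefT_fn_. Qed.

Lemma sup_ex (P : F -> Prop) : Def (fun h : unit * F => P h.2) ->
  (exists x, P x) -> (exists b, forall x, P x -> x <= b) ->
  exists s, (forall x, P x -> x <= s) /\ forall c, (forall x, P x -> x <= c) -> s <= c.
Proof.
move=> dP [x0 Px0] [b bP].
pose Q (m : M) := exists x : F, proj1_sig x = m /\ P x.
have XP (m : M) : m ∈ set_of Q <-> Q m.
  apply: (set_of_sep hZF (a := reals R)) => [_ [x [<- _]]|]; first exact: proj2_sig x.
  by rewrite /Q; def.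
have [|||s [sR [s1 s2]]] := rcomplete R hR (set_of Q).
- by move=> m /XP[x [<- _]]; apply: proj2_sig x.
- by exists (proj1_sig x0); apply/XP; exists x0.
- exists (proj1_sig b); split; first exact: proj2_sig b.
  by move=> m /XP[x [<- Px]]; apply/(rleP (hZF := hZF) (hR := hR))/bP.
exists (exist (fun w : M => w ∈ reals R) s sR : F); split.
  by move=> x Px; apply/rleP/s1/XP; exists x.
move=> c cP; apply/rleP; apply: s2; first exact: proj2_sig c.
by move=> m /XP[x [<- Px]]; apply/(rleP (hZF := hZF) (hR := hR))/cP.
Qed.

Lemma inf_ex (P : F -> Prop) : Def (fun h : unit * F => P h.2) ->
  (exists x, P x) -> (exists b, forall x, P x -> b <= x) ->
  exists s, (forall x, P x -> s <= x) /\ forall c, (forall x, P x -> c <= x) -> c <= s.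
Proof.
move=> dP [x0 Px0] [b bP].
have [|||s [s1 s2]] := @sup_ex (fun x => P (- x)).
- by def.
- by exists (- x0); rewrite opprK.
- by exists (- b) => x /bP; rewrite lerNr.
exists (- s); split=> [x Px|c cP]; first by rewrite lerNl s1 ?opprK.
by rewrite lerNr s2 // => x /cP; rewrite lerNr.
Qed.

Definition nr_fun : SR := projT1 (cid (rrec_ex (s := fun _ x => x + 1) 0 ltac:(def))).
Definition nr n : F := rap nr_fun n.
Lemma nrO : nr O = 0.
Proof. exact: proj1 (projT2 (cid (rrec_ex _ _))). Qed.
Lemma nrS n : nr (S n) = nr n + 1.
Proof. exact: proj2 (projT2 (cid (rrec_ex _ _))) n. Qed.
Lemma DefT_nr_ : DefT (fun h : unit * N => nr h.2).
Proof. by rewrite /nr; def. Qed.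

Lemma nr_ge0 n : 0 <= nr n.
Proof.
have d := DefT_nr_; move: n; apply: N_ind => [||n IH]; [by def|by rewrite nrO|].
by rewrite nrS addr_ge0.
Qed.

Lemma nr_lt n m : Nlt n m -> nr n < nr m.
Proof.
have d := DefT_nr_; move: m; apply: N_ind => [||m IH]; first by def.
  by move=> /NltO.
by move=> /NltS[/IH|->]; rewrite nrS; lra.
Qed.

Lemma nr_le n m : Nle n m -> nr n <= nr m.
Proof. by move=> /NleP[/nr_lt/ltW|->]. Qed.

Lemma nr_le_inv n m : nr n <= nr m -> Nle n m.
Proof.
by move=> h; apply/Nnot_lt => /nr_lt; rewrite ltNge h.
Qed.

Lemma archimedean x : exists n, x < nr n.
Proof.
have d := DefT_nr_; apply: contrapT => /forallNP H.
have B n : nr n <= x by rewrite leNgt; apply/negP/H.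
have [|||s [s1 s2]] := @sup_ex (fun y => exists n, y = nr n); first by def.
- by exists (nr O), O.
- by exists x => _ [n ->].
have : s <= s - 1.
  apply: s2 => _ [n ->]; have := s1 (nr (S n)) (ex_intro _ _ erefl).
  by rewrite nrS; lra.
lra.
Qed.

Lemma psums_ex f : exists s : SR, rap s O = 0 /\ forall n, rap s (S n) = rap s n + rap f n.
Proof. by apply: (@rrec_ex _ (fun n x => x + rap f n)); def. Qed.
Definition psums f : SR := projT1 (cid (psums_ex f)).
Definition sum f n : F := rap (psums f) n.
Lemma sumO f : sum f O = 0.
Proof. exact: proj1 (projT2 (cid (psums_ex f))). Qed.
Lemma sumS f n : sum f (S n) = sum f n + rap f n.
Proof. exact: proj2 (projT2 (cid (psums_ex f))) n. Qed.
Lemma DefT_psums_ : DefT (fun h : unit * SR => psums h.2).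
Proof.
apply: (@DefT_unique _ _ _ _ _ (fun (h : unit * SR) (s : SR) =>
  rap s O = 0 /\ forall n, rap s (S n) = rap s n + rap h.2 n)).
- by case=> u f; apply: (projT2 (cid (psums_ex f))).
- case=> u f s /= [s0 sS]; apply: rap_ext; apply: N_ind; first by def.
    by rewrite s0 -[RHS]/(sum f O) sumO.
  by move=> n e; rewrite sS -[RHS]/(sum f _) sumS e.
- by def.
Qed.
Lemma DefT_sum_ : DefT (fun h : unit * SR * N => sum h.1.2 h.2).
Proof. by have d := DefT_psums_; rewrite /sum; def. Qed.

Lemma sum_le f g n : (forall k, Nlt k n -> rap f k <= rap g k) -> sum f n <= sum g n.
Proof.
have d := DefT_sum_; move: n; apply: N_ind => [||n IH H]; first by def.
  by move=> _; rewrite !sumO.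
rewrite !sumS lerD //; last by apply: H; apply: NltnS.
by apply: IH => k kn; apply: H; apply/NltS; left.
Qed.

Lemma sum_add f g h n : (forall k, rap h k = rap f k + rap g k) ->
  sum h n = sum f n + sum g n.
Proof.
have d := DefT_sum_; move=> H; move: n; apply: N_ind => [||n IH]; first by def.
  by rewrite !sumO addr0.
by rewrite !sumS IH H; ring.
Qed.

Lemma sum_scale c f h n : (forall k, rap h k = c * rap f k) -> sum h n = c * sum f n.
Proof.
have d := DefT_sum_; move=> H; move: n; apply: N_ind => [||n IH]; first by def.
  by rewrite !sumO mulr0.
by rewrite !sumS IH H; ring.
Qed.

Lemma sum_const c f n : (forall k, Nlt k n -> rap f k = c) -> sum f n = nr n * c.
Proof.
have d := DefT_sum_; have e := DefT_nr_.
move: n; apply: N_ind => [||n IH H]; first by def.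
  by rewrite sumO nrO mul0r.
rewrite sumS nrS IH; last by move=> k kn; apply: H; apply/NltS; left.
by rewrite H; [ring|apply: NltnS].
Qed.

Lemma sum_ge0 f n : (forall k, Nlt k n -> 0 <= rap f k) -> 0 <= sum f n.
Proof.
have d := DefT_sum_; move: n; apply: N_ind => [||n IH H]; first by def.
  by rewrite sumO.
rewrite sumS addr_ge0 //; last by apply: H; apply: NltnS.
by apply: IH => k kn; apply: H; apply/NltS; left.
Qed.

Lemma sum_mono f n m : (forall k, 0 <= rap f k) -> Nle n m -> sum f n <= sum f m.
Proof.
move=> H; have d := DefT_sum_; move: m; apply: N_ind => [||m IH]; first by def.
  by move=> /NleO ->.
by move=> /NleS[/IH h|-> //]; rewrite sumS; apply: le_trans h _; rewrite lerDl.
Qed.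

Lemma sum_ge_term f n k : (forall j, 0 <= rap f j) -> Nlt k n -> rap f k <= sum f n.
Proof.
move=> H kn; apply: (le_trans (y := sum f (S k))).
  by rewrite sumS lerDr sum_ge0.
by apply: sum_mono => //; apply/Nle_lt_S.
Qed.

Lemma gpow_ex x : exists p : SR, rap p O = 1 /\ forall n, rap p (S n) = rap p n * x.
Proof. by apply: (@rrec_ex _ (fun n y => y * x)); def. Qed.
Definition gpows x : SR := projT1 (cid (gpow_ex x)).
Definition gpow x n : F := rap (gpows x) n.
Lemma gpowO x : gpow x O = 1.
Proof. exact: proj1 (projT2 (cid (gpow_ex x))). Qed.
Lemma gpowS x n : gpow x (S n) = gpow x n * x.
Proof. exact: proj2 (projT2 (cid (gpow_ex x))) n. Qed.
Lemma DefT_gpows_ : DefT (fun h : unit * F => gpows h.2).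
Proof.
apply: (@DefT_unique _ _ _ _ _ (fun (h : unit * F) (s : SR) =>
  rap s O = 1 /\ forall n, rap s (S n) = rap s n * h.2)).
- by case=> u x; apply: (projT2 (cid (gpow_ex x))).
- case=> u x s /= [s0 sS]; apply: rap_ext; apply: N_ind; first by def.
    by rewrite s0 -[RHS]/(gpow x O) gpowO.
  by move=> n e; rewrite sS -[RHS]/(gpow x _) gpowS e.
- by def.
Qed.

Lemma DefT_gpow_ : DefT (fun h : unit * F * N => gpow h.1.2 h.2).
Proof. by have d := DefT_gpows_; rewrite /gpow; def. Qed.

Lemma gpow_gt0 x n : 0 < x -> 0 < gpow x n.
Proof.
move=> x0; have d := DefT_gpow_; move: n; apply: N_ind => [||n IH]; first by def.
  by rewrite gpowO ltr01.
by rewrite gpowS mulr_gt0.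
Qed.

Definition half n : F := gpow (1 / 2%:R) n.
Lemma halfO : half O = 1. Proof. exact: gpowO. Qed.
Lemma halfS n : half (S n) = half n / 2%:R.
Proof. by rewrite /half gpowS mul1r. Qed.
Lemma half_gt0 n : 0 < half n. Proof. by apply: gpow_gt0; lra. Qed.
Lemma DefT_half_ : DefT (fun h : unit * N => half h.2).
Proof. by have d := DefT_gpow_; rewrite /half; def. Qed.

(** The powers of 1/2 tend to 0 since 2^n >= n + 1. *)
Lemma half_small x : 0 < x -> exists n, half n < x.
Proof.
move=> x0; have d := DefT_half_; have e := DefT_nr_.
have H n : half n * (nr n + 1) <= 1.
  move: n; apply: N_ind => [||n IH]; [by def|by rewrite halfO nrO; lra|].
  by rewrite halfS nrS; have := half_gt0 n; have := nr_ge0 n; nra.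
have [n nP] := archimedean (x^-1); exists n.
have n0 : 0 < nr n by apply: lt_trans nP; rewrite invr_gt0.
have := H n; have h0 := half_gt0 n.
have : 1 < x * nr n by rewrite mulrC -ltr_pdivrMr // mul1r.
by nra.
Qed.

Lemma le_half x c : (forall n, x <= c * half n) -> x <= 0.
Proof.
move=> H; rewrite leNgt; apply/negP => x0.
have c0 : 0 < c by have := H O; rewrite halfO mulr1; apply: lt_le_trans.
have [n nP] := half_small (divr_gt0 x0 c0).
by have := H n; rewrite leNgt mulrC -ltr_pdivlMr // nP.
Qed.

Lemma half_le1 n : half n <= 1.
Proof.
have d := DefT_half_; move: n; apply: N_ind => [||n IH]; [by def|by rewrite halfO|].
by rewrite halfS; have := half_gt0 n; lra.
Qed.

Lemma sum_half (f : SR) n : (forall k, rap f k = half k) -> sum f n <= 2%:R.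
Proof.
move=> H; suff : sum f n = 2%:R - 2%:R * half n by move=> ->; have := half_gt0 n; lra.
have d := DefT_half_; have e := DefT_sum_; move: n; apply: N_ind => [||n IH]; first by def.
  by rewrite sumO halfO; lra.
by rewrite sumS IH H halfS; lra.
Qed.

Lemma sum_dbl f n : (forall t, 0 <= rap f t) -> sum f n <= sum f (S (dbl n)).
Proof.
move=> H; apply: sum_mono => //; apply: (Nle_trans (m := dbl n)); first exact: le_dbl.
exact/Nlt_le/NltnS.
Qed.

End RealAnalysis.

Ltac def_analysis :=
  match goal with
  | h : ZF _, r : is_real_field _ |- DefT (fun g => Order.max _ _) =>
      apply: (DefT_comp2 (DefT_rmax_ h r))
  | h : ZF _, r : is_real_field _ |- DefT (fun g => nr _ _ _) =>
      apply: (DefT_comp1 (DefT_nr_ h r))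
  | h : ZF _, r : is_real_field _ |- DefT (fun g => sum _ _ _ _) =>
      apply: (DefT_comp2 (DefT_sum_ h r))
  | h : ZF _, r : is_real_field _ |- DefT (fun g => gpow _ _) =>
      apply: (DefT_comp2 (DefT_gpow_ h r))
  | h : ZF _, r : is_real_field _ |- DefT (fun g => half _ _ _) =>
      apply: (DefT_comp1 (DefT_half_ h r))
  end.
Ltac def_user ::= first [def_pair | def_ap | def_nat | def_tree | def_branch | def_real | def_analysis].

Global Opaque Real rap nr sum gpow half.

(** * Determinacy in terms of causal functions *)

Section Determinacy.
Context {M : set_structure} (hZF : ZF M) (hAD : AD M).
Local Notation N := (El (M := M) omega).
Local Notation Br := (El (M := M) (fun_set omega omega)).
Local Notation Seq := (El (M := M) finite_sequences).
Local Notation Strat := (El (M := M) (fun_set finite_sequences omega)).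
Local Notation ap := (ap hZF).
Local Notation O := (O hZF).
Local Notation S := (S hZF).
Local Notation Nle := (Nle hZF).
Local Notation dbl := (dbl hZF).
Local Notation par := (par hZF).
Implicit Types (n m k : N) (f g x z : Br).

Lemma par_odd t : par (S (dbl t)) = t.
Proof. exact: (par_ch hZF false t). Qed.
Lemma par_even t : par (S (S (dbl t))) = t.
Proof. exact: (par_ch hZF true t). Qed.

Lemma evenP n : even (proj1_sig n) <-> exists k, n = dbl k.
Proof.
split=> [H|[k ->] X X0 XS].
- pose Q (a : M) := exists k, proj1_sig (dbl k) = a.
  have QP (a : M) : a ∈ set_of Q <-> Q a.
    apply: (set_of_sep hZF (a := omega)) => [_ [k <-]|]; first exact: proj2_sig (dbl k).
    by rewrite /Q; def.
  suff /QP[k e] : proj1_sig n ∈ set_of Q by exists k; apply: El_inj.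
  apply: H; first by apply/QP; exists O; rewrite dblO.
  by move=> a /QP[k <-]; apply/QP; exists (S k); rewrite dblS.
- move: k; apply: N_ind => [||k IH]; first by def.
    by rewrite dblO.
  by rewrite dblS; apply: XS.
Qed.

Lemma finite_seqP (u : M) : u ∈ finite_sequences <-> exists n : M, n ∈ omega /\ is_fun n omega u.
Proof.
apply: (set_of_sep hZF (a := power (prod_set omega omega))).
  move=> {}u [n [nw [s _]]]; apply/(powerP hZF) => p /s /(prod_setP hZF)[x [y [xn [yw ->]]]].
  apply: opair_in => //.
  by have [k -> _] := mem_N hZF (n := exist _ n nw) xn; exact: (proj2_sig k).
by rewrite /is_fun /Defs.subset /unique; def.
Qed.

Lemma Br_fun f : is_fun omega omega (proj1_sig f).
Proof. exact: proj1 (fun_setP hZF _ _ _) (proj2_sig f). Qed.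

Lemma restrictP (f : M) (n : M) p :
  p ∈ restrict f n <-> p ∈ f /\ exists x y : M, x ∈ n /\ p = opair x y.
Proof.
apply: (set_of_sep hZF (a := f)) => [{}p [] //|].
by def.
Qed.

Lemma restrict_fun f n : is_fun (proj1_sig n) omega (restrict (proj1_sig f) (proj1_sig n)).
Proof.
have hf := Br_fun f; split=> [p /restrictP[pf [x [y [xn e]]]]|x xn].
  rewrite e in pf *; apply: opair_in => //.
  have xw : x ∈ omega by have [k -> _] := mem_N hZF xn; exact: (proj2_sig k).
  by rewrite -(appP hZF hf pf); apply: (app_in hZF hf xw).
have xw : x ∈ omega by have [k -> _] := mem_N hZF xn; exact: (proj2_sig k).
exists (app (proj1_sig f) x); split.
  by apply/restrictP; split; [apply: (opair_app hZF hf xw)|exists x, (app (proj1_sig f) x)].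
by move=> y /restrictP[xy _]; apply: (appP hZF hf xy).
Qed.

Lemma restrict_in f n : restrict (proj1_sig f) (proj1_sig n) ∈ finite_sequences.
Proof.
apply/finite_seqP; exists (proj1_sig n); split; [exact: (proj2_sig n)|exact: restrict_fun].
Qed.

Definition restr f n : Seq := exist (fun u : M => u ∈ finite_sequences) _ (restrict_in f n).

Lemma restr_eq f g n : (forall k, Nlt k n -> ap f k = ap g k) -> restr f n = restr g n.
Proof.
move=> H; apply: El_inj; apply: (is_fun_ext hZF (restrict_fun f n) (restrict_fun g n)) => x xn.
have [k e kn] := mem_N hZF xn; rewrite e in xn *.
have E (h : Br) : app (restrict (proj1_sig h) (proj1_sig n)) (proj1_sig k) = proj1_sig (ap h k).
  apply: (appP hZF (X := proj1_sig n) (Y := omega)); first exact: restrict_fun.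
  apply/restrictP; split.
    exact: (opair_app hZF (Br_fun h) (proj2_sig k)).
  by exists (proj1_sig k), (proj1_sig (ap h k)).
by rewrite !E H.
Qed.

Lemma DefT_restr_ : DefT (fun h : unit * Br * N => restr h.1.2 h.2).
Proof.
apply: (@DefT_unique _ _ _ _ _ (fun (h : unit * Br * N) (u : Seq) => forall p : M,
  p ∈ proj1_sig u <-> p ∈ proj1_sig h.1.2 /\ exists x y : M, x ∈ proj1_sig h.2 /\ p = opair x y)).
- by case=> [[u f] n] p; apply: restrictP.
- case=> [[u f] n] v /= H; apply: El_inj; apply: (zf_extensionality M hZF) => p.
  by rewrite H restrictP.
- by def.
Qed.

Definition evens_ex x : exists y : Br, forall n, ap y n = ap x (dbl n).
Proof. by apply: lam_ex; def. Qed.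
Definition odds_ex x : exists y : Br, forall n, ap y n = ap x (S (dbl n)).
Proof. by apply: lam_ex; def. Qed.
Definition evens x : Br := projT1 (cid (evens_ex x)).
Definition odds x : Br := projT1 (cid (odds_ex x)).
Lemma evensE x n : ap (evens x) n = ap x (dbl n).
Proof. exact: projT2 (cid (evens_ex x)) n. Qed.
Lemma oddsE x n : ap (odds x) n = ap x (S (dbl n)).
Proof. exact: projT2 (cid (odds_ex x)) n. Qed.
Lemma DefT_evens_ : DefT (fun h : unit * Br => evens h.2).
Proof.
apply: (DefT_fn_ (hZF := hZF) (t' := fun (h : unit * Br) (n : N) => ap h.2 (dbl n))).
  by case=> u x n; rewrite evensE.
by def.
Qed.
Lemma DefT_odds_ : DefT (fun h : unit * Br => odds h.2).
Proof.
apply: (DefT_fn_ (hZF := hZF) (t' := fun (h : unit * Br) (n : N) => ap h.2 (S (dbl n)))).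
  by case=> u x n; rewrite oddsE.
by def.
Qed.

(** The run in which the moves at the stages in P follow the strategy s, and the
   others are given by y. *)
Section Runs.
Variables (s : Strat) (x0 : Br -> N) (P : N -> Prop) (y : N -> Br -> N).
Hypothesis dx0 : DefT (fun h : unit * Br => x0 h.2).
Hypothesis dP : Def (fun h : unit * N => P h.2).
Hypothesis dy : DefT (fun h : unit * N * Br => y h.1.2 h.2).

Definition step z n f : N := if `[< P (S n) >] then ap s (restr f (S n)) else y (S n) z.

Lemma step_causal z n f g : (forall k, Nle k n -> ap f k = ap g k) ->
  step z n f = step z n g.
Proof. by move=> H; rewrite /step (restr_eq (g := g)). Qed.

Lemma DefT_step_ : DefT (fun h : unit * Br * N * Br => step h.1.1.2 h.1.2 h.2).
Proof. by have d := DefT_restr_; rewrite /step; def. Qed.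

Lemma run_ex z : exists x, ap x O = x0 z /\ forall n, ap x (S n) = step z n x.
Proof.
have d := DefT_step_; apply: cov_rec; first by def.
exact: step_causal.
Qed.
Definition run z : Br := projT1 (cid (run_ex z)).
Lemma runO z : ap (run z) O = x0 z.
Proof. exact: proj1 (projT2 (cid (run_ex z))). Qed.
Lemma runS z n : ap (run z) (S n) = step z n (run z).
Proof. exact: proj2 (projT2 (cid (run_ex z))) n. Qed.

Lemma DefT_run_ : DefT (fun h : unit * Br => run h.2).
Proof.
have d := DefT_step_.
apply: (@DefT_unique _ _ _ _ _ (fun (h : unit * Br) (x : Br) =>
  ap x O = x0 h.2 /\ forall n, ap x (S n) = step h.2 n x)).
- by case=> u z /=; split; [apply: runO|apply: runS].
- case=> u z x /= [e0 eS]; apply: (cov_unique (G := step z)).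
  + exact: step_causal.
  + by rewrite e0 runO.
  + exact: eS.
  + exact: runS.
- by def.
Qed.

Lemma run_agree z z' n : x0 z = x0 z' ->
  (forall i, Nle (S i) n -> ~ P (S i) -> y (S i) z = y (S i) z') ->
  forall i, Nle i n -> ap (run z) i = ap (run z') i.
Proof.
move=> e0 H; suff K : forall i, Nle i n -> forall j, Nle j i -> ap (run z) j = ap (run z') j.
  by move=> i ni; apply: (K i) => //; apply: Nle_refl.
have d := DefT_run_; apply: N_ind => [|_ j /NleO ->|i IH ni j /NleS[ji|->]]; first by def.
- by rewrite !runO.
- by apply: IH => //; apply: Nle_trans ni; apply/Nlt_le/NltnS.
- rewrite !runS /step; case: asboolP => nP; last exact: H.
  congr (ap s _); apply: restr_eq => k ki; apply: IH => //.
  by apply: Nle_trans ni; apply/Nlt_le/NltnS.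
Qed.
End Runs.

Lemma strat_el (s : M) : strategy s -> exists s' : Strat, proj1_sig s' = s.
Proof. by move=> hs; exists (exist _ s (proj2 (fun_setP hZF _ _ _) hs)). Qed.

(** Against a strategy, the moves of one player determine those of the other one.  The
    resulting map is causal: the n-th answer depends on the moves made so far, which
    are those before n for player I and those up to n for player II. *)
Lemma determinacy (W : Br -> Br -> Prop) :
  Def (fun h : unit * Br * Br => W h.1.2 h.2) ->
  (exists Phi : Br -> Br, DefT (fun h : unit * Br => Phi h.2) /\
     (forall z z' n, (forall k, Nlt k n -> ap z k = ap z' k) ->
        ap (Phi z) n = ap (Phi z') n) /\
     forall z, W (Phi z) z) \/
  (exists Psi : Br -> Br, DefT (fun h : unit * Br => Psi h.2) /\
     (forall x x' n, (forall k, Nle k n -> ap x k = ap x' k) ->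
        ap (Psi x) n = ap (Psi x') n) /\
     forall x, ~ W x (Psi x)).
Proof.
move=> dW; have de := DefT_evens_; have do_ := DefT_odds_.
pose Q (a : M) := exists x, proj1_sig x = a /\ W (evens x) (odds x).
have QP a : a ∈ set_of Q <-> Q a.
  apply: (set_of_sep hZF (a := fun_set omega omega)) => [_ [x [<- _]]|].
    exact: proj2_sig x.
  by rewrite /Q; def.
have A_run x : proj1_sig x ∈ set_of Q <-> W (evens x) (odds x).
  rewrite QP; split=> [[x' [/El_inj -> //]]|H]; by exists x.
have odd_even' n : ~ (exists k, n = dbl k) -> exists t, n = S (dbl t).
  move=> H; have [t [e|->]] := parity hZF n; last by exists t.
  by case: H; exists t.
have QP' : subset (set_of Q) (fun_set omega omega).
  by move=> a /QP[x [<- _]]; exact: (proj2_sig x).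
case: (hAD QP').

- move=> [sg [/strat_el[s <-] H]]; left.
  have [c0 _] := lam_ex hZF (t := fun _ : N => O) (DefT_const (G := unit * N) O).
  pose P n := exists k, n = dbl k; pose y n z := ap z (par n).
  have dP : Def (fun h : unit * N => P h.2) by rewrite /P; def.
  have dy : DefT (fun h : unit * N * Br => y h.1.2 h.2) by rewrite /y; def.
  pose x0 (_ : Br) := ap s (restr c0 O).
  have dx : DefT (fun h : unit * Br => x0 h.2) by rewrite /x0; def.
  pose r := run s x0 dP dy.
  have r_odd z n : ap (r z) (S (dbl n)) = ap z n.
    by rewrite runS /step asboolF ?/y ?par_odd // => -[k /esym/dbl_neqS].
  exists (fun z => evens (r z)); split.
    by have d := DefT_run_ s dx dP dy; def.
  split=> [z z' n E|z].
    rewrite !evensE; apply: (run_agree (n := dbl n) s dx dP dy) => //; last exact: Nle_refl.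
    move=> i le_i /odd_even'[t e]; rewrite e /y par_odd; apply: E.
    apply/(Nnot_le hZF) => /(dbl_Nle (n := n)) h; move: le_i; rewrite e.
    by move/Nle_trans/(_ h)/Nle_lt_S/Nlt_irr.
  have -> : z = odds (r z) by apply: ap_ext => n; rewrite oddsE r_odd.
  have -> : evens (r (odds (r z))) = evens (r z).
    by congr (evens (r _)); apply: ap_ext => n; rewrite oddsE r_odd.
  apply/A_run/H; first exact: Br_fun.
  move=> a aw; pose n : N := exist _ a aw; move=> /(evenP n)[k e].
  change (proj1_sig (ap (r z) n) = proj1_sig (ap s (restr (r z) n))); congr proj1_sig.
  case: (N_case hZF n) => [->|[m em]]; first by rewrite runO; congr (ap s _); apply: restr_eq => i /NltO.
  by rewrite em runS /step asboolT //; exists k; rewrite -em.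
- move=> [ta [/strat_el[s <-] H]]; right.
  pose P n := forall k, n <> dbl k; pose y n x := ap x (S (par n)).
  have dP : Def (fun h : unit * N => P h.2) by rewrite /P; def.
  have dy : DefT (fun h : unit * N * Br => y h.1.2 h.2) by rewrite /y; def.
  pose x0 (m : Br) := ap m O.
  have dx : DefT (fun h : unit * Br => x0 h.2) by rewrite /x0; def.
  pose r := run s x0 dP dy.
  have r_even x n : ap (r x) (dbl n) = ap x n.
    case: (N_case hZF n) => [->|[t ->]]; first by rewrite dblO runO.
    by rewrite dblS runS /step asboolF ?/y ?par_even // => /(_ (S t)); rewrite dblS.
  exists (fun x => odds (r x)); split.
    by have d := DefT_run_ s dx dP dy; def.
  split=> [x x' n E|x].
    rewrite !oddsE; apply: (run_agree (n := S (dbl n)) s dx dP dy); last exact: Nle_refl.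
      by apply: E; apply: Nle_O.
    move=> i le_i nP; have [k e] : exists k, S i = dbl k.
      by apply: contrapT => nk; apply: nP => k e; apply: nk; exists k.
    case: (N_case hZF k) => [k0|[t kt]]; first by move: e; rewrite k0 dblO => /S_neqO.
    subst k; rewrite e dblS /y par_even; apply: E.
    apply/(Nnot_lt hZF) => /(Nle_lt_S hZF)/(dbl_Nle (n := S n)) h; move: le_i; rewrite e.
    move/(Nle_trans h); rewrite dblS => /(Nle_lt_S hZF)/Nlt_irr //.
  have E : x = evens (r x) by apply: ap_ext => n; rewrite evensE r_even.
  rewrite {1}E => /A_run; apply: H; first exact: Br_fun.
  move=> a aw; pose n : N := exist _ a aw; move=> ne.
  have {}ne : P n by move=> k e; apply: ne; apply/(evenP n); exists k.
  change (proj1_sig (ap (r x) n) = proj1_sig (ap s (restr (r x) n))); congr proj1_sig.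
  case: (N_case hZF n) => [e|[i em]]; first by case: (ne O); rewrite dblO.
  by rewrite em runS /step asboolT // -em.
Qed.

End Determinacy.

Global Opaque ap.

(** * Least witnesses *)

Section Least.
Context {M : set_structure} (hZF : ZF M).
Local Notation N := (El (M := M) omega).
Local Notation O := (O hZF).

Definition is_least (P : N -> Prop) (n : N) := P n /\ forall k, Nlt k n -> ~ P k.

Lemma is_least_unique P n m : is_least P n -> is_least P m -> n = m.
Proof.
move=> [Pn nP] [Pm mP]; case: (Nlt_total hZF n m) => [/mP|[//|/nP]] //.
Qed.

Lemma least_ex P : exists n, is_least P n \/ (~ (exists k, is_least P k)) /\ n = O.
Proof.
have [[n h]|h] := pselect (exists k, is_least P k); first by exists n; left.
by exists O; right.
Qed.
Definition least P : N := projT1 (cid (least_ex P)).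

Lemma DefT_least G (cG : @Ctx M G) (P : G -> N -> Prop) :
  Def (fun h : G * N => P h.1 h.2) -> DefT (fun g => least (P g)).
Proof.
move=> dP; apply: (@DefT_unique _ _ _ _ _ (fun g n =>
   is_least (P g) n \/ (~ (exists k, is_least (P g) k)) /\ n = O)).
- by move=> g; apply: (projT2 (cid (least_ex (P g)))).
- move=> g n; rewrite /least; case: cid => m /= [hm|[nm ->]] [hn|[nn ->]] //.
  + exact: is_least_unique hn hm.
  + by case: nn; exists m.
  + by case: nm; exists n.
have dQ : Def (fun h : G * N => is_least (P h.1) h.2).
  apply: Def_and => //; apply: Def_all; apply: Def_imp; first by def.
  apply: Def_not; exact: (Def_map (s := fun h : G * N * N => (h.1.1, h.2))
    (ctx_map_pair (ctx_map_fst (X := N))) dP).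
apply: Def_or => //; apply: Def_and; last by def.
apply: Def_not; apply: Def_ex.
exact: (Def_map (s := fun h : G * N * N => (h.1.1, h.2))
    (ctx_map_pair (ctx_map_fst (X := N))) dQ).
Qed.

Lemma leastP (P : N -> Prop) : Def (fun h : unit * N => P h.2) ->
  (exists n, P n) -> P (least P).
Proof.
move=> dP /(N_wf hZF dP)[n hn]; rewrite /least; case: cid => m /= [[]|[[]]] //.
by exists n.
Qed.

End Least.

Ltac def_least := apply DefT_least.
Ltac def_user ::= first [def_pair | def_ap | def_nat | def_tree | def_branch | def_real | def_analysis
  | lazymatch goal with |- DefT (fun g => least _ _) => def_least end].

(** * Flows and covers on the tree *)

Section Flows.
Context {M : set_structure} (hZF : ZF M) (R : field_data M) (hR : is_real_field R).
Local Notation N := (El (M := M) omega).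
Local Notation F := (Real hZF hR).
Local Notation SR := (El (M := M) (fun_set omega (reals R))).
Local Notation Br := (El (M := M) (fun_set omega omega)).
Local Notation ap := (ap hZF).
Local Notation rap := (rap hZF hR).
Local Notation O := (O hZF).
Local Notation S := (S hZF).
Local Notation Nle := (Nle hZF).
Local Notation ch := (ch hZF).
Local Notation dbl := (dbl hZF).
Local Notation len := (len hZF).
Local Notation pre := (pre hZF).
Local Notation path := (path hZF).
Local Notation bit := (bit hZF).
Local Notation half := (half hZF hR).
Local Notation nr := (nr hZF hR).
Local Notation upd := (upd hZF).
Local Notation least := (least hZF).
Implicit Types (n k t : N) (f g h u w : SR) (m z : Br) (b : bool).

(** Flows are the finite measures on the space of branches.  A superflow u that covers
    X plays the part of a cover of X by the nodes with w <= u, their total capacity being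
    bounded by the value of u at the root.  A set X of branches is a predicate of the
    path, which depends on the bits of the branch only. *)
Definition flow h : Prop := (forall t, 0 <= rap h t) /\
  forall t, rap h (ch false t) + rap h (ch true t) = rap h t.
Definition superflow u : Prop := (forall t, 0 <= rap u t) /\
  forall t, rap u (ch false t) + rap u (ch true t) <= rap u t.
Definition covers w u (X : Br -> Prop) : Prop :=
  forall z, X (path z) -> exists n, rap w (pre z n) <= rap u (pre z n).

Lemma pre_ext z z' n : (forall k, Nlt k n -> bit (ap z k) = bit (ap z' k)) -> pre z n = pre z' n.
Proof.
move: n; apply: N_ind => [||n IH H]; first by rewrite /bit; def.
  by rewrite !preO.
rewrite !preS IH => [|k kn]; last by apply: H; apply/NltS; left.
by rewrite H //; apply: NltnS.
Qed.

(** A branch through a given node, continued by zeros. *)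
Lemma zext_ex : exists f : El (fun_set omega (fun_set omega omega)),
  (forall k, ap (ap f O) k = O) /\
  forall b t, ap f (ch b t) = upd (ap f t) (len t) (if b then S O else O).
Proof.
have [c cP] := lam_ex hZF (t := fun _ : N => O) (DefT_const (G := unit * N) O).
have [|f [f0 fS]] := @tree_rec _ hZF _ c (fun b t (x : Br) => upd x (len t) (if b then S O else O)).
  by move=> b; def.
by exists f; split=> [k|//]; rewrite f0 cP.
Qed.
Definition zext t : Br := ap (projT1 (cid zext_ex)) t.
Lemma zextO k : ap (zext O) k = O.
Proof. exact: proj1 (projT2 (cid zext_ex)) k. Qed.
Lemma zext_ch b t : zext (ch b t) = upd (zext t) (len t) (if b then S O else O).
Proof. exact: proj2 (projT2 (cid zext_ex)) b t. Qed.
Lemma DefT_zext_ : DefT (fun h : unit * N => zext h.2).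
Proof. by rewrite /zext; def. Qed.

Lemma bit_if b : bit (if b then S O else O) = b.
Proof. by case: b; apply/asboolP => //; apply: S_neqO. Qed.

Definition normal z := forall n, ap z n = if bit (ap z n) then S O else O.

Lemma zext_pre z n : normal z -> forall k, Nlt k n -> ap (zext (pre z n)) k = ap z k.
Proof.
move=> nz; have d := DefT_zext_; move: n; apply: N_ind => [||n IH k].
- by def.
- by move=> k /NltO.
rewrite preS zext_ch len_pre => /NltS[kn|->]; last by rewrite upd_eq -nz.
by rewrite upd_neq ?IH // => e; subst k; apply: (Nlt_irr hZF kn).
Qed.

Lemma pre_zext t : pre (zext t) (len t) = t.
Proof.
have d := DefT_zext_; move: t; apply: tree_ind => [||b t IH]; first by def.
  by rewrite lenO preO.
rewrite len_ch preS zext_ch upd_eq bit_if; congr ch; rewrite -[RHS]IH.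
apply: pre_ext => k kt; rewrite upd_neq // => e; subst k; exact: (Nlt_irr hZF kt).
Qed.

Lemma zext_normal t : normal (zext t).
Proof.
have d := DefT_zext_; move: t; apply: tree_ind => [||b t IH n].
- by rewrite /normal /bit; def.
- by move=> n; rewrite zextO (bit_if false).
- rewrite zext_ch updE; case: asboolP => _; last exact: IH.
  by rewrite bit_if.
Qed.

Lemma normalize z : exists z', normal z' /\ path z' = path z.
Proof.
have [|z' zP] := @lam_ex _ hZF omega omega (fun n => if bit (ap z n) then S O else O).
  by rewrite /bit; def.
exists z'; split=> [n|]; first by rewrite !zP bit_if.
by apply: ap_ext => n; apply: pre_ext => k _; rewrite zP bit_if.
Qed.

(** Moves are natural numbers, which therefore have to code a dense set of ratios: the
    node t codes the dyadic number whose binary expansion is t. *)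
Definition lo_fun : SR := projT1 (cid (rtree_rec (hZF := hZF) (hR := hR)
  (s := fun b t (x : F) => if b then x + half (S (len t)) else x) 0 ltac:(by case; def))).
Definition lo t : F := rap lo_fun t.
Lemma loO : lo O = 0.
Proof. exact: proj1 (projT2 (cid (rtree_rec _ _))). Qed.
Lemma lo_ch b t : lo (ch b t) = if b then lo t + half (S (len t)) else lo t.
Proof. exact: proj2 (projT2 (cid (rtree_rec _ _))) b t. Qed.
Lemma DefT_lo_ : DefT (fun h : unit * N => lo h.2).
Proof. by rewrite /lo; def. Qed.

Lemma lo_bounds t : 0 <= lo t /\ lo t + half (len t) <= 1.
Proof.
have d := DefT_lo_; move: t; apply: tree_ind => [||b t [l1 l2]]; first by def.
  by rewrite loO lenO halfO; split; lra.
rewrite lo_ch len_ch; have h0 := half_gt0 hZF hR (len t); rewrite halfS.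
by case: b; split; lra.
Qed.

Lemma lo_approx (x : F) n : 0 <= x -> x < 1 ->
  exists t, len t = n /\ lo t <= x /\ x < lo t + half n.
Proof.
move=> x0 x1; have d := DefT_lo_; move: n; apply: N_ind => [||n [t [ln [t1 t2]]]].
- by def.
- by exists O; rewrite lenO loO halfO; split=> //; split; lra.
- have [hx|hx] := leP (lo t + half (S n)) x.
    exists (ch true t); rewrite len_ch lo_ch ln. split=> //; split=> //.
    by move: t2; rewrite halfS; lra.
  by exists (ch false t); rewrite len_ch lo_ch ln.
Qed.

(** Ratio in which a move splits the mass of a node; the root codes the ratio 1,
   which is not among the numbers lo t. *)
Definition ratio b k : F :=
  if b then 1 - (if `[< k = O >] then 1 else lo k) else (if `[< k = O >] then 1 else lo k).

Lemma DefT_ratio_ b : DefT (fun h : unit * N => ratio b h.2).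
Proof. by have d := DefT_lo_; rewrite /ratio; case: b; def. Qed.

Lemma DefT_ratio_bit G (cG : @Ctx M G) (x y : G -> N) : DefT x -> DefT y ->
  DefT (fun c : G => ratio (bit (x c)) (y c)).
Proof.
move=> dx dy; have d := DefT_lo_; rewrite /ratio /bit; apply DefT_if; def.
Qed.

Lemma ratio_sum k : ratio false k + ratio true k = 1.
Proof. by rewrite /ratio; lra. Qed.

Lemma ratio_bounds b k : 0 <= ratio b k /\ ratio b k <= 1.
Proof.
have [l1 l2] := lo_bounds k; have h0 := half_gt0 hZF hR (len k).
by rewrite /ratio; case: b; case: asboolP => _; split; lra.
Qed.

Lemma ratio_dense (p q : F) : 0 <= p -> p < q -> q <= 1 ->
  exists k, p < ratio false k /\ ratio false k < q.
Proof.
move=> p0 pq q1; have [n nP] := half_small (hZF := hZF) (hR := hR) (x := (q - p) / 2%:R) ltac:(lra).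
have [||t [_ [t1 t2]]] := @lo_approx ((p + q) / 2%:R) n; [lra|lra|].
exists t; have pl : p < lo t by lra.
rewrite /ratio asboolF; first by split=> //; lra.
by move=> e; move: pl; rewrite e loO; lra.
Qed.

Lemma ratio_ends : exists k0 k1, ratio false k0 = 0 /\ ratio true k1 = 0.
Proof.
exists (ch false O), O; rewrite /ratio asboolF; last exact: ch_neqO.
by rewrite asboolT // lo_ch loO subrr.
Qed.

(** The mass of the current node after n rounds. *)
Section Value.
Variable v : F.
Lemma value_ex m z : exists f : SR, rap f O = v /\
  forall n, rap f (S n) = rap f n * ratio (bit (ap z n)) (ap m n).
Proof.
apply: (@rrec_ex _ hZF _ hR _ (fun n (x : F) => x * ratio (bit (ap z n)) (ap m n))).
def; apply: DefT_ratio_bit; def.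
Qed.
Definition values m z : SR := projT1 (cid (value_ex m z)).
Definition value m z n : F := rap (values m z) n.
Lemma valueO m z : value m z O = v.
Proof. exact: proj1 (projT2 (cid (value_ex m z))). Qed.
Lemma valueS m z n : value m z (S n) = value m z n * ratio (bit (ap z n)) (ap m n).
Proof. exact: proj2 (projT2 (cid (value_ex m z))) n. Qed.
Lemma DefT_values_ : DefT (fun h : unit * Br * Br => values h.1.2 h.2).
Proof.
apply: (@DefT_unique _ _ _ _ _ (fun (h : unit * Br * Br) (f : SR) =>
  rap f O = v /\ forall n, rap f (S n) = rap f n * ratio (bit (ap h.2 n)) (ap h.1.2 n))).
- by case=> [[c m] z]; apply: (projT2 (cid (value_ex m z))).
- case=> [[c m] z] f /= [f0 fS]; apply: rap_ext; apply: N_ind; first by def.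
    by rewrite f0 -[RHS]/(value m z O) valueO.
  by move=> n e; rewrite fS -[RHS]/(value m z _) valueS e.
- by def; apply: DefT_ratio_bit; def.
Qed.
Lemma DefT_value_ : DefT (fun h : unit * Br * Br * N => value h.1.1.2 h.1.2 h.2).
Proof. by have d := DefT_values_; rewrite /value; def. Qed.

Lemma value_zero m z n k : Nle n k -> value m z n = 0 -> value m z k = 0.
Proof.
have d := DefT_value_; move: k; apply: N_ind => [||k IH]; first by def.
  by move=> /NleO <-.
by move=> /NleS[/IH h /h e|<- //]; rewrite valueS e mul0r.
Qed.
End Value.

End Flows.

Ltac def_flows :=
  match goal with
  | h : ZF _ |- DefT (fun g => zext _ _) => apply: (DefT_comp1 (DefT_zext_ h))
  | h : ZF _, r : is_real_field _ |- DefT (fun g => ratio _ _ (bit _ _) _) => apply (DefT_ratio_bit h r)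
  | h : ZF _, r : is_real_field _ |- DefT (fun g => ratio _ _ ?b _) => apply: (DefT_comp1 (DefT_ratio_ h r b))
  | h : ZF _, r : is_real_field _ |- DefT (fun g => value _ _ _ _) =>
      apply: (DefT_comp3 (DefT_value_ _))
  | |- DefT (fun g => least _ _) => apply DefT_least
  end.
Ltac def_user ::= first [def_pair | def_ap | def_nat | def_tree | def_branch | def_real | def_analysis
  | def_flows].

Section Dichotomy.
Context {M : set_structure} (hZF : ZF M) (hAD : AD M) (R : field_data M) (hR : is_real_field R).
Local Notation N := (El (M := M) omega).
Local Notation F := (Real hZF hR).
Local Notation SR := (El (M := M) (fun_set omega (reals R))).
Local Notation Br := (El (M := M) (fun_set omega omega)).
Local Notation ap := (ap hZF).
Local Notation rap := (rap hZF hR).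
Local Notation O := (O hZF).
Local Notation S := (S hZF).
Local Notation Nle := (Nle hZF).
Local Notation ch := (ch hZF).
Local Notation len := (len hZF).
Local Notation pre := (pre hZF).
Local Notation path := (path hZF).
Local Notation bit := (bit hZF).
Local Notation half := (half hZF hR).
Local Notation upd := (upd hZF).
Local Notation least := (least hZF).
Local Notation zext := (zext hZF).
Local Notation ratio := (ratio hZF hR).
Local Notation superflow := (superflow hZF hR).
Local Notation flow := (flow hZF hR).
Local Notation covers := (covers hZF hR).
Implicit Types (n k t : N) (f g h u : SR) (m z : Br) (b : bool).

Section Game.
Variables (w : SR) (v : F) (X : Br -> Prop).
Hypothesis dX : Def (fun h : unit * Br => X h.2).
Hypothesis w0 : forall t, 0 <= rap w t.
Hypothesis v0 : 0 < v.
Local Notation value := (value v).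

(** In the splitting game, player I divides the mass of the current node, initially v
    at the root, between its children, and player II moves on to one of them.  Player I
    has to respect the capacity w and to force the branch into X unless the mass has
    vanished. *)
Definition payoff m z : Prop :=
  (forall n, value m z n <= rap w (pre z n)) /\
  (X (path z) \/ exists n, value m z n = 0).

Lemma Def_payoff_ : Def (fun h : unit * Br * Br => payoff h.1.2 h.2).
Proof. by rewrite /payoff; def. Qed.

Section StrategyI.
Variable Phi : Br -> Br.
Hypothesis dPhi : DefT (fun h : unit * Br => Phi h.2).
Hypothesis causal : forall z z' n, (forall k, Nlt k n -> ap z k = ap z' k) ->
  ap (Phi z) n = ap (Phi z') n.
Hypothesis win : forall z, payoff (Phi z) z.

(** The masses that the strategy attaches to the nodes form a flow, since the two shares
    of a node add up to its mass. *)
Lemma flow_of_strategy : exists h : SR, flow h /\ rap h O = v /\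
  (forall t, rap h t <= rap w t) /\
  forall z, (forall n, 0 < rap h (pre z n)) -> X (path z).
Proof.
pose move t := ap (Phi (zext t)) (len t).
have dm : DefT (fun h : unit * N => move h.2) by rewrite /move; def.
have [|h [h0 hS]] := @rtree_rec _ hZF _ hR v (fun b t (x : F) => x * ratio b (move t)).
  by move=> b; def.
have E z n : normal hZF z -> value (Phi z) z n = rap h (pre z n).
  move=> nz; move: n; apply: N_ind => [||n IH]; first by def.
    by rewrite valueO preO h0.
  rewrite valueS preS hS IH; congr (_ * ratio _ _).
  by rewrite /move len_pre; apply: causal => k kn; rewrite zext_pre.
have hge t : 0 <= rap h t.
  move: t; apply: tree_ind => [||b t IH]; first by def.
    by rewrite h0 ltW.
  by rewrite hS mulr_ge0 //; case: (ratio_bounds hZF hR b (move t)).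
exists h; split; [split=> // t|split=> //; split=> [t|z hz]].
- by rewrite !hS -mulrDr ratio_sum mulr1.
- have [H _] := win (zext t); have := H (len t).
  by rewrite E ?pre_zext //; apply: zext_normal.
- have [z' [nz e]] := normalize hZF z.
  have e' n : pre z' n = pre z n by rewrite /pre e.
  have [_] := win z'; rewrite e => -[//|[n]].
  by rewrite E // e' => hn; have := hz n; rewrite hn ltxx.
Qed.
End StrategyI.

Section StrategyII.
Variable Psi : Br -> Br.
Hypothesis dPsi : DefT (fun h : unit * Br => Psi h.2).
Hypothesis causal : forall m m' n, (forall k, Nle k n -> ap m k = ap m' k) ->
  ap (Psi m) n = ap (Psi m') n.
Hypothesis win : forall m, ~ payoff m (Psi m).
Variable eps : F.
Hypothesis eps0 : 0 < eps.

(** The move k at the node t, after the moves m, is answered by the child b. *)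
Definition answer b t m k : Prop := bit (ap (Psi (upd m (len t) k)) (len t)) = b.

Lemma Def_answer_ b : Def (fun h : unit * N * Br * N => answer b h.1.1.2 h.1.2 h.2).
Proof.
rewrite /answer /bit; case: b.
- apply: (@Def_ext _ _ _ (fun h : unit * N * Br * N =>
    ap (Psi (upd h.1.2 (len h.1.1.2) h.2)) (len h.1.1.2) <> O)); last by def.
  by case=> [[[c t] m] k] /=; split=> [H|/asboolP //]; apply/asboolP.
- apply: (@Def_ext _ _ _ (fun h : unit * N * Br * N =>
    ap (Psi (upd h.1.2 (len h.1.1.2) h.2)) (len h.1.1.2) = O)); last by def.
  case=> [[[c t] m] k] /=; split=> [H|]; first by apply/asboolP => /(_ H).
  by move/negbT/asboolPn/contrapT.
Qed.

Definition tol n : F := eps * (half n * half n) / (4%:R * v).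

Lemma tol_gt0 n : 0 < tol n.
Proof.
rewrite /tol; have := half_gt0 hZF hR n => h.
by rewrite divr_gt0 ?mulr_gt0 // ltr0n.
Qed.

(** A move answered by b that gives b almost the least possible share. *)
Definition thrifty b t m k : Prop := answer b t m k /\
  forall k', answer b t m k' -> ratio b k <= ratio b k' + tol (len t).
Definition pick b t m : N := least (thrifty b t m).

Lemma Def_thrifty_ b : Def (fun h : unit * N * Br * N => thrifty b h.1.1.2 h.1.2 h.2).
Proof. by have d := Def_answer_ b; rewrite /thrifty /tol; def. Qed.

Lemma DefT_pick_ b : DefT (fun h : unit * N * Br => pick b h.1.2 h.2).
Proof. by have d := Def_thrifty_ b; rewrite /pick; def. Qed.

Lemma pickP b t m : (exists k, answer b t m k) -> thrifty b t m (pick b t m).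
Proof.
move=> [k0 a0]; have d := Def_thrifty_ b; have da := Def_answer_ b.
apply: leastP; first by def.
have [|||s [s1 s2]] := @inf_ex _ hZF _ hR (fun x => exists k, answer b t m k /\ x = ratio b k).
- by def.
- by exists (ratio b k0), k0.
- by exists 0 => _ [k [_ ->]]; case: (ratio_bounds hZF hR b k).
have [k [ak hk]] : exists k, answer b t m k /\ ratio b k < s + tol (len t).
  apply: contrapT => /forallNP H; have := tol_gt0 (len t).
  suff : s + tol (len t) <= s by lra.
  apply: s2 => _ [k [ak ->]]; rewrite leNgt; apply/negP => hk; exact: (H k).
exists k; split=> // k' ak'; apply: ltW; apply: (lt_le_trans hk).
by rewrite lerD2r; apply: s1; exists k'.
Qed.

Lemma moves_ex : exists f : El (fun_set omega (fun_set omega omega)),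
  forall b t, ap f (ch b t) = upd (ap f t) (len t) (pick b t (ap f t)).
Proof.
have [c _] := lam_ex hZF (t := fun _ : N => O) (DefT_const (G := unit * N) O).
have [|f [_ fS]] := @tree_rec _ hZF _ c (fun b t (x : Br) => upd x (len t) (pick b t x)).
  by move=> b; have d := DefT_pick_ b; def.
by exists f.
Qed.

(** Attach to each node the moves by which player I reaches it with nearly the least
    possible mass, as long as the capacity is not reached.  These least masses almost
    form a superflow: otherwise some division of a node would give each child less than
    its least share, and player II could not answer it.  Along a branch in X on which the
    capacity is never reached player I would win with the attached moves. *)
Lemma cover_of_strategy : exists u : SR, superflow u /\ rap u O <= v + eps /\ covers w u X.
Proof.
have [mv mvS] := moves_ex; pose pk b t := pick b t (ap mv t).
have dpk b : DefT (fun h : unit * N => pk b h.2).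
  by have d := DefT_pick_ b; rewrite /pk; def.
have dpk0 := dpk false; have dpk1 := dpk true.
have [|h [h0 hS]] := @rtree_rec _ hZF _ hR v (fun b t (x : F) => x * ratio b (pk b t)).
  by move=> b; have d := dpk b; def.
pose unanswered t := exists t', (t = ch false t' /\ forall k, ~ answer false t' (ap mv t') k)
  \/ (t = ch true t' /\ forall k, ~ answer true t' (ap mv t') k).
have unansweredP b t : unanswered (ch b t) <-> forall k, ~ answer b t (ap mv t) k.
  split=> [[t' [[/ch_inj[-> ->]]|[/ch_inj[-> ->]]]] //|H].
  by exists t; case: b H => H; [right|left].
have unansweredO : ~ unanswered O.
  by move=> [t' [[/esym/ch_neqO]|[/esym/ch_neqO]]].
pose dead t := unanswered t \/ rap w t <= rap h t.
have dd : Def (fun h : unit * N => dead h.2).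
  have d0 := Def_answer_ false; have d1 := Def_answer_ true.
  by rewrite /dead /unanswered; def.
have [|A [A0 AS]] := @tree_rec _ hZF omega (S O)
    (fun b t a => if `[< a <> O /\ ~ dead t >] then S O else O).
  by move=> b; def.
pose alive t := ap A t <> O.
have da : Def (fun h : unit * N => alive h.2) by rewrite /alive; def.
have aliveO : alive O by rewrite /alive A0; apply: S_neqO.
have alive_ch b t : alive (ch b t) <-> alive t /\ ~ dead t.
  by rewrite {1}/alive AS if_neqO.
have hge t : 0 <= rap h t.
  move: t; apply: tree_ind => [||b t IH]; first by def.
    by rewrite h0 ltW.
  by rewrite hS mulr_ge0 //; case: (ratio_bounds hZF hR b (pk b t)).
have hle t : rap h t <= v.
  move: t; apply: tree_ind => [||b t IH]; first by def.
    by rewrite h0.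
  rewrite hS; have [r1 r2] := ratio_bounds hZF hR b (pk b t).
  by apply: le_trans IH; have := hge t; nra.
(* Every run that starts with the moves attached to t is answered by t. *)
have hist t : alive t -> ~ unanswered t -> forall m, (forall k, Nlt k (len t) -> ap m k = ap (ap mv t) k) ->
    pre (Psi m) (len t) = t /\ value m (Psi m) (len t) = rap h t /\
    forall i, Nlt i (len t) -> value m (Psi m) i <= rap w (pre (Psi m) i).
  have d0 := Def_answer_ false; have d1 := Def_answer_ true.
  move: t; apply: tree_ind => [||b t IH /alive_ch[at_ /not_orP[nu /negP]]].
  - by rewrite /unanswered; def.
  - by move=> _ _ m _; rewrite lenO preO valueO h0; split=> //; split=> // i /NltO.
  rewrite -ltNge => hw nub m Em.
  have [th _] : thrifty b t (ap mv t) (pk b t).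
    apply: pickP; apply: contrapT => H; apply: nub; apply/unansweredP => k ak.
    by apply: H; exists k.
  have Em' k : Nlt k (len t) -> ap m k = ap (ap mv t) k.
    move=> kt; rewrite Em ?mvS ?upd_neq // ?len_ch; last by apply/NltS; left.
    by move=> e; subst k; apply: (Nlt_irr hZF kt).
  have [p1 [p2 p3]] := IH at_ nu m Em'.
  have e : ap (Psi m) (len t) = ap (Psi (upd (ap mv t) (len t) (pk b t))) (len t).
    by apply: causal => k kt; rewrite Em ?mvS // len_ch.
  have mt : ap m (len t) = pk b t.
    by rewrite Em ?mvS ?upd_eq // len_ch; apply: NltnS.
  rewrite len_ch preS valueS e th p1 p2 mt hS; split=> //; split=> // i /NltS[/p3 //|->].
  by rewrite p1 p2 ltW.
(* A run that reaches mass 0 legally is won by player I. *)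
have no_zero t m : (forall k, Nlt k (len t) -> ap m k = ap (ap mv t) k) -> alive t -> ~ dead t ->
    0 < rap h t * ratio (bit (ap (Psi m) (len t))) (ap m (len t)).
  move=> Em at_ /not_orP[nu /negP]; rewrite -ltNge => hw.
  have [p1 [p2 p3]] := hist t at_ nu m Em.
  rewrite lt_neqAle eq_sym mulr_ge0 ?andbT //; last by case: (ratio_bounds hZF hR (bit (ap (Psi m) (len t))) (ap m (len t))).
  apply/eqP => z0; have vz : value m (Psi m) (S (len t)) = 0 by rewrite valueS p2.
  apply: (win (m := m)); split; last by right; exists (S (len t)).
  move=> n; have [nt|] := pselect (Nle n (len t)).
    by case/NleP: nt => [/p3 //|->]; rewrite p1 p2 ltW.
  move=> /(proj1 (Nnot_le hZF _ _)) nt.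
  have -> : value m (Psi m) n = 0; last exact: w0.
  exact: (value_zero (proj2 (Nle_lt_S hZF _ _) nt) vz).
pose cost t := if `[< dead t >] then rap w t else rap h t.
have dc : DefT (fun h : unit * N => cost h.2) by rewrite /cost; def.
have cost_le b t k : alive t -> ~ dead t -> answer b t (ap mv t) k ->
    cost (ch b t) <= rap h t * ratio b k + v * tol (len t).
  move=> at_ nd ak; apply: (le_trans (y := rap h (ch b t))).
    rewrite /cost; case: asboolP => // -[/unansweredP/(_ k) //|//].
  have [_ /(_ _ ak) tk] : thrifty b t (ap mv t) (pk b t) by apply: pickP; exists k.
  rewrite hS; have := hge t; have := hle t; have := tol_gt0 (len t).
  move: tk; rewrite -/(pk b t).
  move: (ratio b (pk b t)) (ratio b k) (tol _) (rap h t) => r1 r2 to_ H h1 h2 h3 h4.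
  by nra.
have cost2 t : alive t -> ~ dead t ->
    cost (ch false t) + cost (ch true t) <= rap h t + v * tol (len t) * 2%:R.
  move=> at_ nd; rewrite leNgt; apply/negP => H.
  have hpos : 0 < rap h t.
    have := no_zero t (ap mv t) (fun _ _ => erefl) at_ nd.
    have := hge t; rewrite le_eqVlt => /orP[/eqP <-|//]; by rewrite mul0r ltxx.
  have ans k : exists b, answer b t (ap mv t) k /\ 0 < rap h t * ratio b k.
    exists (bit (ap (Psi (upd (ap mv t) (len t) k)) (len t))); split=> //.
    have := no_zero t (upd (ap mv t) (len t) k) _ at_ nd; rewrite upd_eq; apply.
    by move=> j jt; rewrite upd_neq // => e; subst j; apply: (Nlt_irr hZF jt).
  have [k0 [k1 [r0 r1]]] := ratio_ends hZF hR.
  have s0 := ratio_sum hZF hR k0; have s1 := ratio_sum hZF hR k1.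
  set c0 := cost (ch false t) in H *; set c1 := cost (ch true t) in H *.
  set T := v * tol (len t) in H *.
  have B1 : c1 <= rap h t + T.
    have [b [ab]] := ans k0; case: b ab => ab; last by rewrite r0 mulr0 ltxx.
    move=> _; have := cost_le _ _ _ at_ nd ab; rewrite -/c1 -/T.
    by move: s0; rewrite r0 add0r => ->; rewrite mulr1.
  have B0 : c0 <= rap h t + T.
    have [b [ab]] := ans k1; case: b ab => ab; first by rewrite r1 mulr0 ltxx.
    move=> _; have := cost_le _ _ _ at_ nd ab; rewrite -/c0 -/T.
    by move: s1; rewrite r1 addr0 => ->; rewrite mulr1.
  have [|||k [kp kq]] := @ratio_dense _ hZF _ hR ((rap h t - (c1 - T)) / rap h t) ((c0 - T) / rap h t).
  - by rewrite divr_ge0 //; lra.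
  - by rewrite ltr_pM2r ?invr_gt0 //; lra.
  - by rewrite ler_pdivrMr // mul1r; lra.
  move: kp kq; rewrite ltr_pdivrMr // ltr_pdivlMr // => kp kq.
  have sk := ratio_sum hZF hR k.
  have [b [ab _]] := ans k; have := cost_le _ _ _ at_ nd ab; rewrite -/T.
  case: b {ab}; rewrite -?/c0 -?/c1; last by lra.
  have -> : ratio true k = 1 - ratio false k by lra.
  by lra.
(* The surplus err n of a node at level n is halved by passing to its two children;
   the other half pays for the tolerances of the two attached moves. *)
pose err n := eps * (half n * half n).
have [|u uP] := @rlam_ex _ hZF _ hR (fun t => if `[< alive t >] then cost t + err (len t) else 0).
  by rewrite /err; def.
have err0 n : 0 < err n by rewrite /err; have := half_gt0 hZF hR n => hh; rewrite !mulr_gt0.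
have cost0 t : 0 <= cost t by rewrite /cost; case: asboolP.
exists u; split; first split=> [t|t].
- by rewrite uP; case: asboolP => // _; rewrite addr_ge0 // ltW.
- rewrite !uP !len_ch; case: (pselect (alive t)) => [at_|na]; last first.
    by rewrite !asboolF ?addr0 // => /alive_ch[].
  case: (pselect (dead t)) => [dt|nd].
    rewrite (asboolF (P := alive (ch false t))); last by move=> /alive_ch[].
    rewrite (asboolF (P := alive (ch true t))); last by move=> /alive_ch[].
    by rewrite asboolT // addr0 addr_ge0 // ltW.
  rewrite !asboolT //; try by apply/alive_ch.
  have := cost2 t at_ nd.
  have -> : v * tol (len t) * 2%:R = err (len t) / 2%:R.
    by rewrite /tol /err; field; rewrite gt_eqF.
  have -> : err (S (len t)) = err (len t) / 4%:R by rewrite /err halfS; field.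
  have -> : cost t = rap h t by rewrite /cost asboolF.
  by move: (err0 (len t)); lra.
- split.
    rewrite uP asboolT // lenO /err halfO !mulr1; rewrite lerD2r /cost.
    by case: asboolP => [[/unansweredO|]|_] //; rewrite h0.
move=> z Xz; apply: contrapT => /forallNP H.
have {}H n : rap u (pre z n) < rap w (pre z n) by rewrite ltNge; apply/negP/H.
have an n : alive (pre z n) /\ ~ dead (pre z n).
  have nd k : alive (pre z k) -> ~ dead (pre z k).
    move=> ak dk; have := H k; rewrite uP asboolT // /cost asboolT //.
    by have := err0 (len (pre z k)); lra.
  suff ak : alive (pre z n) by split=> //; apply: nd.
  move: n; apply: N_ind => [||n IH]; [by def|by rewrite preO|].
  by rewrite preS; apply/alive_ch; split=> //; apply: nd.
have [|m mP] := @lam_ex _ hZF omega omega (fun n => ap (ap mv (pre z (S n))) n).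
  by def.
have agree n : forall k, Nlt k n -> ap m k = ap (ap mv (pre z n)) k.
  move: n; apply: N_ind => [|k /NltO //|n IH k /NltS[kn|->]]; first by def.
    rewrite preS mvS len_pre upd_neq ?IH // => e; subst k; exact: (Nlt_irr hZF kn).
  by rewrite mP.
have hz n : pre (Psi m) n = pre z n /\ value m (Psi m) n = rap h (pre z n).
  have [a1 /not_orP[a2 _]] := an n.
  have := hist _ a1 a2 m; rewrite len_pre => /(_ (agree n))[p1 [p2 _]].
  by rewrite p1 p2.
have ez : path (Psi m) = path z by apply: ap_ext => n; case: (hz n).
apply: (win (m := m)); split; last by left; rewrite ez.
move=> n; have [-> ->] := hz n; have [_ /not_orP[_ /negP]] := an n.
by rewrite -ltNge; apply: ltW.
Qed.
End StrategyII.
End Game.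

(** The two outcomes of the splitting game, which is determined for every definable X. *)
Theorem flow_or_cover (w : SR) (v : F) (X : Br -> Prop) :
  Def (fun h : unit * Br => X h.2) -> (forall t, 0 <= rap w t) -> 0 < v ->
  (exists h : SR, flow h /\ rap h O = v /\ (forall t, rap h t <= rap w t) /\
     forall z, (forall n, 0 < rap h (pre z n)) -> X (path z)) \/
  (forall eps : F, 0 < eps -> exists u : SR, superflow u /\ rap u O <= v + eps /\ covers w u X).
Proof.
move=> dX w0 v0; have dp := Def_payoff_ w v dX.
case: (determinacy hZF hAD dp) => [[Phi [d [c W]]]|[Psi [d [c W]]]].
- by left; apply: (flow_of_strategy v0 d c).
- by right=> eps e0; apply: (cover_of_strategy w0 v0 d c W e0).
Qed.

End Dichotomy.

(** * Null sets *)

Section Null.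
Context {M : set_structure} (hZF : ZF M) (hAD : AD M) (R : field_data M) (hR : is_real_field R).
Local Notation N := (El (M := M) omega).
Local Notation F := (Real hZF hR).
Local Notation SR := (El (M := M) (fun_set omega (reals R))).
Local Notation Br := (El (M := M) (fun_set omega omega)).
Local Notation ap := (ap hZF).
Local Notation rap := (rap hZF hR).
Local Notation O := (O hZF).
Local Notation S := (S hZF).
Local Notation Nle := (Nle hZF).
Local Notation ch := (ch hZF).
Local Notation len := (len hZF).
Local Notation pre := (pre hZF).
Local Notation path := (path hZF).
Local Notation bit := (bit hZF).
Local Notation superflow := (superflow hZF hR).
Local Notation flow := (flow hZF hR).
Local Notation covers := (covers hZF hR).
Implicit Types (n k t : N) (f g h u w mu : SR) (m z p : Br) (b : bool) (X Y : Br -> Prop).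

Definition null mu X : Prop := forall eps : F, 0 < eps ->
  exists u, superflow u /\ rap u O <= eps /\ covers mu u X.

Definition positive mu p : Prop := forall n, 0 < rap mu (ap p n).

Lemma null_sub mu mu' X Y : (forall t, rap mu' t <= rap mu t) ->
  (forall z, Y (path z) -> X (path z)) -> null mu X -> null mu' Y.
Proof.
move=> Hm XY H eps e0; have [u [su [u0 cu]]] := H eps e0.
exists u; split=> //; split=> // z /XY/cu[n hn]; exists n; exact: le_trans hn.
Qed.

Lemma nullU mu X Y : null mu X -> null mu Y -> null mu (fun p => X p \/ Y p).
Proof.
move=> HX HY eps e0; have e2 : 0 < eps / 2%:R by lra.
have [u [[u1 u2] [u0 cu]]] := HX _ e2; have [v [[v1 v2] [v0 cv]]] := HY _ e2.
have [|s sP] := @rlam_ex _ hZF _ hR (fun t => rap u t + rap v t); first by def.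
exists s; split; first split=> [t|t]; rewrite ?sP.
- by rewrite addr_ge0.
- by have := u2 t; have := v2 t; lra.
split; first by rewrite ?sP; lra.
move=> z [/cu|/cv] [n hn]; exists n; rewrite ?sP; apply: le_trans hn _.
  by rewrite lerDl.
by rewrite lerDr.
Qed.

Lemma flow_mono h b t : flow h -> rap h (ch b t) <= rap h t.
Proof.
move=> [h0 hS]; have := hS t; have := h0 (ch false t); have := h0 (ch true t).
by case: b; lra.
Qed.

(** A strict inequality at a node persists at one of its children. *)
Lemma not_covered mu u : flow mu -> rap u O < rap mu O -> superflow u ->
  exists z, forall n, rap u (pre z n) < rap mu (pre z n).
Proof.
move=> [m0 mS] h0 [u0 uS]; apply: (@branch _ hZF (fun t => rap u t < rap mu t)) => //.
  by def.
move=> t ht; have := uS t; have := mS t => e1 e2.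
have [h|h] := ltP (rap u (ch true t)) (rap mu (ch true t)); first by exists true.
by exists false; lra.
Qed.

Lemma flow_not_null mu X : flow mu -> 0 < rap mu O ->
  (forall z, positive mu (path z) -> X (path z)) -> ~ null mu X.
Proof.
move=> fm m0 H nX; have [|u [su [u0 cu]]] := nX (rap mu O / 2%:R); first by lra.
have [|z zP] := not_covered fm (u := u) _ su; first by lra.
have [|n] := cu z; last by rewrite leNgt zP.
by apply: H => n; apply: le_lt_trans (zP n); case: su.
Qed.

(** The dichotomy with mu as capacity: a set without small covers carries a flow. *)
Lemma flow_in_not_null mu X : Def (fun h : unit * Br => X h.2) ->
  (forall t, 0 <= rap mu t) -> ~ null mu X ->
  exists h, flow h /\ 0 < rap h O /\ (forall t, rap h t <= rap mu t) /\
    forall z, positive h (path z) -> X (path z).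
Proof.
move=> dX m0; move/existsNP=> [eps /not_implyP[e0 H]].
have e2 : 0 < eps / 2%:R by lra.
have [[h [fh [hO [hm hX]]]]|K] := flow_or_cover hAD dX m0 e2.
  by exists h; rewrite hO.
by case: H; have [u [su [u0 cu]]] := K _ e2; exists u; split=> //; split=> //; lra.
Qed.

End Null.

(** * Subflows on pairs of nodes *)

Section Pairs.
Context {M : set_structure} (hZF : ZF M) (hAD : AD M) (R : field_data M) (hR : is_real_field R).
Local Notation N := (El (M := M) omega).
Local Notation F := (Real hZF hR).
Local Notation SR := (El (M := M) (fun_set omega (reals R))).
Local Notation Br := (El (M := M) (fun_set omega omega)).
Local Notation ap := (ap hZF).
Local Notation rap := (rap hZF hR).
Local Notation O := (O hZF).
Local Notation S := (S hZF).
Local Notation Nle := (Nle hZF).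
Local Notation dbl := (dbl hZF).
Local Notation par := (par hZF).
Local Notation lastbit := (lastbit hZF).
Local Notation ch := (ch hZF).
Local Notation len := (len hZF).
Local Notation pre := (pre hZF).
Local Notation path := (path hZF).
Local Notation bit := (bit hZF).
Local Notation upd := (upd hZF).
Local Notation superflow := (superflow hZF hR).
Local Notation flow := (flow hZF hR).
Local Notation covers := (covers hZF hR).
Local Notation null := (null hZF hR).
Local Notation positive := (positive hZF hR).
Implicit Types (n s t : N) (f g h u w mu : SR) (m z p x y : Br) (a b : bool).

(** A mass distribution on pairs of nodes of equal length, in which some mass may
   be created along the way but none after it has vanished. *)
Record subpair mu (k : N -> N -> F) : Prop := {
  subpair_def : DefT (fun h : unit * N * N => k h.1.2 h.2);
  subpair_ge0 : forall s t, 0 <= k s t;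
  subpair_le : forall s t, k s t <= rap mu s * rap mu t;
  subpair_split : forall s t, k s t <=
    k (ch false s) (ch false t) + k (ch false s) (ch true t) +
    (k (ch true s) (ch false t) + k (ch true s) (ch true t));
  subpair_hered : forall a b s t, 0 < k (ch a s) (ch b t) -> 0 < k s t;
  subpair_pos : 0 < k O O
}.

(** Interleaving identifies pairs of branches with branches, which makes the dichotomy
    applicable to relations. *)
Lemma weave_ex : exists I : El (fun_set omega (fun_set omega omega)),
  (forall t, ap (ap I O) t = O) /\
  forall a s t, ap (ap I (ch a s)) t = ch (lastbit t) (ch a (ap (ap I s) (par t))).
Proof.
have [c cP] := lam_ex hZF (t := fun _ : N => O) (DefT_const (G := unit * N) O).
pose g a (f : Br) (t : N) := ch (lastbit t) (ch a (ap f (par t))).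
have dg a : DefT (fun h : unit * Br * N => g a h.1.2 h.2).
  by rewrite /g /lastbit; case: a; def.
have dg1 a (f : Br) : DefT (fun h : unit * N => g a f h.2).
  by have d := dg a; def.
pose stp a (_ : N) (f : Br) : Br := projT1 (cid (lam_ex hZF (dg1 a f))).
have stpP a n (f : Br) t : ap (stp a n f) t = g a f t := projT2 (cid (lam_ex hZF (dg1 a f))) t.
have [|I [I0 IS]] := @tree_rec _ hZF _ c stp.
  move=> b; apply: (DefT_fn_ (hZF := hZF) (t' := fun (h : unit * N * Br) (k : N) => g b h.2 k)) => //.
  by have d := dg b; def.
by exists I; split=> [t|a s t]; rewrite ?I0 ?cP // IS stpP.
Qed.
Definition weave s t : N := ap (ap (projT1 (cid weave_ex)) s) t.
Lemma weaveO t : weave O t = O.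
Proof. exact: proj1 (projT2 (cid weave_ex)) t. Qed.
Lemma weave_ch a b s t : weave (ch a s) (ch b t) = ch b (ch a (weave s t)).
Proof.
by rewrite [LHS](proj2 (projT2 (cid weave_ex)) a s (ch b t)) lastbit_ch par_ch.
Qed.
Lemma DefT_weave_ : DefT (fun h : unit * N * N => weave h.1.2 h.2).
Proof. by rewrite /weave; def. Qed.

(** The two nodes woven into a node, as the values at 0 and 1 of a function; a
   step of the tree exchanges their roles. *)
Lemma unweave_ex : exists D : El (fun_set omega (fun_set omega omega)),
  (ap (ap D O) O = O /\ ap (ap D O) (S O) = O) /\
  forall b t, ap (ap D (ch b t)) O = ap (ap D t) (S O) /\
    ap (ap D (ch b t)) (S O) = ch b (ap (ap D t) O).
Proof.
have [c cP] := lam_ex hZF (t := fun _ : N => O) (DefT_const (G := unit * N) O).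
have [|D [D0 DS]] := @tree_rec _ hZF _ c (fun b t (f : Br) =>
  upd (upd f O (ap f (S O))) (S O) (ch b (ap f O))).
  by case; def.
exists D; split; first by rewrite D0 !cP.
by move=> b t; rewrite DS upd_eq upd_neq ?upd_eq // => /esym/S_neqO.
Qed.
Definition lnode t : N := ap (ap (projT1 (cid unweave_ex)) t) O.
Definition rnode t : N := ap (ap (projT1 (cid unweave_ex)) t) (S O).
Lemma lnodeO : lnode O = O. Proof. exact: proj1 (proj1 (projT2 (cid unweave_ex))). Qed.
Lemma rnodeO : rnode O = O. Proof. exact: proj2 (proj1 (projT2 (cid unweave_ex))). Qed.
Lemma lnode_ch b t : lnode (ch b t) = rnode t.
Proof. exact: proj1 (proj2 (projT2 (cid unweave_ex)) b t). Qed.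
Lemma rnode_ch b t : rnode (ch b t) = ch b (lnode t).
Proof. exact: proj2 (proj2 (projT2 (cid unweave_ex)) b t). Qed.
Lemma DefT_lnode_ : DefT (fun h : unit * N => lnode h.2).
Proof. by rewrite /lnode; def. Qed.
Lemma DefT_rnode_ : DefT (fun h : unit * N => rnode h.2).
Proof. by rewrite /rnode; def. Qed.

Lemma weaveK s t : len s = len t -> lnode (weave s t) = s /\ rnode (weave s t) = t.
Proof.
have d := DefT_weave_; have dl := DefT_lnode_; have dr := DefT_rnode_.
move: s t; apply: tree_ind => [|t|a s IH t]; first by def.
  rewrite weaveO lnodeO rnodeO; case: (node_case hZF t) => [->|[b [t' ->]]] //.
  by rewrite lenO len_ch => /esym/S_neqO.
case: (node_case hZF t) => [->|[b [t' ->]]]; first by rewrite lenO len_ch => /S_neqO.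
rewrite !len_ch weave_ch !(lnode_ch, rnode_ch) => /S_inj/IH[-> ->] //.
Qed.

Lemma pre_weave z n : pre z (dbl n) = weave (pre (evens hZF z) n) (pre (odds hZF z) n).
Proof.
have d := DefT_weave_; have de := DefT_evens_ hZF; have do_ := DefT_odds_ hZF.
move: n; apply: N_ind => [||n IH]; first by def.
  by rewrite dblO !preO weaveO.
by rewrite dblS !preS weave_ch evensE oddsE IH.
Qed.

Lemma merge_ex x y : exists z, evens hZF z = x /\ odds hZF z = y.
Proof.
have [|z zP] := @lam_ex _ hZF omega omega
  (fun k => if `[< exists t, k = dbl t >] then ap x (par (S k)) else ap y (par k)).
  by def.
exists z; split; apply: ap_ext => n; rewrite ?evensE ?oddsE zP.
  by rewrite asboolT ?par_odd //; exists n.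
by rewrite asboolF ?par_odd // => -[t /esym/dbl_neqS].
Qed.

Lemma sides_ex p : exists q : Br * Br, (forall n, ap q.1 n = lnode (ap p (dbl n))) /\
  forall n, ap q.2 n = rnode (ap p (dbl n)).
Proof.
have dl := DefT_lnode_; have dr := DefT_rnode_.
have [|x xP] := @lam_ex _ hZF omega omega (fun n => lnode (ap p (dbl n))); first by def.
have [|y yP] := @lam_ex _ hZF omega omega (fun n => rnode (ap p (dbl n))); first by def.
by exists (x, y).
Qed.
Definition lpath p : Br := (projT1 (cid (sides_ex p))).1.
Definition rpath p : Br := (projT1 (cid (sides_ex p))).2.
Lemma lpathE p n : ap (lpath p) n = lnode (ap p (dbl n)).
Proof. exact: proj1 (projT2 (cid (sides_ex p))) n. Qed.
Lemma rpathE p n : ap (rpath p) n = rnode (ap p (dbl n)).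
Proof. exact: proj2 (projT2 (cid (sides_ex p))) n. Qed.
Lemma DefT_lpath_ : DefT (fun h : unit * Br => lpath h.2).
Proof.
have d := DefT_lnode_.
apply: (DefT_fn_ (hZF := hZF) (t' := fun (h : unit * Br) (n : N) => lnode (ap h.2 (dbl n)))).
  by move=> h n; rewrite lpathE.
by def.
Qed.
Lemma DefT_rpath_ : DefT (fun h : unit * Br => rpath h.2).
Proof.
have d := DefT_rnode_.
apply: (DefT_fn_ (hZF := hZF) (t' := fun (h : unit * Br) (n : N) => rnode (ap h.2 (dbl n)))).
  by move=> h n; rewrite rpathE.
by def.
Qed.

Lemma sides_path z : lpath (path z) = path (evens hZF z) /\ rpath (path z) = path (odds hZF z).
Proof.
split; apply: ap_ext => n; rewrite ?lpathE ?rpathE -/(pre z (dbl n)) pre_weave.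
  by case: (weaveK (s := pre (evens hZF z) n) (t := pre (odds hZF z) n)) => //; rewrite !len_pre.
by case: (weaveK (s := pre (evens hZF z) n) (t := pre (odds hZF z) n)) => //; rewrite !len_pre.
Qed.

Record subflow g : Prop := {
  subflow_ge0 : forall t, 0 <= rap g t;
  subflow_split : forall t, rap g t <= rap g (ch false t) + rap g (ch true t);
  subflow_hered : forall b t, 0 < rap g (ch b t) -> 0 < rap g t
}.

Lemma subflow_flow h : flow h -> subflow h.
Proof.
move=> fh; split=> [t|t|b t h0].
- by case: fh.
- by case: fh => _ ->.
- by apply: lt_le_trans h0 (flow_mono b t fh).
Qed.

(** What a superflow leaves of a flow, cut off where nothing is left. *)
Lemma remainder w u : flow w -> superflow u -> rap u O < rap w O ->
  exists g, subflow g /\ 0 < rap g O /\ (forall t, rap g t <= rap w t) /\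
    forall t, 0 < rap g t -> rap u t < rap w t.
Proof.
move=> [w0 wS] [u0 uS] uw.
have [|g [g0 gS]] := @rtree_rec _ hZF _ hR (rap w O - rap u O) (fun b t (x : F) =>
  if `[< is_true (0 < x) >] then Num.max 0 (rap w (ch b t) - rap u (ch b t)) else 0).
  by case; def.
have gP t : rap g t <= rap w t /\ 0 <= rap g t /\
    (0 < rap g t -> rap g t = rap w t - rap u t).
  move: t; apply: tree_ind => [||b t [IH1 [IH2 IH3]]]; first by def.
    by rewrite g0; split; [have := u0 O; lra|split; lra].
  rewrite gS; case: asboolP => _; last by split=> //; split=> //; rewrite ltxx.
  have := u0 (ch b t); have := w0 (ch b t); rewrite /Num.max.
  by case: ltP => h h1 h2; split; [lra|split; lra|lra|split=> //; lra].
exists g; split; first split=> [t|t|b t].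
- by case: (gP t) => _ [].
- have [_ [gt0 gt]] := gP t; case: (ltP 0 (rap g t)) => [h|h]; last first.
    by apply: le_trans h _; apply: addr_ge0; [case: (gP (ch false t)) => _ []|case: (gP (ch true t)) => _ []].
  rewrite (gt h) !gS !asboolT //; have := uS t; have := wS t.
  have : forall x : F, x <= Num.max 0 x by move=> x; rewrite le_max lexx orbT.
  move=> Hm; have := Hm (rap w (ch false t) - rap u (ch false t)).
  by have := Hm (rap w (ch true t) - rap u (ch true t)); lra.
- by rewrite gS; case: asboolP => //; rewrite ltxx.
split; first by rewrite g0; lra.
split=> t; first by case: (gP t).
by have [_ [_ H]] := gP t; move=> h; have := H h; lra.
Qed.

Lemma subflow_mono g z n k : subflow g -> Nle n k -> 0 < rap g (pre z k) -> 0 < rap g (pre z n).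
Proof.
move=> [_ _ gh]; move: k; apply: N_ind => [||k IH]; first by def.
  by move=> /NleO ->.
by move=> /NleS[/IH H|-> //]; rewrite preS => /gh.
Qed.

(** Two steps of the interleaved tree are one step on pairs of nodes of equal length. *)
Lemma subpair_of_subflow mu g (E : Br -> Br -> Prop) : flow mu -> subflow g -> 0 < rap g O ->
  (forall t, rap g t <= rap mu (lnode t) * rap mu (rnode t)) ->
  (forall z, positive g (path z) -> E (lpath (path z)) (rpath (path z))) ->
  exists k, subpair mu k /\
    forall x y, (forall n, 0 < k (pre x n) (pre y n)) -> E (path x) (path y).
Proof.
move=> [m0 mS] sg g0 gm gE; have dw := DefT_weave_.
have [gg gs gh] := sg.
exists (fun s t => if `[< len s = len t >] then rap g (weave s t) else 0); split; last first.
  move=> x y H; have [z [ex ey]] := merge_ex x y.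
  have [<- <-] : lpath (path z) = path x /\ rpath (path z) = path y.
    by have [-> ->] := sides_path z; rewrite ex ey.
  apply: gE => n; apply: (subflow_mono sg (le_dbl hZF n)).
  by have := H n; rewrite asboolT ?len_pre // pre_weave ex ey.
have lenE a b s t : `[< len (ch a s) = len (ch b t) >] = `[< len s = len t >].
  by apply: asbool_equiv_eq; rewrite !len_ch; split=> [/S_inj|->].
split.
- by def.
- by move=> s t; case: asboolP => // _.
- move=> s t; case: asboolP => [e|_]; last by rewrite mulr_ge0.
  by have [e1 e2] := weaveK e; have := gm (weave s t); rewrite e1 e2.
- move=> s t; rewrite !lenE; case: asboolP => [e|_]; last by rewrite !addr0.
  rewrite !weave_ch; have := gs (weave s t).
  by have := gs (ch false (weave s t)); have := gs (ch true (weave s t)); lra.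
- by move=> a b s t; rewrite lenE; case: asboolP => // _; rewrite weave_ch => /gh/gh.
- by rewrite asboolT // weaveO.
Qed.

(** The dichotomy for the product of mu with itself and half of its mass: a superflow
    covering E with three quarters of the mass leaves a quarter to the complement. *)
Lemma product_dichotomy mu (E : Br -> Br -> Prop) :
  Def (fun h : unit * Br * Br => E h.1.2 h.2) -> flow mu -> 0 < rap mu O ->
  (exists k, subpair mu k /\
     forall x y, (forall n, 0 < k (pre x n) (pre y n)) -> E (path x) (path y)) \/
  (exists k, subpair mu k /\
     forall x y, (forall n, 0 < k (pre x n) (pre y n)) -> ~ E (path x) (path y)).
Proof.
move=> dE fm mO; have [m0 mS] := fm.
have dl := DefT_lnode_; have dr := DefT_rnode_; have dlp := DefT_lpath_; have drp := DefT_rpath_.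
have [|w wP] := @rlam_ex _ hZF _ hR (fun t => rap mu (lnode t) * rap mu (rnode t)).
  by def.
have fw : flow w.
  split=> t; rewrite !wP ?mulr_ge0 // !lnode_ch !rnode_ch -mulrDr mS mulrC //.
have wO : 0 < rap w O by rewrite wP lnodeO rnodeO mulr_gt0.
have v0 : 0 < rap w O / 2%:R by lra.
have [||[h [fh [hO [hw hE]]]]|K] := @flow_or_cover _ hZF hAD _ hR w _ (fun p => E (lpath p) (rpath p)) _ _ v0.
- by def.
- by case: fw.
- left; apply: (subpair_of_subflow fm (subflow_flow fh)); rewrite ?hO //.
  by move=> t; rewrite -wP.
- right; have [|u [su [uO cu]]] := K (rap w O / 4%:R); first by lra.
  have [|g [sg [gO [gw gu]]]] := remainder fw su; first by lra.
  apply: (subpair_of_subflow (E := fun x y => ~ E x y) fm sg) => //.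
    by move=> t; rewrite -wP.
  move=> z hz /cu[n]; rewrite leNgt => /negP; apply; exact/gu/hz.
Qed.

End Pairs.

(** * Fubini: a mass distribution on pairs has a section that is not null *)

Section Fubini.
Context {M : set_structure} (hZF : ZF M) (R : field_data M) (hR : is_real_field R).
Local Notation N := (El (M := M) omega).
Local Notation F := (Real hZF hR).
Local Notation SR := (El (M := M) (fun_set omega (reals R))).
Local Notation Br := (El (M := M) (fun_set omega omega)).
Local Notation ap := (ap hZF).
Local Notation rap := (rap hZF hR).
Local Notation O := (O hZF).
Local Notation S := (S hZF).
Local Notation Nle := (Nle hZF).
Local Notation ch := (ch hZF).
Local Notation len := (len hZF).
Local Notation pre := (pre hZF).
Local Notation path := (path hZF).
Local Notation nr := (nr hZF hR).
Local Notation superflow := (superflow hZF hR).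
Local Notation flow := (flow hZF hR).
Local Notation covers := (covers hZF hR).
Local Notation null := (null hZF hR).
Local Notation alive := (alive hZF).
Implicit Types (n s t j : N) (f g h u mu : SR) (z p x y : Br) (a b : bool).

(** Sums over the descendants n levels below a node. *)
Lemma desc_ex f : exists D : El (fun_set omega (fun_set omega (reals R))),
  (forall t, rap (ap D O) t = rap f t) /\
  forall n t, rap (ap D (S n)) t = rap (ap D n) (ch false t) + rap (ap D n) (ch true t).
Proof.
pose g (f : SR) t : F := rap f (ch false t) + rap f (ch true t).
have dg : DefT (fun h : unit * SR * N => g h.1.2 h.2) by rewrite /g; def.
have dg1 (e : SR) : DefT (fun h : unit * N => g e h.2) by def.
pose stp (_ : N) (f : SR) : SR := projT1 (cid (rlam_ex (dg1 f))).
have stpP n (e : SR) t : rap (stp n e) t = g e t := projT2 (cid (rlam_ex (dg1 e))) t.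
have [|D [D0 DS]] := @rec_ex _ hZF _ f stp.
  apply: (DefT_rfn (hZF := hZF) (hR := hR) (t' := fun (h : unit * N * SR) (k : N) => g h.2 k)) => //.
  by def.
by exists D; split=> [t|n t]; rewrite ?D0 // DS stpP.
Qed.
Definition descs f := projT1 (cid (desc_ex f)).
Definition desc n f t : F := rap (ap (descs f) n) t.
Lemma descO f t : desc O f t = rap f t.
Proof. exact: proj1 (projT2 (cid (desc_ex f))) t. Qed.
Lemma descS n f t : desc (S n) f t = desc n f (ch false t) + desc n f (ch true t).
Proof. exact: proj2 (projT2 (cid (desc_ex f))) n t. Qed.

Lemma DefT_descs_ : DefT (fun h : unit * SR => descs h.2).
Proof.
apply: (@DefT_unique _ _ _ _ _ (fun (h : unit * SR) (D : El (fun_set omega (fun_set omega (reals R)))) =>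
  (forall t, rap (ap D O) t = rap h.2 t) /\
  forall n t, rap (ap D (S n)) t = rap (ap D n) (ch false t) + rap (ap D n) (ch true t))).
- by case=> c f; apply: (projT2 (cid (desc_ex f))).
- case=> c f D /= [D0 DS]; apply: ap_ext.
  suff H : forall n t, rap (ap D n) t = desc n f t.
    by move=> n; apply: (@rap_ext _ hZF _ hR) => t; rewrite H.
  have [E0 ES] := projT2 (cid (desc_ex f)); rewrite -/(descs f) in E0 ES.
  rewrite /desc; apply: N_ind => [|t|n IH t]; first by def.
    by rewrite D0 E0.
  by rewrite DS ES !IH.
- by def.
Qed.
Lemma DefT_desc_ : DefT (fun h : unit * N * SR * N => desc h.1.1.2 h.1.2 h.2).
Proof. by have d := DefT_descs_; rewrite /desc; def. Qed.

Lemma desc_le c f g n t : (forall s, rap f s <= c * rap g s) -> desc n f t <= c * desc n g t.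
Proof.
have d := DefT_desc_; move=> H; move: n t; apply: N_ind => [|t|n IH t]; first by def.
  by rewrite !descO.
by rewrite !descS mulrDr lerD.
Qed.

Lemma desc_flow mu n t : flow mu -> desc n mu t = rap mu t.
Proof.
have d := DefT_desc_; move=> [_ mS]; move: n t; apply: N_ind => [|t|n IH t]; first by def.
  by rewrite !descO.
by rewrite descS !IH mS.
Qed.

Lemma desc_add f g h n t : (forall s, rap h s = rap f s + rap g s) ->
  desc n h t = desc n f t + desc n g t.
Proof.
have d := DefT_desc_; move=> H; move: n t; apply: N_ind => [|t|n IH t]; first by def.
  by rewrite !descO.
by rewrite !descS !IH; ring.
Qed.

Lemma desc_last f g n t : (forall s, rap g s = rap f (ch false s) + rap f (ch true s)) ->
  desc (S n) f t = desc n g t.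
Proof.
have d := DefT_desc_; move=> H; move: n t; apply: N_ind => [|t|n IH t]; first by def.
  by rewrite descS !descO H.
by rewrite descS !IH -descS.
Qed.

Section Slices.
Variables (mu : SR) (k : N -> N -> F).
Hypotheses (fmu : flow mu) (sk : subpair mu k).

Let dk := subpair_def sk.

Lemma slice_ex t : exists f, forall s, rap f s = k s t.
Proof. by apply: rlam_ex; def. Qed.
Definition slice t : SR := projT1 (cid (slice_ex t)).
Lemma sliceE t s : rap (slice t) s = k s t.
Proof. exact: projT2 (cid (slice_ex t)) s. Qed.
Lemma DefT_slice_ : DefT (fun h : unit * N => slice h.2).
Proof.
apply: (DefT_rfn (hZF := hZF) (hR := hR) (t' := fun (h : unit * N) (s : N) => k s h.2)).
  by move=> h n; rewrite sliceE.
by def.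
Qed.

(** The mass of all pairs whose second node is t. *)
Definition strip t : F := desc (len t) (slice t) O.

Lemma strip_le t : strip t <= rap mu O * rap mu t.
Proof.
rewrite -(desc_flow (len t) O fmu) mulrC; apply: desc_le => s.
by rewrite sliceE mulrC; apply: subpair_le sk s t.
Qed.

Lemma strip_split t : strip t <= strip (ch false t) + strip (ch true t).
Proof.
have ds := DefT_slice_; rewrite /strip !len_ch.
have [|f0 f0P] := @rlam_ex _ hZF _ hR (fun s => k (ch false s) (ch false t) + k (ch true s) (ch false t)); first by def.
have [|f1 f1P] := @rlam_ex _ hZF _ hR (fun s => k (ch false s) (ch true t) + k (ch true s) (ch true t)); first by def.
have [|f fP] := @rlam_ex _ hZF _ hR (fun s => rap f0 s + rap f1 s); first by def.
rewrite (@desc_last _ f0) => [|s]; last by rewrite f0P !sliceE.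
rewrite (@desc_last _ f1) => [|s]; last by rewrite f1P !sliceE.
rewrite -(desc_add _ _ fP) -[X in _ <= X]mul1r; apply: desc_le => s.
rewrite mul1r fP f0P f1P sliceE; have := subpair_split sk s t; lra.
Qed.

Lemma heavy_child (c e x x0 x1 m m0 m1 : F) : 0 <= m0 -> 0 <= m1 -> 0 < m ->
  m0 + m1 = m -> c * m <= x -> x <= x0 + x1 -> x0 <= e * m0 -> x1 <= e * m1 ->
  (0 < m0 /\ c * m0 <= x0) \/ (0 < m1 /\ c * m1 <= x1).
Proof.
move=> h0 h1 hm em hx hs hx0 hx1; subst m.
move: h0; rewrite le_eqVlt => /orP[/eqP z0|p0].
  by right; move: hm hx hx0; rewrite -z0 mulr0 !add0r => *; split=> //; lra.
move: h1; rewrite le_eqVlt => /orP[/eqP z1|p1].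
  by left; move: hm hx hx1; rewrite -z1 mulr0 !addr0 => *; split=> //; lra.
have [H|H] := leP (c * m1) x1; first by right.
by left; split=> //; move: hx; rewrite mulrDr; lra.
Qed.

(** The mass of a strip is at most the sum over its two halves, so its ratio to mu stays
    at least c at one of the children. *)
Lemma heavy_branch : exists (c : F) (y : Br), 0 < c /\
  forall n, 0 < rap mu (pre y n) /\ c * rap mu (pre y n) <= strip (pre y n).
Proof.
have [m0 mS] := fmu; have kp := subpair_pos sk; have kle := subpair_le sk O O.
have mO : 0 < rap mu O by have := m0 O; nra.
have ds := DefT_slice_; have dd := DefT_desc_.
exists (k O O / rap mu O).
have [||t [mt ht]|y yP] := @branch _ hZF (fun t => is_true (0 < rap mu t) /\
    is_true (k O O / rap mu O * rap mu t <= strip t)).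
- by rewrite /strip; def.
- by rewrite /strip lenO descO sliceE divfK ?gt_eqF.
- have := heavy_child (m0 (ch false t)) (m0 (ch true t)) mt (mS t) ht (strip_split t)
    (strip_le (ch false t)) (strip_le (ch true t)).
  by case=> h; [exists false|exists true].
by exists y; split=> //; rewrite divr_gt0.
Qed.

Definition section_support y p : Prop := forall n, 0 < k (ap p n) (pre y n).

(** Along a heavy branch y the strips have mass at least c mu.  If the section at y were
    covered by a superflow of mass c / 2, then by compactness this would happen before
    some level n, and the strip of the node of y at level n would have at most the mass
    c / 2 times mu. *)
Lemma fubini : exists y, (forall n, 0 < rap mu (pre y n)) /\ ~ null mu (section_support y).
Proof.
have [c [y [c0 yP]]] := heavy_branch; exists y; split=> [n|H]; first by case: (yP n).
have [m0 mS] := fmu; have dd := DefT_desc_; have ds := DefT_slice_.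
have [|u [[u0 uS] [uO cu]]] := H (c / 2%:R); first by lra.
pose Q s := is_true (0 < k s (pre y (len s))) /\ is_true (rap u s < rap mu s).
have dQ : Def (fun h : unit * N => Q h.2) by rewrite /Q; def.
have [n nP] : exists n, ~ alive dQ n O.
  apply: contrapT => /forallNP nA; have [|z zP] := @konig _ hZF Q dQ; first by move=> n; apply: contrapT; apply: nA.
  have [|n] := cu z; last by case: (zP n) => _ h; rewrite leNgt h.
  by move=> n; have [] := zP n; rewrite len_pre.
have da := Def_alive_ hZF dQ.
have dead0 : forall j s, nr (len s) + nr j = nr n -> ~ 0 < k s (pre y (len s)) ->
    desc j (slice (pre y n)) s <= 0.
  apply: N_ind => [|s|j IH s]; first by def.
    rewrite nrO addr0 => e; have -> : len s = n.
      by apply: Nle_antisym; apply: (nr_le_inv (hR := hR)); rewrite e.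
    by move=> /negP; rewrite -leNgt descO sliceE.
  rewrite nrS => e hs; rewrite descS -[X in _ <= X]addr0; apply: lerD; apply: IH;
    rewrite ?len_ch ?nrS; try lra; rewrite preS => /(subpair_hered sk) //.
have bound : forall j s, nr (len s) + nr j = nr n -> ~ alive dQ j s ->
    desc j (slice (pre y n)) s <= rap mu (pre y n) * rap u s.
  have small s j : rap mu s <= rap u s -> desc j (slice (pre y n)) s <= rap mu (pre y n) * rap u s.
    move=> h; apply: (le_trans (y := rap mu (pre y n) * desc j mu s)).
      by apply: desc_le => i; rewrite sliceE mulrC; apply: subpair_le sk i _.
    by rewrite desc_flow // ler_wpM2l.
  have notQ s j : nr (len s) + nr j = nr n -> ~ Q s ->
      desc j (slice (pre y n)) s <= rap mu (pre y n) * rap u s.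
    move=> e /not_andP[h|/negP]; last by rewrite -leNgt; apply: small.
    by apply: le_trans (dead0 _ _ e h) _; rewrite mulr_ge0.
  apply: N_ind => [|s e|j IH s e]; first by def.
    by rewrite aliveO => nQ; apply: notQ.
  rewrite aliveS => /not_andP[nQ|/forallNP h]; first exact: notQ.
  rewrite nrS in e; have e' b : nr (len (ch b s)) + nr j = nr n by rewrite len_ch nrS; lra.
  have := IH _ (e' false) (h false); have := IH _ (e' true) (h true).
  have := uS s; have := m0 (pre y n); rewrite descS.
  move: (desc _ _ _) (desc j _ (ch true s)) => d0 d1 h1 h2 h3 h4; nra.
have := bound n O _ nP; rewrite lenO nrO add0r => /(_ erefl).
have [mn sn] := yP n; move: sn; rewrite /strip len_pre => sn B.
have := le_trans sn B; nra.
Qed.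
End Slices.
End Fubini.

(** * Logarithm, exponential and real powers *)

Section Logarithm.
Context {M : set_structure} (hZF : ZF M) (R : field_data M) (hR : is_real_field R).
Local Notation N := (El (M := M) omega).
Local Notation F := (Real hZF hR).
Local Notation SR := (El (M := M) (fun_set omega (reals R))).
Local Notation rap := (rap hZF hR).
Local Notation O := (O hZF).
Local Notation S := (S hZF).
Local Notation Nle := (Nle hZF).
Local Notation dbl := (dbl hZF).
Local Notation nr := (nr hZF hR).
Local Notation half := (half hZF hR).
Implicit Types (x y z s u : F) (n m k j : N).

Definition pow2 n : F := gpow 2%:R n.
Lemma pow2O : pow2 O = 1. Proof. exact: gpowO. Qed.
Lemma pow2S n : pow2 (S n) = 2%:R * pow2 n.
Proof. by rewrite /pow2 gpowS mulrC. Qed.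
Lemma pow2_gt0 n : 0 < pow2 n. Proof. by apply: gpow_gt0; rewrite ltr0n. Qed.
Lemma DefT_pow2_ : DefT (fun h : unit * N => pow2 h.2).
Proof. by rewrite /pow2; def. Qed.

Lemma pow2_ge n : nr n + 1 <= pow2 n.
Proof.
have d := DefT_pow2_; move: n; apply: N_ind => [||n IH]; first by def.
  by rewrite nrO pow2O add0r.
by rewrite nrS pow2S; have := nr_ge0 hZF hR n; lra.
Qed.

Lemma pow2_lt n m : Nlt n m -> pow2 n < pow2 m.
Proof.
have d := DefT_pow2_; move: m; apply: N_ind => [||m IH]; first by def.
  by move=> /NltO.
by move=> /NltS[/IH|->]; rewrite pow2S; have := pow2_gt0 m; lra.
Qed.

Lemma pow2_lt_inv n m : pow2 n < pow2 m -> Nlt n m.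
Proof.
move=> h; case: (Nlt_total hZF n m) => [//|[e|/pow2_lt]]; first by move: h; rewrite e ltxx.
by rewrite ltNge (ltW h).
Qed.

Lemma pow2_add n m : exists k, pow2 k = pow2 n * pow2 m /\ nr k = nr n + nr m.
Proof.
have d := DefT_pow2_; move: m; apply: N_ind => [||m [k [e1 e2]]]; first by def.
  by exists n; rewrite pow2O mulr1 nrO addr0.
by exists (S k); rewrite !pow2S !nrS e1 e2; split; ring.
Qed.

Lemma pow2_floor x : 1 <= x -> exists n, pow2 n <= x /\ x < pow2 (S n).
Proof.
move=> x1; have d := DefT_pow2_.
have [||m [mP mm]] := @N_wf _ hZF (fun m => is_true (x < pow2 m)); first by def.
  have [n nP] := archimedean (hZF := hZF) (hR := hR) x; exists n; apply: (lt_trans nP).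
  by apply: lt_le_trans (pow2_ge n); lra.
case: (N_case hZF m) mP mm => [->|[n ->]] mP mm; first by move: mP; rewrite pow2O; lra.
by exists n; split=> //; rewrite leNgt; apply/negP/mm/NltnS.
Qed.

(** x ^ (2 ^ j) by repeated squaring. *)
Lemma sqs_ex x : exists f : SR, rap f O = x /\ forall j, rap f (S j) = rap f j * rap f j.
Proof. by apply: (@rrec_ex _ hZF _ hR _ (fun _ y => y * y)); def. Qed.
Definition sqs x : SR := projT1 (cid (sqs_ex x)).
Definition sq x j : F := rap (sqs x) j.
Lemma sqO x : sq x O = x.
Proof. exact: proj1 (projT2 (cid (sqs_ex x))). Qed.
Lemma sqS x j : sq x (S j) = sq x j * sq x j.
Proof. exact: proj2 (projT2 (cid (sqs_ex x))) j. Qed.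
Lemma DefT_sqs_ : DefT (fun h : unit * F => sqs h.2).
Proof.
apply: (@DefT_unique _ _ _ _ _ (fun (h : unit * F) (f : SR) =>
  rap f O = h.2 /\ forall j, rap f (S j) = rap f j * rap f j)).
- by case=> c x; apply: (projT2 (cid (sqs_ex x))).
- case=> c x f /= [f0 fS]; apply: rap_ext; apply: N_ind; first by def.
    by rewrite f0 -[RHS]/(sq x O) sqO.
  by move=> n e; rewrite fS -[RHS]/(sq x _) sqS e.
- by def.
Qed.
Lemma DefT_sq_ : DefT (fun h : unit * F * N => sq h.1.2 h.2).
Proof. by have d := DefT_sqs_; rewrite /sq; def. Qed.

Lemma sqM x y j : sq (x * y) j = sq x j * sq y j.
Proof.
have d := DefT_sq_; move: j; apply: N_ind => [||j IH]; first by def.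
  by rewrite !sqO.
by rewrite !sqS IH; ring.
Qed.

Lemma sq_bernoulli x j : 1 <= x -> half j + (x - 1) <= half j * sq x j.
Proof.
have d := DefT_sq_; move=> x1; move: j; apply: N_ind => [||j IH]; first by def.
  by rewrite halfO sqO; lra.
rewrite sqS halfS; have := half_gt0 hZF hR j; set a := half j in IH *; set b := sq x j in IH *.
move=> a0; have b1 : 1 <= b by rewrite -(ler_pM2l a0) mulr1; lra.
have : a + (x - 1) <= a * b by []. nra.
Qed.

Lemma sq_ge1 x j : 1 <= x -> 1 <= sq x j.
Proof.
by move=> x1; have := sq_bernoulli j x1; have := half_gt0 hZF hR j; nra.
Qed.

(** The binary logarithm l of x >= 1 is determined by the integer parts n of
    2^j l, which satisfy 2^n <= x^(2^j) < 2^(n+1). *)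
Definition is_log x l : Prop := forall j n, pow2 n <= sq x j -> sq x j < pow2 (S n) ->
  nr n * half j <= l /\ l <= (nr n + 1) * half j.

Lemma floor_sq x j n m : pow2 n <= sq x j -> sq x j < pow2 (S n) ->
  pow2 m <= sq x (S j) -> sq x (S j) < pow2 (S m) ->
  nr n * half j <= nr m * half (S j) /\ (nr m + 1) * half (S j) <= (nr n + 1) * half j.
Proof.
move=> h1 h2 h3 h4; rewrite halfS; have p := half_gt0 hZF hR j.
have n0 := pow2_gt0 n; have n1 := pow2_gt0 (S n).
have [k [k1 k2]] := pow2_add n n; have [l [l1 l2]] := pow2_add (S n) (S n).
have : Nlt k (S m) by apply: pow2_lt_inv; apply: le_lt_trans h4; rewrite k1 sqS; nra.
move=> /(nr_lt hZF hR); rewrite nrS k2 => H1.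
have {}H1 : nr n + nr n <= nr m.
  rewrite -k2; apply: nr_le; apply: contrapT => /(proj1 (Nnot_le hZF _ _)) c.
  have : nr (S m) <= nr k by apply: nr_le; apply/Nle_lt_S.
  by rewrite nrS k2; lra.
have H2 : nr m + 1 <= nr (S n) + nr (S n).
  rewrite -l2 -nrS; apply: nr_le; apply/Nle_lt_S/pow2_lt_inv; apply: (le_lt_trans h3).
  by rewrite l1 sqS; have := sqS x j; nra.
by move: H2; rewrite nrS => H2; nra.
Qed.

Lemma log_ex x : exists l, 1 <= x -> is_log x l.
Proof.
have [x1|nx] := pselect (is_true (1 <= x)); last by exists 0 => /nx.
pose fl j n := is_true (pow2 n <= sq x j) /\ is_true (sq x j < pow2 (S n)).
have fl_ex j : exists n, fl j n by apply: pow2_floor; apply: sq_ge1.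
have dp := DefT_pow2_; have ds := DefT_sq_.
have fl_unique j n m : fl j n -> fl j m -> n = m.
  move=> [h1 h2] [h3 h4]; apply: (Nle_antisym); apply: (pow2_lt_inv).
    exact: le_lt_trans h1 h4.
  exact: le_lt_trans h3 h2.
have mono j : forall i n m, Nle i j -> fl i n -> fl j m ->
    nr n * half i <= nr m * half j /\ (nr m + 1) * half j <= (nr n + 1) * half i.
  move: j; apply: N_ind => [|i n m|j IH i n m]; first by rewrite /fl; def.
    by move=> /NleO -> fn fm; rewrite (fl_unique _ _ _ fn fm).
  move=> /NleS[ij|->] fn fm; last by rewrite (fl_unique _ _ _ fn fm).
  have [k fk] := fl_ex j; have [a1 a2] := IH _ _ _ ij fn fk.
  have [b1 b2] := floor_sq (proj1 fk) (proj2 fk) (proj1 fm) (proj2 fm).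
  by split; [apply: le_trans b1|apply: le_trans a2].
have cross i n j m : fl i n -> fl j m -> nr n * half i <= (nr m + 1) * half j.
  move=> fn fm; have hi := half_gt0 hZF hR i; have hj := half_gt0 hZF hR j.
  have [|/(proj1 (Nnot_le hZF _ _))/(Nlt_le hZF) ij] := pselect (Nle i j).
    by move=> ij; have [h _] := mono _ _ _ _ ij fn fm; lra.
  by have [_ h] := mono _ _ _ _ ij fm fn; lra.
have [|||l [l1 l2]] := @sup_ex _ hZF _ hR (fun y => exists j n, fl j n /\ y = nr n * half j).
- by rewrite /fl; def.
- by have [n fn] := fl_ex O; exists (nr n * half O), O, n.
- have [n fn] := fl_ex O; exists ((nr n + 1) * half O) => _ [j [m [fm ->]]]; exact: cross fn.
exists l => _ j n h1 h2; split; first by apply: l1; exists j, n.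
by apply: l2 => _ [i [m [fm ->]]]; apply: cross fm _.
Qed.

Lemma is_log_unique x l l' : 1 <= x -> is_log x l -> is_log x l' -> l = l'.
Proof.
move=> x1 hl hl'; have H a b : is_log x a -> is_log x b -> a - b <= 0.
  move=> ha hb; apply: (@le_half _ hZF _ hR _ 1) => j; have [n [n1 n2]] := pow2_floor (sq_ge1 j x1).
  by have [a1 a2] := ha _ _ n1 n2; have [b1 b2] := hb _ _ n1 n2; lra.
by have := H _ _ hl hl'; have := H _ _ hl' hl; lra.
Qed.

Definition log1 x : F := if `[< is_true (1 <= x) >] then projT1 (cid (log_ex x)) else 0.
Lemma log1P x : 1 <= x -> is_log x (log1 x).
Proof. by move=> x1; rewrite /log1 asboolT //; apply: (projT2 (cid (log_ex x))). Qed.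

Lemma DefT_log1_ : DefT (fun h : unit * F => log1 h.2).
Proof.
have dp := DefT_pow2_; have ds := DefT_sq_.
apply: (@DefT_unique _ _ _ _ _ (fun (h : unit * F) (l : F) =>
  (is_true (1 <= h.2) /\ is_log h.2 l) \/ (~ is_true (1 <= h.2) /\ l = 0))).
- case=> c x /=; have [x1|nx] := pselect (is_true (1 <= x)).
    by left; split=> //; apply: log1P.
  by right; rewrite /log1 asboolF.
- case=> c x l /= [[x1 hl]|[nx ->]]; last by rewrite /log1 asboolF.
  exact: is_log_unique x1 hl (log1P x1).
- by rewrite /is_log; def.
Qed.

Lemma log1M x y : 1 <= x -> 1 <= y -> log1 (x * y) = log1 x + log1 y.
Proof.
move=> x1 y1; have xy1 : 1 <= x * y by nra.
have H j : log1 (x * y) - (log1 x + log1 y) <= 3%:R * half j /\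
    (log1 x + log1 y) - log1 (x * y) <= 3%:R * half j.
  have h0 := half_gt0 hZF hR j.
  have [a [a1 a2]] := pow2_floor (sq_ge1 j x1); have [b [b1 b2]] := pow2_floor (sq_ge1 j y1).
  have [c [c1 c2]] := pow2_floor (sq_ge1 j xy1).
  have [A1 A2] := log1P x1 a1 a2; have [B1 B2] := log1P y1 b1 b2.
  have [C1 C2] := log1P xy1 c1 c2; rewrite sqM in c1 c2.
  have pa := pow2_gt0 a; have pb := pow2_gt0 b.
  have [k [k1 k2]] := pow2_add a b; have [l [l1 l2]] := pow2_add (S a) (S b).
  have : Nlt k (S c) by apply: pow2_lt_inv; apply: le_lt_trans c2; rewrite k1 ler_pM // ltW.
  move=> /(nr_lt hZF hR); rewrite nrS k2 => K.
  have : Nlt c l.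
    by apply: pow2_lt_inv; apply: (le_lt_trans c1); rewrite l1 ltr_pM // (le_trans ler01) // sq_ge1.
  move=> /(nr_lt hZF hR); rewrite l2 !nrS => L.
  by split; nra.
have := @le_half _ hZF _ hR _ 3%:R (fun j => proj1 (H j)).
by have := @le_half _ hZF _ hR _ 3%:R (fun j => proj2 (H j)); lra.
Qed.

Lemma log1_1 : log1 1 = 0.
Proof. by have := log1M (lexx 1) (lexx 1); rewrite mulr1; lra. Qed.

Lemma log1_gt0 x : 1 < x -> 0 < log1 x.
Proof.
move=> x1; have x1' := ltW x1; have [j jP] := half_small (hZF := hZF) (hR := hR) (x := x - 1) ltac:(lra).
have h0 := half_gt0 hZF hR j; have B := sq_bernoulli j x1'.
have s2 : 2%:R < sq x j by rewrite -(ltr_pM2l h0); lra.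
have [n [n1 n2]] := pow2_floor (sq_ge1 j x1'); have [L _] := log1P x1' n1 n2.
case: (N_case hZF n) n1 n2 L => [->|[m ->]] n1 n2 L.
  by move: n2; rewrite pow2S pow2O mulr1; lra.
apply: lt_le_trans L; rewrite nrS; have := nr_ge0 hZF hR m; nra.
Qed.

Definition log y : F := log1 (Num.max y 1) - log1 (Num.max y^-1 1).
Lemma DefT_log_ : DefT (fun h : unit * F => log h.2).
Proof. by have d := DefT_log1_; rewrite /log; def. Qed.

Lemma log_frac y a b : 0 < y -> 1 <= a -> 1 <= b -> y * b = a -> log y = log1 a - log1 b.
Proof.
move=> y0 a1 b1 e; rewrite /log; set A := Num.max y 1; set B := Num.max y^-1 1.
have A1 : 1 <= A by rewrite le_max lexx orbT.
have B1 : 1 <= B by rewrite le_max lexx orbT.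
have E : y * B = A.
  have [h|h] := leP 1 y.
    have h' : y^-1 <= 1 by rewrite invf_le1.
    by rewrite /A /B (max_idPl h) (max_idPr h') mulr1.
  have h' : 1 <= y^-1 by rewrite invf_ge1 // ltW.
  by rewrite /A /B (max_idPr (ltW h)) (max_idPl h') mulfV ?gt_eqF.
suff : log1 A + log1 b = log1 a + log1 B by lra.
by rewrite -!log1M // -E -e; congr log1; ring.
Qed.

Lemma frac_ex y : 0 < y -> exists a b, 1 <= a /\ 1 <= b /\ y * b = a.
Proof.
move=> y0; have [h|h] := leP 1 y; first by exists y, 1; rewrite mulr1.
exists 1, y^-1; rewrite mulfV ?gt_eqF // lexx; split=> //; split=> //.
by rewrite -invr1 lef_pV2 ?posrE ?ltr01 // ltW.
Qed.

Lemma logM x y : 0 < x -> 0 < y -> log (x * y) = log x + log y.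
Proof.
move=> x0 y0; have [a [b [a1 [b1 e]]]] := frac_ex x0; have [c [d [c1 [d1 f]]]] := frac_ex y0.
rewrite (log_frac x0 a1 b1 e) (log_frac y0 c1 d1 f).
have ac : 1 <= a * c by nra. have bd : 1 <= b * d by nra.
rewrite (log_frac (mulr_gt0 x0 y0) ac bd); last by rewrite -e -f; ring.
by rewrite !log1M //; ring.
Qed.

Lemma log1E x : 1 <= x -> log x = log1 x.
Proof.
by move=> x1; rewrite (@log_frac x x 1) ?mulr1 ?log1_1 ?subr0 //; apply: lt_le_trans x1; lra.
Qed.

Lemma log_one : log 1 = 0. Proof. by rewrite log1E ?log1_1. Qed.

Lemma log_lt x y : 0 < x -> x < y -> log x < log y.
Proof.
move=> x0 xy; have y0 := lt_trans x0 xy.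
have -> : y = x * (y / x) by rewrite mulrCA mulfV ?mulr1 // gt_eqF.
have q1 : 1 < y / x by rewrite ltr_pdivlMr // mul1r.
rewrite logM //; last by apply: lt_trans q1; lra.
by rewrite ltrDl log1E ?log1_gt0 // ltW.
Qed.

Lemma log_le x y : 0 < x -> x <= y -> log x <= log y.
Proof.
by move=> x0; rewrite le_eqVlt => /orP[/eqP -> //|h]; apply/ltW/log_lt.
Qed.

Lemma log_inj x y : 0 < x -> 0 < y -> log x = log y -> x = y.
Proof.
move=> x0 y0 e; case: (ltgtP x y) => // h; first by have := log_lt x0 h; rewrite e ltxx.
by have := log_lt y0 h; rewrite e ltxx.
Qed.

Lemma log_pow2 n : log (pow2 n) = nr n * log 2%:R.
Proof.
have d := DefT_pow2_; have dl := DefT_log_; move: n; apply: N_ind => [||n IH]; first by def.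
  by rewrite pow2O log_one nrO mul0r.
by rewrite pow2S logM ?pow2_gt0 ?ltr0n // IH nrS; ring.
Qed.

Lemma log_root j : exists u, 1 < u /\ log u <= log 2%:R * half j.
Proof.
have dl := DefT_log_; move: j; apply: N_ind => [||j [u [u1 hu]]]; first by def.
  by exists 2%:R; rewrite halfO mulr1 lexx; split=> //; lra.
pose x := Num.min 1 ((u - 1) / 3%:R).
have x0 : 0 < x by rewrite lt_min ltr01 /=; lra.
have x1 : x <= 1 by rewrite ge_min lexx.
have x2 : x <= (u - 1) / 3%:R by rewrite ge_min lexx orbT.
exists (1 + x); split; first lra.
have : log ((1 + x) * (1 + x)) <= log u by apply: log_le; nra.
by rewrite logM ?halfS; try lra.
Qed.

(** The logarithm is onto, by completeness. *)
Lemma log_onto s : exists y, 0 < y /\ log y = s.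
Proof.
have dl := DefT_log_; have c0 : 0 < log 2%:R by rewrite -log_one; apply: log_lt; lra.
have big x : exists y, 0 < y /\ x < log y.
  have [n nP] := archimedean (hZF := hZF) (hR := hR) (x / log 2%:R).
  exists (pow2 n); split; first exact: pow2_gt0.
  by rewrite log_pow2 -ltr_pdivrMr.
have logV y : 0 < y -> log y^-1 = - log y.
  move=> y0; have := logM y0 (y := y^-1); rewrite invr_gt0 => /(_ y0).
  by rewrite mulfV ?gt_eqF // log_one; lra.
have [a [a0 ha]] := big (- s); have [b [b0 hb]] := big s.
have [|||y [y1 y2]] := @sup_ex _ hZF _ hR (fun y => is_true (0 < y) /\ is_true (log y <= s)).
- by def.
- by exists a^-1; rewrite invr_gt0 logV //; split=> //; lra.
- exists b => y [y0 hy]; rewrite leNgt; apply/negP => /(log_lt b0) h; lra.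
have y0 : 0 < y.
  by apply: lt_le_trans (y1 a^-1 _); rewrite ?invr_gt0 // logV //; split=> //; lra.
exists y; split=> //; apply/eqP; rewrite eq_le; apply/andP; split; rewrite leNgt; apply/negP => h.
- have q0 : 0 < (log y - s) / log 2%:R by rewrite divr_gt0 // subr_gt0.
  have [j jP] := half_small q0.
  have [u [u1 hu]] := log_root j; have u0 : 0 < u by lra.
  have hu' : log u < log y - s.
    by apply: (le_lt_trans hu); rewrite mulrC -ltr_pdivlMr.
  have : y <= y / u.
    apply: y2 => z [z0 hz]; rewrite leNgt; apply/negP => /(log_lt (divr_gt0 y0 u0)).
    by rewrite logM ?invr_gt0 // logV //; lra.
  by rewrite ler_pdivlMr //; nra.
- have q0 : 0 < (s - log y) / log 2%:R by rewrite divr_gt0 // subr_gt0.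
  have [j jP] := half_small q0.
  have [u [u1 hu]] := log_root j; have u0 : 0 < u by lra.
  have hu' : log u < s - log y.
    by apply: (le_lt_trans hu); rewrite mulrC -ltr_pdivlMr.
  have : y * u <= y by apply: y1; rewrite mulr_gt0 // logM //; split=> //; lra.
  nra.
Qed.

Definition exp s : F := projT1 (cid (log_onto s)).
Lemma exp_gt0 s : 0 < exp s. Proof. by case: (projT2 (cid (log_onto s))). Qed.
Lemma expK s : log (exp s) = s. Proof. by case: (projT2 (cid (log_onto s))). Qed.
Lemma logK y : 0 < y -> exp (log y) = y.
Proof. by move=> y0; apply: log_inj; rewrite ?exp_gt0 ?expK. Qed.
Lemma DefT_exp_ : DefT (fun h : unit * F => exp h.2).
Proof.
have dl := DefT_log_.
apply: (@DefT_unique _ _ _ _ _ (fun (h : unit * F) (y : F) => is_true (0 < y) /\ log y = h.2)).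
- by case=> c s /=; rewrite expK exp_gt0.
- by case=> c s y /= [y0 <-]; rewrite logK.
- by def.
Qed.
Lemma expD s u : exp (s + u) = exp s * exp u.
Proof.
by apply: log_inj; rewrite ?exp_gt0 ?mulr_gt0 ?exp_gt0 // logM ?exp_gt0 // !expK.
Qed.
Lemma exp_lt s u : s < u -> exp s < exp u.
Proof.
move=> h; rewrite ltNge; apply/negP => /(log_le (exp_gt0 u)).
by rewrite !expK; lra.
Qed.
Lemma exp_le s u : s <= u -> exp s <= exp u.
Proof. by rewrite le_eqVlt => /orP[/eqP -> //|h]; apply/ltW/exp_lt. Qed.

(** x ^ s, with 0 ^ 0 = 1. *)
Definition pw x s : F :=
  if `[< x = 0 >] then (if `[< s = 0 >] then 1 else 0) else exp (s * log x).
Lemma DefT_pw_ : DefT (fun h : unit * F * F => pw h.1.2 h.2).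
Proof. by have d := DefT_exp_; have dl := DefT_log_; rewrite /pw; def. Qed.

Lemma pw_pos x s : 0 < x -> pw x s = exp (s * log x).
Proof. by move=> x0; rewrite /pw asboolF // => e; move: x0; rewrite e ltxx. Qed.
Lemma pw_gt0 x s : 0 < x -> 0 < pw x s.
Proof. by move=> x0; rewrite pw_pos // exp_gt0. Qed.
Lemma pw0 s : 0 < s -> pw 0 s = 0.
Proof. by move=> s0; rewrite /pw asboolT // asboolF // => e; move: s0; rewrite e ltxx. Qed.
Lemma pw_ge0 x s : 0 <= x -> 0 <= pw x s.
Proof.
rewrite le_eqVlt => /orP[/eqP <-|/pw_gt0 h]; last exact: ltW.
by rewrite /pw asboolT //; case: asboolP => _ //; rewrite ler01.
Qed.
Lemma pwM x y s : 0 < x -> 0 < y -> pw (x * y) s = pw x s * pw y s.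
Proof. by move=> x0 y0; rewrite !pw_pos ?mulr_gt0 // logM // mulrDr expD. Qed.
Lemma pw_le x y s : 0 <= x -> x <= y -> 0 < s -> pw x s <= pw y s.
Proof.
rewrite le_eqVlt => /orP[/eqP <-|x0] xy s0; first by rewrite pw0 // pw_ge0.
by rewrite !pw_pos //; [apply/exp_le/ler_wpM2l/log_le => //; exact: ltW|exact: lt_le_trans xy].
Qed.
Lemma pw_anti x s u : 0 < x -> x <= 1 -> s <= u -> pw x u <= pw x s.
Proof.
move=> x0 x1 su; rewrite !pw_pos //; apply: exp_le.
by have := log_le x0 x1; rewrite log_one; nra.
Qed.
Lemma pw_root (s e : F) : 0 < s -> 0 < e -> 0 < exp (log e / s) /\ pw (exp (log e / s)) s = e.
Proof.
move=> s0 e0; rewrite pw_pos ?exp_gt0 //; split=> //.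
by rewrite expK mulrCA mulfV ?mulr1 ?logK // gt_eqF.
Qed.
Lemma pw_sqrt x : 0 <= x -> exists r, 0 <= r /\ r * r = x.
Proof.
rewrite le_eqVlt => /orP[/eqP <-|x0]; first by exists 0; rewrite mulr0 lexx.
exists (exp (log x / 2%:R)); rewrite ltW ?exp_gt0 // -expD; split=> //.
have -> : log x / 2%:R + log x / 2%:R = log x by field.
by rewrite logK.
Qed.

(** The bound on [0, 1] extends to all x >= 0 because d 1 = 0, and d (2^n x) = 2^n (d x)
    then forces d x = 0. *)
Lemma additive_bounded (d : F -> F) (C : F) : (forall x y, d (x + y) = d x + d y) ->
  (forall x, 0 <= x -> x <= 1 -> `|d x| <= C) -> d 1 = 0 ->
  DefT (fun h : unit * F => d h.2) -> forall x, d x = 0.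
Proof.
move=> dD dC d1 dd.
have d0 : d 0 = 0 by have := dD 0 0; rewrite addr0; lra.
have dN x : d (- x) = - d x by have := dD x (- x); rewrite subrr d0; lra.
have B n : forall x, 0 <= x -> x <= nr n + 1 -> - C <= d x /\ d x <= C.
  move: n; apply: N_ind => [|x x0|n IH x x0]; first by def.
    by rewrite nrO add0r => x1; have := dC x x0 x1; rewrite ler_norml => /andP[].
  rewrite nrS => xn; have [x1|x1] := leP x 1.
    by have := dC x x0 x1; rewrite ler_norml => /andP[].
  have [||h1 h2] := IH (x - 1); [lra|lra|].
  by have := dD (x - 1) 1; rewrite subrK d1 addr0 => ->.
have pos x : 0 <= x -> d x = 0.
  move=> x0; have H n : exists y, 0 <= y /\ d x = d y * half n.
    move: n; apply: N_ind => [||n [y [y0 e]]]; first by def.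
      by exists x; rewrite halfO mulr1.
    by exists (y + y); rewrite dD halfS e; split; [lra|field].
  have K n : d x <= C * half n /\ - d x <= C * half n.
    have [y [y0 ->]] := H n; have h0 := half_gt0 hZF hR n.
    have [k kP] := archimedean (hZF := hZF) (hR := hR) y.
    have [|b1 b2] := B k y y0; first by lra.
    by split; nra.
  have := @le_half _ hZF _ hR (d x) C (fun n => proj1 (K n)).
  by have := @le_half _ hZF _ hR (- d x) C (fun n => proj2 (K n)); lra.
move=> x; have [h|h] := leP 0 x; first exact: pos.
by have := pos (- x); rewrite dN => H; have := H ltac:(lra); lra.
Qed.

(** The logarithm of a solution of the functional equation differs from a linear function
    by an additive one, which vanishes at 1 and is bounded on [0, 1] by monotonicity. *)
Lemma exp_unique (q : F -> F) r : DefT (fun h : unit * F => q h.2) -> 0 < r ->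
  (forall a b, q (a + b) = q a * q b) ->
  (forall a b, a <= b -> q a <= q b) \/ (forall a b, a <= b -> q b <= q a) ->
  q 1 = r -> forall s, q s = exp (s * log r).
Proof.
move=> dq r0 qD qm q1.
have q0 a : 0 < q a.
  rewrite lt_neqAle eq_sym; apply/andP; split.
    apply/eqP => z; have := qD a (1 - a); rewrite z mul0r addrCA subrr addr0 q1 => z'.
    by move: r0; rewrite z' ltxx.
  have -> : a = a / 2%:R + a / 2%:R by field.
  by rewrite qD -expr2 sqr_ge0.
pose d a := log (q a) - a * log r.
have dD x y : d (x + y) = d x + d y by rewrite /d qD logM //; ring.
have q00 : q 0 = 1.
  have := qD 0 0; rewrite addr0 => e; have := q0 0 => p.
  by apply: (mulIf (x := q 0)); rewrite ?gt_eqF // mul1r -e.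
suff H s : d s = 0.
  by move=> s; have := H s; rewrite /d => e; rewrite -[LHS]logK //; congr exp; lra.
have dl := DefT_log_.
apply: (@additive_bounded d (2%:R * `|log r|)) => //.
- move=> x x0 x1.
  have : `|log (q x)| <= `|log r|.
    case: qm => qm.
    - have := qm _ _ x0; have := qm _ _ x1; rewrite q1 q00 => h1 h2.
      have := log_le (q0 x) h1; have := log_le ltr01 h2; rewrite log_one => l1 l2.
      by rewrite !ger0_norm //; apply: le_trans l2.
    - have := qm _ _ x0; have := qm _ _ x1; rewrite q1 q00 => h1 h2.
      have := log_le r0 h1; have := log_le (q0 x) h2; rewrite log_one => l1 l2.
      by rewrite !ler0_norm ?lerN2 //; apply: le_trans l1.
  move=> H; rewrite /d; apply: (le_trans (ler_normB _ _)); rewrite normrM (ger0_norm x0).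
  have := normr_ge0 (log r); nra.
- by rewrite /d q1; ring.
- by rewrite /d; def.
Qed.

End Logarithm.

Ltac def_log :=
  match goal with
  | h : ZF _, r : is_real_field _ |- DefT (fun g => pw _ _) =>
      apply: (DefT_comp2 (DefT_pw_ h r))
  | h : ZF _, r : is_real_field _ |- DefT (fun g => log _) =>
      apply: (DefT_comp1 (DefT_log_ h r))
  | h : ZF _, r : is_real_field _ |- DefT (fun g => exp _) =>
      apply: (DefT_comp1 (DefT_exp_ h r))
  end.
Ltac def_user ::= first [def_pair | def_ap | def_nat | def_tree | def_branch | def_real | def_analysis
  | def_flows | def_log].

(** * Hausdorff dimension in terms of the typed reals *)

Section Translation.
Context {M : set_structure} (hZF : ZF M) (R : field_data M) (hR : is_real_field R).
Local Notation N := (El (M := M) omega).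
Local Notation F := (Real hZF hR).
Local Notation SR := (El (M := M) (fun_set omega (reals R))).
Local Notation ap := (ap hZF).
Local Notation rap := (rap hZF hR).
Local Notation O := (O hZF).
Local Notation S := (S hZF).
Local Notation Nle := (Nle hZF).
Local Notation nr := (nr hZF hR).
Local Notation sum := (sum hZF hR).
Local Notation psums := (psums hZF hR).
Implicit Types (a b c r s x y : F) (n k i : N) (f : SR).

Definition toF (v : M) (h : v ∈ reals R) : F := exist (fun v => v ∈ reals R) v h.
Lemma real_of (v : M) : v ∈ reals R -> exists x, v = proj1_sig x.
Proof. by move=> h; exists (toF h). Qed.

Lemma rle_in (u v : M) : rle R u v -> u ∈ reals R /\ v ∈ reals R.
Proof.
move=> /(rle_rel R hR)/(prod_setP hZF)[u' [v' [h1 [h2 /(opair_inj hZF)[-> ->]]]]] //.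
Qed.

Lemma rltP x y : rlt R (proj1_sig x) (proj1_sig y) <-> x < y.
Proof.
rewrite /rlt rleP lt_neqAle; split=> [[-> n]|/andP[/eqP n ->]].
  by rewrite andbT; apply/eqP => e; apply: n; rewrite e.
by split=> // e; apply: n; apply: El_inj.
Qed.

Lemma rsub_code x y : rsub R (proj1_sig x) (proj1_sig y) = proj1_sig (x - y).
Proof.

apply: the_unique; split.
  by split; [exact: (proj2_sig (x - y))|rewrite -(@code_add _ hZF _ hR) subrK].
move=> z [/real_of[z' ->]]; rewrite -(@code_add _ hZF _ hR) => /El_inj <-.
by rewrite addrK.
Qed.

(** The partial sums in psum are internal functions on succ n rather than on omega. *)
Definition emb (n : M) (hn : subset n omega) (e : El n) : N :=
  exist (fun v => v ∈ omega) (proj1_sig e) (hn _ (proj2_sig e)).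
Lemma DefT_emb_ (n : M) (hn : subset n omega) : DefT (fun h : unit * El n => emb hn h.2).
Proof.
apply: DefT_graph; apply: (@Def_ext _ _ _ (fun h : unit * El n * N => proj1_sig h.2 = proj1_sig h.1.2)).
  by case=> [[c e] k] /=; split=> [h|-> //]; apply: El_inj.
by def.
Qed.

Lemma N_sub n : subset (proj1_sig n) omega.
Proof. by move=> v /(mem_N hZF)[k -> _]; exact: (proj2_sig k). Qed.

Lemma psum_code (G : M -> M) f n :
  (forall k, Nlt k n -> G (proj1_sig k) = proj1_sig (rap f k)) ->
  psum R (proj1_sig n) G = proj1_sig (sum f n).
Proof.
move=> GE; have hn : subset (succ (proj1_sig n)) omega by exact: (@N_sub (S n)).
have de := DefT_emb_ hn.
have [|s sP] := @lam_ex _ hZF _ (reals R) (fun e => sum f (emb hn e)); first by def.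
have sfun := proj1 (fun_setP hZF _ _ _) (proj2_sig s).
have sE k : Nle k n -> app (proj1_sig s) (proj1_sig k) = proj1_sig (sum f k).
  move=> kn; have := sP (exist (fun v => v ∈ succ (proj1_sig n)) (proj1_sig k) kn).
  move/(congr1 (@proj1_sig _ _)); rewrite val_ap /= => ->.
  by congr (proj1_sig (sum f _)); apply: El_inj.
apply: the_unique; split.
  exists (proj1_sig s); split=> //; split; [|split].
  - by have := sE O (Nle_O hZF n); rewrite sumO code_0.
  - move=> v vn; have [k e kn] := mem_N hZF vn; rewrite e.
    have h1 : Nle k n by apply: Nlt_le.
    have h2 : Nle (S k) n by apply/Nle_lt_S.
    rewrite (sE k h1) GE // -(@code_add _ hZF _ hR) -sumS; exact: (sE (S k) h2).
  - by rewrite (sE n (Nle_refl hZF n)).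
move=> v [s' [hs' [s0 [sS ->]]]]; symmetry.
have H k : Nle k n -> opair (proj1_sig k) (proj1_sig (sum f k)) ∈ s'.
  move: k; apply: N_ind => [|_|k IH kn]; first by def.
    have -> : proj1_sig (sum f O) = app s' empty by rewrite s0 sumO code_0.
    apply: (opair_app hZF hs'); exact: (Nle_O hZF n).
  have kn' : Nlt k n by apply/(Nle_lt_S hZF).
  have -> : proj1_sig (sum f (S k)) = app s' (proj1_sig (S k)).
    rewrite [RHS]sS // (appP hZF hs' (IH (Nlt_le hZF kn'))) GE // -(@code_add _ hZF _ hR) sumS //.
  exact: (opair_app hZF hs' kn).
by rewrite (appP hZF hs' (H n (Nle_refl hZF n))).
Qed.

(** The functions in the definition of rpow are the exponential ones, by exp_unique. *)
Lemma rpow_code r s : 0 <= r -> rpow R (proj1_sig r) (proj1_sig s) = proj1_sig (pw r s).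
Proof.
have z0 x : proj1_sig x = rzero R <-> x = 0.
  by rewrite -(code_0 hZF hR); split=> [/El_inj|->].
move=> r0; apply: the_unique.
have [rz|nz] := pselect (r = 0).
  subst r; split; last first.
    rewrite /pw asboolT // => v [[_ [/z0 -> ->]]|[[_ [n ->]]|[/z0 //]]].
      by rewrite asboolT // code_1.
    by rewrite asboolF ?code_0 // => /z0.
  rewrite /pw asboolT //; case: asboolP => [->|n]; first by left; rewrite code_1 !code_0.
  by right; left; rewrite !code_0; split=> //; split=> // /z0.
have rp : 0 < r by rewrite lt_neqAle eq_sym r0 andbT; apply/eqP.
rewrite pw_pos //; split.
  right; right; split; first by move/z0.
  have [|p pP] := @lam_ex _ hZF (reals R) (reals R) (fun a : F => exp (a * log r)).
    by def.
  have pE a : app (proj1_sig p) (proj1_sig a) = proj1_sig (exp (a * log r)).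
    by rewrite -(pP a) val_ap.
  exists (proj1_sig p); split; first exact: (proj1 (fun_setP hZF _ _ _) (proj2_sig p)).
  split; [|split; [|split]].
  - move=> a b /real_of[a' ->] /real_of[b' ->].
    by rewrite -(@code_add _ hZF _ hR) !pE -(@code_mul _ hZF _ hR) -expD mulrDl.
  - have [l|l] := leP 0 (log r); [left|right] => a b h; have [ha hb] := rle_in h;
      move: h; have [a' ->] := real_of ha; have [b' ->] := real_of hb;
      rewrite !pE => /(rleP (hZF := hZF) (hR := hR)) h; apply/rleP/exp_le; nra.
  - by rewrite -(code_1 hZF hR) pE mul1r logK.
  - by rewrite pE.
move=> v [[/z0 //]|[[/z0 //]|[_ [p [hp [pD [pm [p1 ->]]]]]]]].
pose q : El (fun_set (reals R) (reals R)) := exist _ p (proj2 (fun_setP hZF _ _ p) hp).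
pose qf (a : F) : F := ap q a.
have qE a : app p (proj1_sig a) = proj1_sig (qf a) by rewrite /qf val_ap.
rewrite qE; congr proj1_sig; symmetry; apply: (@exp_unique _ hZF _ hR qf r) => //.
- by rewrite /qf; def.
- move=> a b; apply: El_inj; rewrite -qE code_add code_mul -!qE; apply: pD; [exact: (proj2_sig a)|exact: (proj2_sig b)].
- case: pm => pm; [left|right] => a b h; apply/rleP; rewrite -!qE; apply: pm; exact/rleP.
- by apply: El_inj; rewrite -qE code_1.
Qed.

Lemma ele_antisym (u v : option M) : ele R u v -> ele R v u -> u = v.
Proof.
by case: u v => [u|] [v|] //= h k; congr Some; apply: (rle_antisym R hR _ _ h k).
Qed.

Lemma esup_intro (P : option M -> Prop) v : extended R v -> (forall u, P u -> ele R u v) ->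
  (forall w, extended R w -> (forall u, P u -> ele R u w) -> ele R v w) -> esup R P = v.
Proof.
move=> h1 h2 h3; apply: the_or_unique; split=> // w [k1 [k2 k3]].
by apply: ele_antisym; [apply: h3|apply: k3].
Qed.
Lemma einf_intro (P : option M -> Prop) v : extended R v -> (forall u, P u -> ele R v u) ->
  (forall w, extended R w -> (forall u, P u -> ele R w u) -> ele R w v) -> einf R P = v.
Proof.
move=> h1 h2 h3; apply: the_or_unique; split=> // w [k1 [k2 k3]].
by apply: ele_antisym; [apply: k3|apply: h3].
Qed.
Lemma esup_Some (P : option M -> Prop) v : esup R P = Some v ->
  extended R (Some v) /\ (forall u, P u -> ele R u (Some v)) /\
  (forall w, extended R w -> (forall u, P u -> ele R u w) -> ele R (Some v) w).
Proof.
rewrite /esup; case: (the_or_cases (None (A := M)) (fun v0 => extended R v0 /\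
  (forall u, P u -> ele R u v0) /\ (forall w, extended R w -> (forall u, P u -> ele R u w) -> ele R v0 w))).
  by move=> [h _] e; rewrite e in h.
by case=> _ ->.
Qed.
Lemma einf_Some (P : option M -> Prop) v : einf R P = Some v ->
  extended R (Some v) /\ (forall u, P u -> ele R (Some v) u) /\
  (forall w, extended R w -> (forall u, P u -> ele R w u) -> ele R w (Some v)).
Proof.
rewrite /einf; case: (the_or_cases (None (A := M)) (fun v0 => extended R v0 /\
  (forall u, P u -> ele R v0 u) /\ (forall w, extended R w -> (forall u, P u -> ele R w u) -> ele R w v0))).
  by move=> [h _] e; rewrite e in h.
by case=> _ ->.
Qed.

Lemma extendedP v : extended R (Some v) <-> exists x, v = proj1_sig x /\ 0 <= x.
Proof.
split=> [[/real_of[x ->] h]|[x [-> h]]].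
  by exists x; split=> //; apply/rleP; rewrite code_0.
by split; [exact: (proj2_sig x)|rewrite -(code_0 hZF hR); apply/rleP].
Qed.

End Translation.

(** * Distances, diameters and covers *)
Section Points.
Context {M : set_structure} (hZF : ZF M) (R : field_data M) (hR : is_real_field R).
Local Notation N := (El (M := M) omega).
Local Notation F := (Real hZF hR).
Local Notation SR := (El (M := M) (fun_set omega (reals R))).
Local Notation ap := (ap hZF).
Local Notation rap := (rap hZF hR).
Local Notation O := (O hZF).
Local Notation S := (S hZF).
Local Notation Nle := (Nle hZF).
Local Notation nr := (nr hZF hR).
Local Notation sum := (sum hZF hR).
Variable d : N.
Local Notation D := (proj1_sig d).
Local Notation Pt := (El (M := M) (fun_set D (reals R))).
Implicit Types (p q : Pt) (n k i : N) (f : SR) (s r : F).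

(** The coordinates of a point, extended by 0. *)
Definition co p i : F :=
  if pselect (Nlt i d) is left h then ap p (exist (fun v => v ∈ D) (proj1_sig i) h) else 0.

Lemma co_app p i : Nlt i d -> app (proj1_sig p) (proj1_sig i) = proj1_sig (co p i).
Proof. by rewrite /co; case: pselect => // h _; rewrite val_ap. Qed.

Lemma DefT_co_ : DefT (fun h : unit * Pt * N => co h.1.2 h.2).
Proof.
apply: (@DefT_unique _ _ _ _ _ (fun (h : unit * Pt * N) (y : F) =>
  (Nlt h.2 d /\ opair (proj1_sig h.2) (proj1_sig y) ∈ proj1_sig h.1.2) \/
  (~ Nlt h.2 d /\ y = 0))).
- case=> [[c p] i] /=; have [h|h] := pselect (Nlt i d); last by right; rewrite /co; case: pselect.
  left; split=> //; rewrite -co_app //.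
  exact: (opair_app hZF (proj1 (fun_setP hZF _ _ _) (proj2_sig p)) h).
- case=> [[c p] i] y /= [[h e]|[h ->]]; last by rewrite /co; case: pselect.
  apply: El_inj; rewrite -co_app //.
  by rewrite (appP hZF (proj1 (fun_setP hZF _ _ _) (proj2_sig p)) e).
- by def.
Qed.

Lemma sqd_ex p q : exists f : SR, forall i, rap f i = (co p i - co q i) * (co p i - co q i).
Proof. by have dc := DefT_co_; apply: rlam_ex; def. Qed.
Definition sqd p q : SR := projT1 (cid (sqd_ex p q)).
Lemma sqdE p q i : rap (sqd p q) i = (co p i - co q i) * (co p i - co q i).
Proof. exact: projT2 (cid (sqd_ex p q)) i. Qed.
Lemma DefT_sqd_ : DefT (fun h : unit * Pt * Pt => sqd h.1.2 h.2).
Proof.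
have dc := DefT_co_.
apply: (DefT_rfn (hZF := hZF) (hR := hR) (t' := fun (h : unit * Pt * Pt) (i : N) =>
  (co h.1.2 i - co h.2 i) * (co h.1.2 i - co h.2 i))).
  by case=> [[c p] q] i; rewrite sqdE.
by def.
Qed.

Lemma dst_ex p q : exists r, 0 <= r /\ r * r = sum (sqd p q) d.
Proof. by apply: pw_sqrt; apply: sum_ge0 => k _; rewrite sqdE -expr2 sqr_ge0. Qed.
Definition dst p q : F := projT1 (cid (dst_ex p q)).
Lemma dst_ge0 p q : 0 <= dst p q.
Proof. by case: (projT2 (cid (dst_ex p q))). Qed.
Lemma dst2 p q : dst p q * dst p q = sum (sqd p q) d.
Proof. by case: (projT2 (cid (dst_ex p q))). Qed.
Lemma sqr_inj (a b : F) : 0 <= a -> 0 <= b -> a * a = b * b -> a = b.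
Proof. by move=> a0 b0; nra. Qed.
Lemma DefT_dst_ : DefT (fun h : unit * Pt * Pt => dst h.1.2 h.2).
Proof.
have ds := DefT_sqd_.
apply: (@DefT_unique _ _ _ _ _ (fun (h : unit * Pt * Pt) (r : F) =>
  is_true (0 <= r) /\ r * r = sum (sqd h.1.2 h.2) d)).
- by case=> [[c p] q] /=; rewrite dst2; split=> //; apply: dst_ge0.
- by case=> [[c p] q] r /= [r0 e]; apply: sqr_inj; rewrite ?dst_ge0 // dst2.
- by def.
Qed.

Lemma dist_code p q : dist R D (proj1_sig p) (proj1_sig q) = proj1_sig (dst p q).
Proof.
set G := fun i : M => rmul R (rsub R (app (proj1_sig p) i) (app (proj1_sig q) i))
                         (rsub R (app (proj1_sig p) i) (app (proj1_sig q) i)).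
have E : psum R D G = proj1_sig (sum (sqd p q) d).
  apply: psum_code => k kd; rewrite /G !co_app // (rsub_code (hZF := hZF) (hR := hR)).
  by rewrite -(@code_mul _ hZF _ hR) sqdE.
apply: the_unique; split.
  split; first exact: (proj2_sig (dst p q)).
  rewrite -(code_0 hZF hR) rleP dst_ge0; split=> //.
  by rewrite -(@code_mul _ hZF _ hR) dst2 -E.
move=> v [/(real_of hZF hR)[r ->]]; rewrite -(code_0 hZF hR) rleP -/G E -(@code_mul _ hZF _ hR).
move=> [r0 /El_inj e]; congr proj1_sig; apply: sqr_inj; rewrite ?dst_ge0 // dst2 -e //.
Qed.

Lemma co_dst p q i r : Nlt i d -> dst p q <= r -> co p i - r <= co q i /\ co q i <= co p i + r.
Proof.
move=> id_ hr; have h0 := dst_ge0 p q; have h2 := dst2 p q.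
have : (co p i - co q i) * (co p i - co q i) <= dst p q * dst p q.
  rewrite h2 -sqdE; apply: sum_ge_term => // j; by rewrite sqdE -expr2 sqr_ge0.
by split; nra.
Qed.

Lemma dst_co p q r : 0 <= r -> (forall i, Nlt i d -> co p i - r <= co q i /\ co q i <= co p i + r) ->
  dst p q <= (nr d + 1) * r.
Proof.
move=> r0 H; have h0 := dst_ge0 p q; have h2 := dst2 p q; have n0 := nr_ge0 hZF hR d.
have [|c cP] := @rlam_ex _ hZF _ hR (fun _ => r * r); first by def.
have : sum (sqd p q) d <= nr d * (r * r).
  rewrite -(sum_const (f := c)) => [|k _]; last by rewrite cP.
  by apply: sum_le => k kd; rewrite sqdE cP; have [] := H k kd; nra.
rewrite -h2 => h3; rewrite leNgt; apply/negP => h4.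
have : (nr d + 1) * r * ((nr d + 1) * r) < dst p q * dst p q by apply: ltr_pM => //; rewrite mulr_ge0 // addr_ge0.
nra.
Qed.

Local Notation Set_ := (El (M := M) (power (fun_set D (reals R)))).
Implicit Types U : Set_.
Definition inS p U : Prop := proj1_sig p ∈ proj1_sig U.
Lemma Def_inS_ : Def (fun h : unit * Pt * Set_ => inS h.1.2 h.2).
Proof. by rewrite /inS; def. Qed.
Definition bounded U r : Prop := 0 <= r /\ forall p q, inS p U -> inS q U -> dst p q <= r.
Definition is_diam U r : Prop := bounded U r /\ forall c, bounded U c -> r <= c.

Lemma Def_bounded_ : Def (fun h : unit * Set_ * F => bounded h.1.2 h.2).
Proof. by have d1 := Def_inS_; have d2 := DefT_dst_; rewrite /bounded; def. Qed.
Lemma Def_is_diam_ : Def (fun h : unit * Set_ * F => is_diam h.1.2 h.2).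
Proof. by have d1 := Def_bounded_; rewrite /is_diam; def. Qed.

Lemma is_diam_unique U r r' : is_diam U r -> is_diam U r' -> r = r'.
Proof. by move=> [b m] [b' m']; apply/eqP; rewrite eq_le m // m'. Qed.

Lemma diam_ex U c : bounded U c -> exists r, is_diam U r /\ r <= c.
Proof.
move=> bc; have d1 := Def_bounded_.
have [|||r [r1 r2]] := @inf_ex _ hZF _ hR (bounded U); first by def.
- by exists c.
- by exists 0 => x [].
exists r; split; last exact: r1.
split=> //; split; first by apply: r2 => x [].
by move=> p q pU qU; apply: r2 => x [_ H]; apply: H.
Qed.

Lemma in_space U (v : M) : v ∈ proj1_sig U -> exists p, v = proj1_sig p.
Proof.
move=> vU; have vs := proj1 (powerP hZF _ _) (proj2_sig U) _ vU.
by exists (exist (fun v => v ∈ fun_set D (reals R)) v vs).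
Qed.

Lemma diam_code U r : is_diam U r -> diam R D (proj1_sig U) = Some (proj1_sig r).
Proof.
move=> [[r0 rb] rm]; apply: (esup_intro hR).
- by apply/(extendedP hZF hR); exists r.
- move=> _ [x [y [xU [yU ->]]]]; have [p e] := in_space xU; have [q e'] := in_space yU.
  by subst x y; rewrite dist_code; apply/rleP/rb.
- move=> [w|//] /(extendedP hZF hR)[c [-> c0]] H; apply/rleP; apply: rm; split=> // p q pU qU.
  apply/rleP; rewrite -dist_code.
  by apply: (H (Some _)); exists (proj1_sig p), (proj1_sig q).
Qed.

Lemma diam_inv U v : diam R D (proj1_sig U) = Some v -> exists r, v = proj1_sig r /\ is_diam U r.
Proof.
move=> /esup_Some[/(extendedP hZF hR)[r [-> r0]] [h1 h2]]; exists r; split=> //.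
split.
  split=> // p q pU qU; apply/rleP; rewrite -dist_code.
  by apply: (h1 (Some _)); exists (proj1_sig p), (proj1_sig q).
move=> c [c0 cb]; apply/rleP; apply: (h2 (Some (proj1_sig c))).
  by apply/(extendedP hZF hR); exists c.
move=> _ [x [y [xU [yU ->]]]]; have [p e] := in_space xU; have [q e'] := in_space yU.
by subst x y; rewrite dist_code; apply/rleP/cb.
Qed.

(** A relation, as unbounded sets have no diameter. *)
Definition is_pow s U v : Prop :=
  ((forall p, ~ inS p U) /\ v = 0) \/
  ((exists p, inS p U) /\ exists r, is_diam U r /\ v = pw r s).

Lemma is_pow_unique s U v v' : is_pow s U v -> is_pow s U v' -> v = v'.
Proof.
move=> [[h ->]|[[p h] [r [hr ->]]]] [[h' ->]|[[p' h'] [r' [hr' ->]]]] //.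
- by case: (h p').
- by case: (h' p).
- by rewrite (is_diam_unique hr hr').
Qed.

Lemma is_pow_ex s U r : is_diam U r -> exists v, is_pow s U v.
Proof.
move=> hr; have [h|h] := pselect (exists p, inS p U).
  by exists (pw r s); right; split=> //; exists r.
by exists 0; left; split=> // p pU; apply: h; exists p.
Qed.

Lemma is_pow_ge0 s U v : is_pow s U v -> 0 <= v.
Proof. by move=> [[_ ->]//|[_ [r [[[r0 _] _] ->]]]]; apply: pw_ge0. Qed.

Lemma Def_is_pow_ : Def (fun h : unit * F * Set_ * F => is_pow h.1.1.2 h.1.2 h.2).
Proof. by have d1 := Def_inS_; have d2 := Def_is_diam_; rewrite /is_pow; def. Qed.

Lemma diam_pow_code s U v : is_pow s U v -> diam_pow R D (proj1_sig U) (proj1_sig s) = proj1_sig v.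
Proof.
have ne : (exists p, inS p U) -> proj1_sig U <> empty.
  by move=> [p pU] e; apply: (in_empty hZF (x := proj1_sig p)); rewrite -e.
move=> [[h ->]|[h [r [hr ->]]]].
  have e : proj1_sig U = empty.
    by apply: (empty_eq hZF) => u uU; have [p ep] := in_space uU; apply: (h p); rewrite /inS -ep.
  apply: the_unique; split; first by left; rewrite code_0.
  by move=> w [[_ ->]|[]] //; rewrite code_0.
have r0 : 0 <= r by case: hr => -[].
apply: the_unique; split.
  right; split; first exact: ne.
  by exists (proj1_sig r); rewrite (diam_code hr) rpow_code.
move=> w [[/ne //]|[_ [r' []]]]; rewrite (diam_code hr) => -[<-] ->.
by rewrite rpow_code.
Qed.

Local Notation Cov := (El (M := M) (fun_set omega (power (fun_set D (reals R))))).
Implicit Types C : Cov.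

Definition good_cover s (h e : F) (A : Pt -> Prop) C : Prop :=
  (forall i, exists r, is_diam (ap C i) r /\ r <= h) /\
  (forall p, A p -> exists i, inS p (ap C i)) /\
  exists f : SR, (forall i, is_pow s (ap C i) (rap f i)) /\ forall n, sum f n <= e.

Definition cover_null s (A : Pt -> Prop) : Prop :=
  forall h e, 0 < h -> 0 < e -> exists C, good_cover s h e A C.

Lemma Def_cover_null (A : Pt -> Prop) : Def (fun h : unit * Pt => A h.2) ->
  Def (fun h : unit * F => cover_null h.2 A).
Proof.
move=> dA; have d1 := Def_inS_; have d2 := Def_is_diam_; have d3 := Def_is_pow_.
by rewrite /cover_null /good_cover; def.
Qed.

Section Measure.
Variable A : M.
Let Ap p := proj1_sig p ∈ A.
Hypothesis A_sub : subset A (fun_set D (reals R)).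

Lemma premeasure_le s h e C : good_cover s h e Ap C -> 0 < e ->
  exists v : F, eseries R (fun i : M => diam_pow R D (app (proj1_sig C) i) (proj1_sig s)) = Some (proj1_sig v)
    /\ v <= e /\ is_cover R D (proj1_sig h) A (proj1_sig C).
Proof.
move=> [hd [hc [f [fP fe]]]] e0.
have hC := proj1 (fun_setP hZF _ _ _) (proj2_sig C).
set G := fun i : M => _; have GE n : psum R (proj1_sig n) G = proj1_sig (sum f n).
  by apply: psum_code => k _; rewrite /G -val_ap; apply: diam_pow_code.
have [|||v [v1 v2]] := @sup_ex _ hZF _ hR (fun x => exists n, x = sum f n); first by def.
- by exists (sum f O), O.
- by exists e => _ [n ->].
exists v; split; [|split].
- apply: (esup_intro hR).
  + apply/(extendedP hZF hR); exists v; split=> //.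
    by apply: v1; exists O; rewrite sumO.
  + move=> _ [m [mw ->]]; rewrite (GE (exist (fun v => v ∈ omega) m mw)).
    by apply/rleP/v1; exists (exist (fun v => v ∈ omega) m mw).
  + move=> [w|//] /(extendedP hZF hR)[c [-> c0]] H; apply/rleP; apply: v2 => _ [n ->].
    apply/rleP; rewrite -GE; apply: (H (Some _)).
    by exists (proj1_sig n); split=> //; exact: (proj2_sig n).
- by apply: v2 => _ [n ->].
- split=> //; split=> [i iw|x xA].
    have [r [hr rh]] := hd (exist (fun v => v ∈ omega) i iw).
    by have := diam_code hr; rewrite val_ap /= => ->; apply/rleP.
  have [i ip] := hc (exist (fun v => v ∈ fun_set D (reals R)) x (A_sub xA)) xA.
  exists (proj1_sig i); split; first exact: (proj2_sig i).
  by move: ip; rewrite /inS val_ap.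
Qed.

Lemma premeasure_inv s h (U : M) (e : F) : is_cover R D (proj1_sig h) A U ->
  ele R (eseries R (fun i : M => diam_pow R D (app U i) (proj1_sig s))) (Some (proj1_sig e)) ->
  exists C, good_cover s h e Ap C.
Proof.
move=> [hU [hd hc]] he.
pose C : Cov := exist (fun v => v ∈ fun_set omega (power (fun_set D (reals R)))) U
  (proj2 (fun_setP hZF _ _ U) hU).
have CE i : app U (proj1_sig i) = proj1_sig (ap C i) by rewrite val_ap.
have dC i : exists r, is_diam (ap C i) r /\ r <= h.
  have := hd (proj1_sig i) (proj2_sig i); rewrite CE.
  case E : diam => [v|//] hv; have [r [er hr]] := diam_inv E.
  by exists r; split=> //; apply/rleP; rewrite -er.
have dp := Def_is_pow_.
have pC i : exists v, is_pow s (ap C i) v by have [r [/(is_pow_ex s)]] := dC i.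
have [|f fP] := @rlam_ex _ hZF _ hR (fun i => projT1 (cid (pC i))).
  apply: (@DefT_unique _ _ _ _ _ (fun (g : unit * N) (v : F) => is_pow s (ap C g.2) v)).
  - by case=> c i /=; exact: (projT2 (cid (pC i))).
  - by case=> c i v /= hv; apply: is_pow_unique hv (projT2 (cid (pC i))).
  - by def.
have {}fP i : is_pow s (ap C i) (rap f i) by rewrite fP; exact: (projT2 (cid (pC i))).
exists C; split=> //; split.
  move=> p /hc[i [iw ip]]; exists (exist (fun v => v ∈ omega) i iw).
  by rewrite /inS -CE.
exists f; split=> // n.
move: he; set G := fun i : M => _.
have GE k : psum R (proj1_sig k) G = proj1_sig (sum f k).
  by apply: psum_code => j _; rewrite /G CE; apply: diam_pow_code.
case E : eseries => [v|//] hv; have [_ [h1 _]] := esup_Some E.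
have : ele R (Some (proj1_sig (sum f n))) (Some v).
  by apply: h1; exists (proj1_sig n); rewrite GE; split=> //; exact: (proj2_sig n).
by move=> h2; apply/rleP; apply: (rle_trans R hR) h2 hv.
Qed.

Lemma ele0 (w : option M) : extended R w -> ele R (Some (rzero R)) w.
Proof.
case: w => [w|//] /(extendedP hZF hR)[c [-> c0]].
by rewrite -(code_0 hZF hR); apply/rleP.
Qed.

Lemma eseries_extended (G : M -> M) v : eseries R G = Some v -> extended R (Some v).
Proof. by case/esup_Some. Qed.

(** The supremum over the scales vanishes iff every premeasure does, and an infimum of
    costs vanishes iff there are covers of every positive cost. *)
Lemma measure_null s : hausdorff_measure R D (proj1_sig s) A = Some (rzero R) <->
  cover_null s Ap.
Proof.
split=> [/esup_Some[_ [H _]] h e h0 e0|H].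
- have : ele R (hausdorff_premeasure R D (proj1_sig s) (proj1_sig h) A) (Some (rzero R)).
    apply: H; exists (proj1_sig h); split=> //.
    by rewrite -(code_0 hZF hR); apply/rltP.
  case E : hausdorff_premeasure => [v|//] hv.
  have [/(extendedP hZF hR)[v' [ev v0]] [_ h2]] := einf_Some E; subst v.
  apply: contrapT => /forallNP nC.
  have : ele R (Some (proj1_sig e)) (Some (proj1_sig v')).
    apply: h2; first by apply/(extendedP hZF hR); exists e; split=> //; apply: ltW.
    move=> _ [U [hU ->]]; case E' : eseries => [y|//].
    have /(extendedP hZF hR)[y' [ey y0]] := eseries_extended E'; subst y.
    apply/(rleP (hZF := hZF) (hR := hR)); rewrite leNgt; apply/negP => ye.
    have [|C hC] := @premeasure_inv s h U e hU; last exact: (nC C).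
    by rewrite E'; apply/rleP/ltW.
  move/(rleP (hZF := hZF) (hR := hR)) => h3.
  have : v' <= 0 by apply/(rleP (hZF := hZF) (hR := hR)); rewrite code_0.
  by move=> h4; have := lt_le_trans e0 (le_trans h3 h4); rewrite ltxx.
- have x0 : extended R (Some (rzero R)).
    by apply/(extendedP hZF hR); exists 0; rewrite code_0.
  have P0 (h : F) : 0 < h -> hausdorff_premeasure R D (proj1_sig s) (proj1_sig h) A = Some (rzero R).
    move=> h0; apply: einf_intro => //.
    - move=> _ [U [_ ->]]; apply: ele0.
      by case E : eseries => [y|//]; apply: eseries_extended E.
    - move=> w wx wl.
      have wb (e : F) : 0 < e -> exists v : F, v <= e /\ ele R w (Some (proj1_sig v)).
        move=> e0; have [C hC] := H h e h0 e0.
        have [v [ev [ve hv]]] := premeasure_le hC e0.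
        by exists v; split=> //; rewrite -ev; apply: wl; exists (proj1_sig C).
      case: w wx wl wb => [w|] wx wl wb; last by have [v []] := wb 1 ltr01.
      have /(extendedP hZF hR)[y [ey y0]] := wx; subst w.
      rewrite -(code_0 hZF hR); apply/(rleP (hZF := hZF) (hR := hR)).
      rewrite leNgt; apply/negP => y1.
      have y2 : 0 < y / 2 by rewrite divr_gt0.
      have [v [v1 /(rleP (hZF := hZF) (hR := hR)) v2]] := wb _ y2.
      lra.
  apply: esup_intro => //.
  + move=> _ [h [hp ->]]; have [_ /(real_of hZF hR)[h' eh]] := rle_in hZF hR (proj1 hp).
    subst h; rewrite P0; first exact: ele0.
    by apply/(rltP (hZF := hZF) (hR := hR)); rewrite code_0.
  + by move=> w wx _; apply: ele0.
Qed.

End Measure.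

Section Dimension.
Variable A : M.
Let Ap p := proj1_sig p ∈ A.
Hypothesis A_sub : subset A (fun_set D (reals R)).

(** The infimum defining the dimension need not be attained. *)
Lemma HD_inv r : ele R (HD R D A) (Some (proj1_sig r)) ->
  0 <= r /\ forall s, r < s -> exists s' : F, 0 <= s' /\ s' < s /\ cover_null s' Ap.
Proof.
case E : HD => [v|//] hv.
have [/(extendedP hZF hR)[v' [ev v0]] [_ h2]] := einf_Some E; subst v.
have {}hv : v' <= r by apply/(rleP (hZF := hZF) (hR := hR)).
split; first exact: le_trans v0 hv.
move=> s rs; apply: contrapT => nx.
have : ele R (Some (proj1_sig s)) (Some (proj1_sig v')).
  apply: h2.
    by apply/(extendedP hZF hR); exists s; split=> //; apply: ltW; apply: le_lt_trans (le_trans v0 hv) rs.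
  move=> _ [t [t0 [hm ->]]]; have [_ /(real_of hZF hR)[t' et]] := rle_in hZF hR t0; subst t.
  apply/(rleP (hZF := hZF) (hR := hR)); rewrite leNgt; apply/negP => ts.
  apply: nx; exists t'; split; last split=> //.
    by apply/(rleP (hZF := hZF) (hR := hR)); rewrite code_0.
  by apply/(measure_null A_sub).
move/(rleP (hZF := hZF) (hR := hR)) => h3.
by have := le_lt_trans (le_trans h3 hv) rs; rewrite ltxx.
Qed.

Lemma HD_intro r : 0 <= r -> (forall s, r < s -> cover_null s Ap) ->
  ele R (HD R D A) (Some (proj1_sig r)).
Proof.
move=> r0 H.
have dA : Def (fun h : unit * Pt => Ap h.2) by rewrite /Ap; def.
have dc := Def_cover_null dA.
have [|||i [i1 i2]] := @inf_ex _ hZF _ hR (fun s : F => 0 <= s /\ cover_null s Ap); first by def.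
- by exists (r + 1); split; [lra|apply: H; lra].
- by exists 0 => x [].
have ir : i <= r.
  rewrite leNgt; apply/negP => ri.
  have : i <= (r + i) / 2 by apply: i1; split; [lra|apply: H; lra].
  lra.
have -> : HD R D A = Some (proj1_sig i).
  apply: (einf_intro hR).
  - by apply/(extendedP hZF hR); exists i; split=> //; apply: i2 => x [].
  - move=> _ [s [s0 [hm ->]]]; have [_ /(real_of hZF hR)[s' es]] := rle_in hZF hR s0; subst s.
    apply/(rleP (hZF := hZF) (hR := hR)); apply: i1; split; last exact/(measure_null A_sub).
    by apply/(rleP (hZF := hZF) (hR := hR)); rewrite code_0.
  - move=> [w|] wx wl.
      have /(extendedP hZF hR)[w' [ew w0]] := wx; subst w.
      apply/(rleP (hZF := hZF) (hR := hR)); apply: i2 => x [x0 xc].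
      apply/(rleP (hZF := hZF) (hR := hR)); apply: (wl (Some _)).
      exists (proj1_sig x); split; last by split=> //; exact/(measure_null A_sub).
      by rewrite -(code_0 hZF hR); apply/rleP.
    apply: (wl (Some (proj1_sig (r + 1)))); exists (proj1_sig (r + 1)); split; last split=> //.
      by rewrite -(code_0 hZF hR); apply/rleP; lra.
    by apply/(measure_null A_sub); apply: H; lra.
exact/(rleP (hZF := hZF) (hR := hR)).
Qed.

End Dimension.
End Points.

Ltac def_points :=
  match goal with
  | h : ZF _, r : is_real_field _ |- DefT (fun g => co _ _ _ _) =>
      apply: (DefT_comp2 (DefT_co_ h r _))
  | h : ZF _, r : is_real_field _ |- Def (fun g => inS _ _) =>
      apply: (Def_comp2 (P := @inS _ _ _) (Def_inS_ h _ _))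
  end.
Ltac def_user ::= first [def_pair | def_ap | def_nat | def_tree | def_branch | def_real | def_analysis
  | def_flows | def_log | def_points].

(** * The tree of half-open boxes *)

Section Boxes.
Context {M : set_structure} (hZF : ZF M) (R : field_data M) (hR : is_real_field R).
Local Notation N := (El (M := M) omega).
Local Notation F := (Real hZF hR).
Local Notation SR := (El (M := M) (fun_set omega (reals R))).
Local Notation Br := (El (M := M) (fun_set omega omega)).
Local Notation ap := (ap hZF).
Local Notation rap := (rap hZF hR).
Local Notation O := (O hZF).
Local Notation S := (S hZF).
Local Notation Nle := (Nle hZF).
Local Notation ch := (ch hZF).
Local Notation len := (len hZF).
Local Notation pre := (pre hZF).
Local Notation path := (path hZF).
Local Notation upd := (upd hZF).
Local Notation nr := (nr hZF hR).
Local Notation half := (half hZF hR).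
Local Notation co := (co hZF hR).
Local Notation superflow := (superflow hZF hR).
Implicit Types (n k t i : N) (f g q : SR) (z : Br) (b : bool) (c r : F).

Lemma prods_ex f : exists s : SR, rap s O = 1 /\ forall n, rap s (S n) = rap s n * rap f n.
Proof. by apply: (@rrec_ex _ hZF _ hR _ (fun n (x : F) => x * rap f n)); def. Qed.
Definition prods f : SR := projT1 (cid (prods_ex f)).
Definition prod f n : F := rap (prods f) n.
Lemma prodO f : prod f O = 1.
Proof. exact: proj1 (projT2 (cid (prods_ex f))). Qed.
Lemma prodS f n : prod f (S n) = prod f n * rap f n.
Proof. exact: proj2 (projT2 (cid (prods_ex f))) n. Qed.
Lemma DefT_prods_ : DefT (fun h : unit * SR => prods h.2).
Proof.
apply: (@DefT_unique _ _ _ _ _ (fun (h : unit * SR) (s : SR) =>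
  rap s O = 1 /\ forall n, rap s (S n) = rap s n * rap h.2 n)).
- by case=> u f; apply: (projT2 (cid (prods_ex f))).
- case=> u f s /= [s0 sS]; apply: rap_ext; apply: N_ind; first by def.
    by rewrite s0 -[RHS]/(prod f O) prodO.
  by move=> n e; rewrite sS -[RHS]/(prod f _) prodS e.
- by def.
Qed.
Lemma DefT_prod_ : DefT (fun h : unit * SR * N => prod h.1.2 h.2).
Proof. by have d := DefT_prods_; rewrite /prod; def. Qed.

Lemma prod_ge0 f n : (forall k, 0 <= rap f k) -> 0 <= prod f n.
Proof.
have d := DefT_prod_; move=> H; move: n; apply: N_ind => [||n IH]; first by def.
  by rewrite prodO.
by rewrite prodS mulr_ge0.
Qed.

Lemma prod_ge1 f n : (forall k, Nlt k n -> 1 <= rap f k) -> 1 <= prod f n.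
Proof.
have d := DefT_prod_; move: n; apply: N_ind => [||n IH H]; first by def.
  by rewrite prodO.
have h1 : 1 <= prod f n by apply: IH => k kn; apply: H; apply/NltS; left.
have h2 : 1 <= rap f n by apply: H; apply: NltnS.
by rewrite prodS; nra.
Qed.

Lemma prod_le f c n : (forall k, 0 <= rap f k /\ rap f k <= c) -> prod f n <= gpow c n.
Proof.
have d := DefT_prod_; move=> H; move: n; apply: N_ind => [||n IH]; first by def.
  by rewrite prodO gpowO.
have [h1 h2] := H n; rewrite prodS gpowS; apply: ler_pM => //.
by apply: prod_ge0 => k; case: (H k).
Qed.

Lemma prod_eq f g n : (forall k, Nlt k n -> rap f k = rap g k) -> prod f n = prod g n.
Proof.
have d := DefT_prod_; move: n; apply: N_ind => [||n IH H]; first by def.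
  by rewrite !prodO.
rewrite !prodS IH => [|k kn]; last by apply: H; apply/NltS; left.
by rewrite H //; apply: NltnS.
Qed.

Lemma prod_split f g q j n : Nlt j n -> rap f j = rap g j + rap q j ->
  (forall k, k <> j -> rap g k = rap f k /\ rap q k = rap f k) ->
  prod g n + prod q n = prod f n.
Proof.
move=> jn e H; have d := DefT_prod_; move: n jn; apply: N_ind => [||n IH]; first by def.
  by move=> /NltO.
move=> /NltS[jn|<-]; rewrite !prodS.
  have [|-> ->] := H n; last by rewrite -mulrDl IH.
  by move=> e'; subst n; apply: (Nlt_irr hZF jn).
have -> : prod g j = prod f j.
  by apply: prod_eq => k kj; have [|//] := H k; move=> e'; subst k; apply: (Nlt_irr hZF kj).
have -> : prod q j = prod f j.
  by apply: prod_eq => k kj; have [|//] := H k; move=> e'; subst k; apply: (Nlt_irr hZF kj).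
by rewrite e mulrDr.
Qed.

(** The nodes 1..1 form the spine; every other node has a prefix 1..10 with k ones,
    whose box is the cube [-2^k, 2^k)^d, and from there on a step of the tree halves the
    box along one coordinate, the coordinates being used cyclically. *)
Variable d' : N.
Local Notation d := (S d').

Definition bodies : Br := projT1 (cid (@tree_rec _ hZF _ O
  (fun b _ (m : N) => if `[< m <> O >] then S O else if b then O else S O) ltac:(by case; def))).
Definition body t : Prop := ap bodies t <> O.
Lemma bodyO : ~ body O.
Proof. by rewrite /body (proj1 (projT2 (cid (@tree_rec _ _ _ _ _ _)))). Qed.
Lemma body_ch b t : body (ch b t) <-> body t \/ b = false.
Proof.
rewrite /body [ap bodies (ch b t)](proj2 (projT2 (cid (@tree_rec _ _ _ _ _ _)))).
case: asboolP => h; first by split=> [_|_]; [left|apply: S_neqO].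
by case: b; split=> //; [case|right|move=> _; apply: S_neqO].
Qed.
Lemma Def_body_ : Def (fun h : unit * N => body h.2).
Proof. by rewrite /body; def. Qed.

Definition scales : SR := projT1 (cid (@rtree_rec _ hZF _ hR 1
  (fun b t (x : F) => if `[< body t >] then x else if b then 2%:R * x else x)
  ltac:(have db := Def_body_; by case; def))).
Definition scale t : F := rap scales t.
Lemma scaleO : scale O = 1.
Proof. exact: proj1 (projT2 (cid (rtree_rec _ _))). Qed.
Lemma scale_ch b t : scale (ch b t) = if `[< body t >] then scale t else if b then 2%:R * scale t else scale t.
Proof. exact: proj2 (projT2 (cid (rtree_rec _ _))) b t. Qed.
Lemma DefT_scale_ : DefT (fun h : unit * N => scale h.2).
Proof. by rewrite /scale; def. Qed.

Definition cors : Br := projT1 (cid (@tree_rec _ hZF _ O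
  (fun b t (m : N) => if `[< body t >] then (if `[< m = d' >] then O else S m) else O)
  ltac:(have db := Def_body_; move=> b; def))).
Definition cor t : N := ap cors t.
Lemma corO : cor O = O.
Proof. exact: (proj1 (projT2 (cid (@tree_rec _ _ _ _ _ _)))). Qed.
Lemma cor_ch b t : cor (ch b t) = if `[< body t >] then (if `[< cor t = d' >] then O else S (cor t)) else O.
Proof. exact: (proj2 (projT2 (cid (@tree_rec _ _ _ _ _ _)))). Qed.
Lemma DefT_cor_ : DefT (fun h : unit * N => cor h.2).
Proof. by rewrite /cor; def. Qed.

Lemma const_ex c : exists f, forall n, rap f n = c.
Proof. by apply: rlam_ex; def. Qed.

(** Widths and lower ends are measured in units of the scale. *)
Lemma widths_ex : exists wd : El (fun_set omega (fun_set omega (reals R))),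
  (forall i, rap (ap wd O) i = 2%:R) /\
  forall b t, ap wd (ch b t) = if `[< body t >]
    then upd (ap wd t) (cor t) (rap (ap wd t) (cor t) / 2%:R : F) else ap wd t.
Proof.
have db := Def_body_; have dc := DefT_cor_; have [c cP] := const_ex 2%:R.
have [|wd [w0 wS]] := @tree_rec _ hZF _ c (fun b t (f : SR) =>
  if `[< body t >] then upd f (cor t) (rap f (cor t) / 2%:R : F) else f).
  by move=> b; def.
by exists wd; split=> [i|//]; rewrite w0 cP.
Qed.
Definition width t i : F := rap (ap (projT1 (cid widths_ex)) t) i.
Lemma widthO i : width O i = 2%:R.
Proof. exact: proj1 (projT2 (cid widths_ex)) i. Qed.
Lemma width_ch b t i : width (ch b t) i =
  if `[< body t /\ i = cor t >] then width t i / 2%:R else width t i.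
Proof.
rewrite /width (proj2 (projT2 (cid widths_ex))); case: (asboolP (body t)) => h; last first.
  by rewrite asboolF // => -[].
rewrite rupdE; case: (asboolP (i = cor t)) => e; last by rewrite asboolF // => -[].
by rewrite asboolT // e.
Qed.
Lemma DefT_width_ : DefT (fun h : unit * N * N => width h.1.2 h.2).
Proof. by rewrite /width; def. Qed.

Lemma lows_ex : exists lw : El (fun_set omega (fun_set omega (reals R))),
  (forall i, rap (ap lw O) i = - 1) /\
  forall b t, ap lw (ch b t) = if `[< body t >]
    then (if b then upd (ap lw t) (cor t) (rap (ap lw t) (cor t) + width t (cor t) / 2%:R : F)
          else ap lw t)
    else ap lw t.
Proof.
have db := Def_body_; have dc := DefT_cor_; have dw := DefT_width_.
have [c cP] := const_ex (- 1).
have [|lw [w0 wS]] := @tree_rec _ hZF _ c (fun b t (f : SR) => if `[< body t >] then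
  (if b then upd f (cor t) (rap f (cor t) + width t (cor t) / 2%:R : F) else f) else f).
  by case; def.
by exists lw; split=> [i|//]; rewrite w0 cP.
Qed.
Definition low t i : F := rap (ap (projT1 (cid lows_ex)) t) i.
Lemma lowO i : low O i = - 1.
Proof. exact: proj1 (projT2 (cid lows_ex)) i. Qed.
Lemma low_ch b t i : low (ch b t) i =
  if `[< body t /\ i = cor t >] then (if b then low t i + width t i / 2%:R else low t i) else low t i.
Proof.
rewrite /low (proj2 (projT2 (cid lows_ex))); case: (asboolP (body t)) => h; last first.
  by rewrite asboolF // => -[].
case: b; last by case: asboolP.
rewrite rupdE; case: (asboolP (i = cor t)) => e; last by rewrite asboolF // => -[].
by rewrite asboolT // e.
Qed.
Lemma DefT_low_ : DefT (fun h : unit * N * N => low h.1.2 h.2).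
Proof. by rewrite /low; def. Qed.

(** The longest edge, since the last coordinate is halved last. *)
Definition side t : F := scale t * width t d'.
Lemma DefT_side_ : DefT (fun h : unit * N => side h.2).
Proof. by have d1 := DefT_scale_; have d2 := DefT_width_; rewrite /side; def. Qed.

Lemma scale_ge1 t : 1 <= scale t.
Proof.
have ds := DefT_scale_; move: t; apply: tree_ind => [||b t IH]; first by def.
  by rewrite scaleO.
by rewrite scale_ch; case: asboolP => _ //; case: b => //; lra.
Qed.

Lemma scale_spine t : ~ body t -> nr (len t) + 1 <= scale t.
Proof.
have ds := DefT_scale_; have db := Def_body_.
move: t; apply: tree_ind => [||b t IH]; first by def.
  by rewrite lenO nrO scaleO; lra.
move=> /body_ch nb; have nbt : ~ body t by move=> h; apply: nb; left.
have bt : b by case: b nb => // nb; case: nb; right.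
rewrite scale_ch asboolF // bt len_ch nrS; have := IH nbt.
by have := nr_ge0 hZF hR (len t); lra.
Qed.

Lemma scale_le t : scale t <= gpow 2%:R (len t).
Proof.
have ds := DefT_scale_; move: t; apply: tree_ind => [||b t IH]; first by def.
  by rewrite lenO gpowO scaleO.
have := scale_ge1 t; rewrite len_ch gpowS scale_ch.
by case: asboolP => _; [|case: b]; nra.
Qed.

Lemma cor_le t : Nle (cor t) d'.
Proof.
have dc := DefT_cor_; move: t; apply: tree_ind => [||b t IH]; first by def.
  by rewrite corO; apply: Nle_O.
rewrite cor_ch; case: asboolP => _; last exact: Nle_O.
case: asboolP => e; first exact: Nle_O.
apply: (proj2 (Nle_lt_S hZF _ _)); case: (proj1 (NleP hZF _ _) IH) => // /e [].
Qed.

Lemma cor_lt t : Nlt (cor t) d.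
Proof. exact: cor_le. Qed.

Lemma width_gt0 t i : 0 < width t i.
Proof.
have dw := DefT_width_; move: t i; apply: tree_ind => [|i|b t IH i]; first by def.
  by rewrite widthO; lra.
by have := IH i; rewrite width_ch; case: asboolP => _; lra.
Qed.

Lemma side_gt0 t : 0 < side t.
Proof.
rewrite /side mulr_gt0 ?width_gt0 //; have := scale_ge1 t; lra.
Qed.

Lemma spine_shape t : ~ body t -> cor t = O /\ forall i, width t i = 2%:R.
Proof.
have dw := DefT_width_; have dc := DefT_cor_; have db := Def_body_.
move: t; apply: tree_ind => [||b t IH]; first by def.
  by rewrite corO; split=> // i; rewrite widthO.
move=> /body_ch nb; have nbt : ~ body t by move=> h; apply: nb; left.
have [c1 c2] := IH nbt; rewrite cor_ch asboolF //; split=> // i.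
by rewrite width_ch asboolF // => -[].
Qed.

(** The coordinates are halved in turn, so those before the current one are one step
    ahead. *)
Lemma width_shape t i : Nle i d' ->
  width t i = if `[< Nlt i (cor t) >] then width t d' / 2%:R else width t d'.
Proof.
have dw := DefT_width_; have dc := DefT_cor_; have db := Def_body_.
move: t i; apply: tree_ind => [|i id'|b t IH i id']; first by def.
  rewrite !widthO corO asboolF; [done|by move=> /NltO].
rewrite !width_ch cor_ch; case: (asboolP (body t)) => bt; last first.
  rewrite asboolF; last by case.
  rewrite (asboolF (P := body t /\ d' = cor t)); last by case.
  rewrite asboolF; last by move=> /NltO.
  by have [_ H] := spine_shape bt; rewrite !H.
case: (asboolP (cor t = d')) => e.
  rewrite (asboolT (P := body t /\ d' = cor t)) // (asboolF (P := Nlt i O)); last by move=> /NltO.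
  have [ei|ni] := pselect (i = d'); first by subst i; rewrite asboolT.
  rewrite asboolF; last by rewrite e; case.
  rewrite (IH i id') asboolT // e; case: (proj1 (NleP hZF _ _) id') => // /ni [].
rewrite (asboolF (P := body t /\ d' = cor t)); last by case=> _ /esym.
have [ei|ni] := pselect (i = cor t).
  subst i; rewrite asboolT // asboolT; last exact: NltnS.
  by rewrite (IH _ id') asboolF //; apply: Nlt_irr.
rewrite asboolF; last by case.
rewrite (IH i id'); case: asboolP => h1.
  by rewrite asboolT //; apply/NltS; left.
by rewrite asboolF // => /NltS[].
Qed.

Lemma width_bounds t i : Nlt i d -> width t d' / 2%:R <= width t i /\ width t i <= width t d'.
Proof.
move=> id_; have := width_gt0 t d'; rewrite (@width_shape t i); last exact: id_.
by case: asboolP => _; split; lra.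
Qed.

Lemma side_ch b t : side (ch b t) = if `[< body t >]
  then (if `[< cor t = d' >] then side t / 2%:R else side t)
  else (if b then 2%:R * side t else side t).
Proof.
rewrite /side scale_ch width_ch; case: (asboolP (body t)) => bt; last first.
  by rewrite asboolF; [case: b; rewrite ?mulrA|case].
case: (asboolP (cor t = d')) => e; last by rewrite (asboolF (P := body t /\ d' = cor t)) // => -[_ /esym].
by rewrite asboolT // mulrA.
Qed.

Lemma side_spine t : ~ body t -> side t = scale t * 2%:R.
Proof. by move=> h; rewrite /side; have [_ ->] := spine_shape h. Qed.

Lemma body_mono z n k : Nle n k -> body (pre z n) -> body (pre z k) /\ scale (pre z k) = scale (pre z n).
Proof.
have ds := DefT_scale_; have db := Def_body_.
move=> nk h; move: k nk; apply: N_ind => [||k IH]; first by def.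
  by move=> /NleO <-.
move=> /NleS[/IH[h1 h2]|<- //]; rewrite preS; split; first by apply/body_ch; left.
by rewrite scale_ch asboolT.
Qed.

Lemma scale_mono z n k : Nle n k -> scale (pre z n) <= scale (pre z k).
Proof.
have ds := DefT_scale_; move: k; apply: N_ind => [||k IH]; first by def.
  by move=> /NleO ->.
move=> /NleS[/IH h|-> //]; rewrite preS scale_ch; have := scale_ge1 (pre z k).
by case: asboolP => _ //; case: (bit _ _) => //; lra.
Qed.

Lemma side_halves z n : body (pre z n) -> exists k, Nle n k /\ side (pre z k) <= side (pre z n) / 2%:R.
Proof.
have ds := DefT_side_; have dc := DefT_cor_; have db := Def_body_.
have H : forall m n, nr (cor (pre z n)) + nr m = nr d' -> body (pre z n) ->
    exists k, Nle n k /\ side (pre z k) <= side (pre z n) / 2%:R.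
  apply: N_ind => [|k e bt|m IH k e bt]; first by def.
    exists (S k); split; first exact/Nlt_le/NltnS.
    rewrite preS side_ch asboolT // asboolT //.
    apply: (Nle_antisym (hZF := hZF)); apply: (nr_le_inv (hR := hR)); move: e; rewrite nrO; lra.
  have nd : cor (pre z k) <> d'.
    by move=> e'; move: e; rewrite e' nrS; have := nr_ge0 hZF hR m; lra.
  have [||j [kj sj]] := IH (S k).
  - by rewrite preS cor_ch asboolT // asboolF // nrS; move: e; rewrite nrS; lra.
  - by rewrite preS; apply/body_ch; left.
  exists j; split; first exact: Nle_trans (Nlt_le hZF (NltnS hZF k)) kj.
  by move: sj; rewrite preS side_ch asboolT // asboolF.
move=> bt; have [m e] : exists m, nr (cor (pre z n)) + nr m = nr d'; last exact: H e bt.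
have dn := DefT_nr_ hZF hR.
have : forall a c : N, Nle a c -> exists m, nr a + nr m = nr c.
  move=> a; apply: N_ind => [|/NleO ->|c IH /NleS[/IH[m e]|->]]; first by def.
  - by exists O; rewrite nrO addr0.
  - by exists (S m); rewrite !nrS addrA e.
  - by exists O; rewrite nrO addr0.
by apply; apply: cor_le.
Qed.

Lemma side_small z n r : body (pre z n) -> 0 < r -> exists k, Nle n k /\ side (pre z k) < r.
Proof.
move=> bt r0; have ds := DefT_side_; have dh := DefT_half_ hZF hR.
have H m : exists k, Nle n k /\ side (pre z k) <= half m * side (pre z n).
  move: m; apply: N_ind => [||m [k [nk sk]]]; first by def.
    by exists n; split; [apply: Nle_refl|rewrite halfO mul1r].
  have [j [kj sj]] := side_halves (proj1 (body_mono nk bt)).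
  exists j; split; first exact: Nle_trans nk kj.
  by rewrite halfS; lra.
have [m mP] := half_small (hZF := hZF) (hR := hR) (divr_gt0 r0 (side_gt0 (pre z n))).
have [k [nk sk]] := H m; exists k; split=> //; apply: le_lt_trans sk _.
by rewrite -ltr_pdivlMr // side_gt0.
Qed.

(** A step at most halves the side, and d steps do halve it; the boxes at the start of the
    body have side at least 2. *)
Lemma side_crossing z n0 r : body (pre z n0) -> 0 < r -> r <= 2%:R ->
  exists n, body (pre z n) /\ r <= side (pre z n) /\ side (pre z n) < 2%:R * r.
Proof.
move=> bt r0 r2; have ds := DefT_side_; have db := Def_body_.
have [||n [[n1 n2] nm]] := @N_wf _ hZF (fun n => body (pre z n) /\ is_true (side (pre z n) < r)).
- by def.
- have [k [nk sk]] := side_small bt r0; exists k; split=> //.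
  exact: (proj1 (body_mono nk bt)).
case: (N_case hZF n) => [e|[m e]]; subst n; first by case: bodyO; rewrite -(preO hZF z).
have [bm|nb] := pselect (body (pre z m)); last first.
  move: n2; rewrite preS side_ch asboolF // side_spine //.
  by have := scale_ge1 (pre z m); case: (bit _ _); lra.
exists m; split=> //.
have h : r <= side (pre z m).
  by rewrite leNgt; apply/negP => h; apply: (nm m (NltnS hZF m)).
split=> //; move: n2; rewrite preS side_ch asboolT //.
by case: asboolP => _; lra.
Qed.

End Boxes.

Ltac def_boxes :=
  match goal with
  | h : ZF _ |- Def (fun g => body _ _) => apply: (Def_comp1 (Def_body_ h))
  | h : ZF _ |- DefT (fun g => cor _ _ _) => apply: (DefT_comp1 (DefT_cor_ h _))
  | h : ZF _, r : is_real_field _ |- DefT (fun g => prod _ _ _ _) =>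
      apply: (DefT_comp2 (DefT_prod_ h r))
  | h : ZF _, r : is_real_field _ |- DefT (fun g => scale _ _ _) =>
      apply: (DefT_comp1 (DefT_scale_ h r))
  | h : ZF _, r : is_real_field _ |- DefT (fun g => width _ _ _ _ _) =>
      apply: (DefT_comp2 (DefT_width_ h r _))
  | h : ZF _, r : is_real_field _ |- DefT (fun g => low _ _ _ _ _) =>
      apply: (DefT_comp2 (DefT_low_ h r _))
  | h : ZF _, r : is_real_field _ |- DefT (fun g => side _ _ _ _) =>
      apply: (DefT_comp1 (DefT_side_ h r _))
  end.
Ltac def_user ::= first [def_pair | def_ap | def_nat | def_tree | def_branch | def_real | def_analysis
  | def_flows | def_log | def_points | def_boxes].

Section Coding.
Context {M : set_structure} (hZF : ZF M) (R : field_data M) (hR : is_real_field R).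
Local Notation N := (El (M := M) omega).
Local Notation F := (Real hZF hR).
Local Notation SR := (El (M := M) (fun_set omega (reals R))).
Local Notation Br := (El (M := M) (fun_set omega omega)).
Local Notation ap := (ap hZF).
Local Notation rap := (rap hZF hR).
Local Notation O := (O hZF).
Local Notation S := (S hZF).
Local Notation Nle := (Nle hZF).
Local Notation ch := (ch hZF).
Local Notation len := (len hZF).
Local Notation pre := (pre hZF).
Local Notation path := (path hZF).
Local Notation nr := (nr hZF hR).
Local Notation co := (co hZF hR).
Local Notation dst := (dst hZF hR).
Local Notation prod := (prod hZF hR).
Local Notation superflow := (superflow hZF hR).
Local Notation body := (body hZF).
Local Notation scale := (scale hZF hR).
Variable d' : N.
Local Notation d := (S d').
Local Notation cor := (cor hZF d').
Local Notation width := (width hZF hR d').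
Local Notation low := (low hZF hR d').
Local Notation side := (side hZF hR d').
Local Notation Pt := (El (M := M) (fun_set (proj1_sig d) (reals R))).
Implicit Types (n k t i : N) (f g q : SR) (z p : Br) (b : bool) (c r : F) (x y : Pt).

Definition within t i (a : F) : Prop :=
  is_true (scale t * low t i <= a) /\ is_true (a < scale t * (low t i + width t i)).
Lemma Def_within_ : Def (fun h : unit * N * N * F => within h.1.1.2 h.1.2 h.2).
Proof. by rewrite /within; def. Qed.

Lemma within_ch b t i a : ~ (body t /\ i = cor t) -> body t -> within (ch b t) i a <-> within t i a.
Proof.
by move=> h bt; rewrite /within scale_ch asboolT // low_ch width_ch asboolF.
Qed.

Lemma within_split t a : body t ->
  (within t (cor t) a <-> within (ch false t) (cor t) a \/ within (ch true t) (cor t) a) /\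
  ~ (within (ch false t) (cor t) a /\ within (ch true t) (cor t) a).
Proof.
move=> bt; rewrite /within !scale_ch !low_ch !width_ch !asboolT //.
have h1 := width_gt0 hZF hR d' t (cor t); have h2 := scale_ge1 hZF hR t.
set s := scale t in h2 *; set l := low t _; set w := width t _ in h1 *.
have h3 : 0 < s * w by rewrite mulr_gt0 //; lra.
have -> : s * (l + w / 2%:R) = s * l + s * w / 2%:R by field.
have -> : s * (l + w / 2%:R + w / 2%:R) = s * l + s * w by field.
have -> : s * (l + w) = s * l + s * w by ring.
split; last by case=> -[k1 k2] [k3 k4]; lra.
split=> [[k1 k2]|[[k1 k2]|[k1 k2]]]; [|split; lra..].
by have [k3|k3] := leP (s * l + s * w / 2%:R) a; [right|left]; split; lra.
Qed.

Lemma side_width t i : Nlt i d -> side t / 2%:R <= scale t * width t i /\ scale t * width t i <= side t.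
Proof.
move=> id_; have [h1 h2] := width_bounds hR t id_; have h3 := scale_ge1 hZF hR t.
have h4 := width_gt0 hZF hR d' t d'; rewrite /side; nra.
Qed.

Definition in_box x t : Prop := forall i, Nlt i d -> within t i (co x i).
Lemma Def_in_box_ : Def (fun h : unit * Pt * N => in_box h.1.2 h.2).
Proof. by have h := Def_within_; rewrite /in_box; def. Qed.

Lemma box_dst x y t : in_box x t -> in_box y t -> dst x y <= (nr d + 1) * side t.
Proof.
move=> hx hy; apply: dst_co => [|i id_]; first exact/ltW/side_gt0.
have [h1 h2] := hx i id_; have [h3 h4] := hy i id_; have [_ h5] := side_width t id_.
move: h2 h4; rewrite mulrDr; set w := scale t * width t i in h5 *.
by move: h1 h3; set l := scale t * low t i; split; lra.
Qed.

(** Spine nodes have no box of their own, and a path that stays on the spine codes nothing. *)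
Definition codes x p : Prop :=
  (exists n, body (ap p n)) /\ forall n, body (ap p n) -> in_box x (ap p n).
Lemma Def_codes_ : Def (fun h : unit * Pt * Br => codes h.1.2 h.2).
Proof. by have h := Def_in_box_; rewrite /codes; def. Qed.

Lemma coord_bound x : exists c, 1 <= c /\ forall i, Nlt i d -> - c <= co x i /\ co x i < c.
Proof.
have H : forall n, exists c : F, 1 <= c /\ forall i, Nlt i n -> - c <= co x i /\ co x i < c.
  apply: N_ind => [||n [c [c1 cP]]]; first by def.
    by exists 1; split=> // i /NltO.
  exists (Num.max c (Num.max (- co x n) (co x n + 1))); split; first by rewrite le_max c1.
  move=> i /NltS[/cP[h1 h2]|->].
    split; last by rewrite lt_max h2.
    by apply: le_trans h1; rewrite lerN2 le_max lexx.
  split; first by rewrite lerNl !le_max lexx orbT.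
  by rewrite !lt_max ltrDl ltr01 !orbT.
exact: H.
Qed.

Lemma spine_low t i : ~ body t -> low t i = -1.
Proof.
move: t; apply: tree_ind => [||b t IH]; first by def.
  by rewrite lowO.
move=> /body_ch nb; have nbt : ~ body t by move=> h; apply: nb; left.
by rewrite low_ch asboolF ?IH // => -[].
Qed.

(** The path follows the spine until the cube contains x, and bisects from there. *)
Lemma coded x : exists z, codes x (path z).
Proof.
have [c [c1 cP]] := coord_bound x.
have db := Def_in_box_; have dw := Def_within_.
have [||t [[nb sc]|[bt bx]]|z zP] := @branch _ hZF (fun t => (~ body t /\ is_true (scale t <= 2%:R * c))
    \/ (body t /\ in_box x t)); first by def.
- by left; rewrite scaleO; split; [apply: bodyO|lra].
- have [h|h] := leP (scale t) c.
    exists true; left; split; first by move/body_ch => -[].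
    by rewrite scale_ch asboolF //; lra.
  exists false; right; split; first by apply/body_ch; right.
  move=> i id_; have [h1 h2] := cP i id_; rewrite /within scale_ch asboolF //.
  rewrite low_ch width_ch asboolF; last by case.
  by rewrite spine_low //; have [_ ->] := spine_shape hR d' nb; split; lra.
- have id_ := cor_lt hZF d' t; have [h _] := within_split (co x (cor t)) bt.
  have [b hb] : exists b, within (ch b t) (cor t) (co x (cor t)).
    by have [k|k] := proj1 h (bx _ id_); [exists false|exists true].
  exists b; right; split; first by apply/body_ch; left.
  move=> i hi; have [e|ne] := pselect (i = cor t); first by subst i.
  by apply/within_ch => //; [case|apply: bx].
exists z; split=> [|n bn]; last by have [[]|[]] := zP n.
apply: contrapT => /forallNP nb; have [n nP] := archimedean (hZF := hZF) (hR := hR) (2%:R * c).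
have [[_ h]|[/nb //]] := zP n.
by have := scale_spine hR (nb n); rewrite len_pre; lra.
Qed.

Definition ind (P : Prop) : F := if `[< P >] then 1 else 0.
Lemma ends_ex f g t : exists q, forall i, rap q i = ind (within t i (rap f i)) + ind (within t i (rap g i)).
Proof. by have h := Def_within_; apply: rlam_ex; rewrite /ind; def. Qed.
Definition ends f g t : SR := projT1 (cid (ends_ex f g t)).
Lemma endsE f g t i : rap (ends f g t) i = ind (within t i (rap f i)) + ind (within t i (rap g i)).
Proof. exact: projT2 (cid (ends_ex f g t)) i. Qed.
Lemma DefT_ends_ : DefT (fun h : unit * SR * SR * N => ends h.1.1.2 h.1.2 h.2).
Proof.
have d1 := Def_within_.
apply: (DefT_rfn (hZF := hZF) (hR := hR) (t' := fun (h : unit * SR * SR * N) (i : N) =>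
  ind (within h.2 i (rap h.1.1.2 i)) + ind (within h.2 i (rap h.1.2 i)))).
  by case=> [[[c f] g] t] i; rewrite endsE.
by rewrite /ind; def.
Qed.

Lemma ind_bounds P : 0 <= ind P /\ ind P <= 1.
Proof. by rewrite /ind; case: asboolP => _; rewrite ?ler01 ?lexx. Qed.
Lemma ind_split t a : body t -> ind (within t (cor t) a) =
  ind (within (ch false t) (cor t) a) + ind (within (ch true t) (cor t) a).
Proof.
move=> bt; have [h1 h2] := within_split a bt; rewrite /ind.
case: (asboolP (within t (cor t) a)) => [/h1 h|h].
  case: asboolP => k; case: asboolP => k'; rewrite ?add0r ?addr0 //; first by case: h2.
  by case: h.
by rewrite !asboolF ?addr0 // => k; apply: h; apply/h1; [right|left].
Qed.

Lemma ends_bounds f g t i : 0 <= rap (ends f g t) i /\ rap (ends f g t) i <= 2%:R.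
Proof.
rewrite endsE; have [h1 h2] := ind_bounds (within t i (rap f i)).
by have [h3 h4] := ind_bounds (within t i (rap g i)); split; lra.
Qed.

(** The counting measure on the corners of the cube with the opposite corners f and g,
    with multiplicity: the number of corners in a box is a product over the coordinates,
    hence additive when the box is split.  A box that meets the cube and is at least as
    long contains a corner.  The division by the scale makes the masses of the
    2^d corners, counted in all the cubes along the spine, summable. *)
Definition hull f g c t : F :=
  if `[< body t >] then c * prod (ends f g t) d / scale t
  else c * (gpow 2%:R d * 2%:R) / scale t.
Lemma hull_root f g c : hull f g c O = c * (gpow 2%:R d * 2%:R).
Proof. by rewrite /hull asboolF ?scaleO ?divr1 //; apply: bodyO. Qed.

Lemma hull_ge0 f g c t : 0 <= c -> 0 <= hull f g c t.
Proof.
move=> c0; have s0 : 0 <= (scale t)^-1 by rewrite invr_ge0; have := scale_ge1 hZF hR t; lra.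
have g0 : 0 < gpow 2%:R d :> F by apply: gpow_gt0; lra.
rewrite /hull; case: asboolP => _; rewrite mulr_ge0 // mulr_ge0 //.
  by apply: prod_ge0 => i; case: (ends_bounds f g t i).
by rewrite mulr_ge0 //; lra.
Qed.

Lemma hull_split f g c t : 0 <= c -> hull f g c (ch false t) + hull f g c (ch true t) <= hull f g c t.
Proof.
move=> c0; have s1 := scale_ge1 hZF hR t.
have [bt|nb] := pselect (body t).
  have hb b : hull f g c (ch b t) = c * prod (ends f g (ch b t)) d / scale t.
    rewrite /hull asboolT; last by apply/body_ch; left.
    by rewrite scale_ch asboolT.
  rewrite !hb {hb}/hull asboolT // -mulrDl -mulrDr.
  rewrite (@prod_split _ hZF _ hR (ends f g t) _ _ (cor t)) //; first exact: cor_lt.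
    by rewrite !endsE !ind_split //; ring.
  move=> k ne; have e b : rap (ends f g (ch b t)) k = rap (ends f g t) k.
    have h a : ind (within (ch b t) k a) = ind (within t k a).
      rewrite /ind; congr (if _ then _ else _); apply: asbool_equiv_eq.
      by apply: within_ch => // -[].
    by rewrite !endsE !h.
  by split; apply: e.
rewrite /hull asboolT; last by apply/body_ch; right.
rewrite (asboolF (P := body (ch true t))); last by move=> /body_ch[].
rewrite asboolF // !scale_ch !asboolF //.
have : prod (ends f g (ch false t)) d <= gpow 2%:R d by apply: prod_le; apply: ends_bounds.
set P := prod _ _; set G := gpow _ _ => h.
have -> : c * (G * 2%:R) / (2%:R * scale t) = c * G / scale t by field; lra.
rewrite -mulrDl ler_pM2r ?invr_gt0 //; last by lra.
nra.
Qed.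

Lemma hull_hit f g c t x : 0 <= c -> body t -> in_box x t ->
  (forall i, Nlt i d -> rap f i <= co x i /\ co x i <= rap g i /\ rap g i - rap f i <= side t / 2%:R) ->
  c / scale t <= hull f g c t.
Proof.
move=> c0 bt xt H; have s1 := scale_ge1 hZF hR t.
rewrite /hull asboolT // ler_pM2r ?invr_gt0 //; last by lra.
rewrite ler_peMr //; apply: prod_ge1 => i id_.
have [h1 [h2 h3]] := H i id_; have [k1 k2] := xt i id_; have [k3 _] := side_width t id_.
rewrite endsE; have [b1 b2] := ind_bounds (within t i (rap f i)).
have [b3 b4] := ind_bounds (within t i (rap g i)).
move: k2; rewrite mulrDr => k2.
have [h4|h4] := leP (scale t * low t i) (rap f i).
  have : ind (within t i (rap f i)) = 1 by rewrite /ind asboolT //; split=> //; rewrite mulrDr; lra.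
  lra.
have : ind (within t i (rap g i)) = 1 by rewrite /ind asboolT //; split; rewrite ?mulrDr; lra.
lra.
Qed.

End Coding.

Ltac def_codes :=
  match goal with
  | h : ZF _, r : is_real_field _ |- Def (fun g => within _ _ _ _ _ _) =>
      apply: (Def_comp3 (P := @within _ h _ r _) (Def_within_ h r _))
  | h : ZF _, r : is_real_field _ |- Def (fun g => in_box _ _) =>
      apply: (Def_comp2 (P := @in_box _ h _ r _) (Def_in_box_ h r _))
  | h : ZF _, r : is_real_field _ |- Def (fun g => codes _ _) =>
      apply: (Def_comp2 (P := @codes _ h _ r _) (Def_codes_ h r _))
  end.
Ltac def_user ::= first [def_pair | def_ap | def_nat | def_tree | def_branch | def_real | def_analysis
  | def_flows | def_log | def_points | def_boxes | def_codes].

(** * Sums of flows *)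

Section FlowSums.
Context {M : set_structure} (hZF : ZF M) (R : field_data M) (hR : is_real_field R).
Local Notation N := (El (M := M) omega).
Local Notation F := (Real hZF hR).
Local Notation SR := (El (M := M) (fun_set omega (reals R))).
Local Notation Br := (El (M := M) (fun_set omega omega)).
Local Notation ap := (ap hZF).
Local Notation rap := (rap hZF hR).
Local Notation O := (O hZF).
Local Notation S := (S hZF).
Local Notation Nle := (Nle hZF).
Local Notation ch := (ch hZF).
Local Notation dbl := (dbl hZF).
Local Notation pre := (pre hZF).
Local Notation sum := (sum hZF hR).
Local Notation superflow := (superflow hZF hR).
Implicit Types (n k t i : N) (f g u v : SR) (z : Br) (b : bool) (c r : F).

Lemma superflow_root u t : superflow u -> rap u t <= rap u O.
Proof.
move=> [u0 uS]; move: t; apply: tree_ind => [||b t IH]; [by def|by []|].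
apply: le_trans IH; have := uS t; have := u0 (ch false t); have := u0 (ch true t).
by case: b; lra.
Qed.

Section Antichain.
Variables (u : SR) (H : N -> Prop).
Hypothesis su : superflow u.
Hypothesis dH : Def (fun h : unit * N => H h.2).

Definition belows : Br := projT1 (cid (@tree_rec _ hZF _ O
  (fun b t (m : N) => if `[< m <> O \/ H t >] then S O else O) ltac:(by case; def))).
Definition below t : Prop := ap belows t <> O.
Lemma belowO : ~ below O.
Proof. by rewrite /below (proj1 (projT2 (cid (@tree_rec _ _ _ _ _ _)))). Qed.
Lemma below_ch b t : below (ch b t) <-> below t \/ H t.
Proof.
rewrite /below [ap belows (ch b t)](proj2 (projT2 (cid (@tree_rec _ _ _ _ _ _)))).
exact: if_neqO.
Qed.
Lemma Def_below_ : Def (fun h : unit * N => below h.2).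
Proof. by rewrite /below; def. Qed.

Definition first t : Prop := ~ below t /\ H t.
Lemma Def_first_ : Def (fun h : unit * N => first h.2).
Proof. by have db := Def_below_; rewrite /first; def. Qed.

Lemma first_on_branch z n : H (pre z n) -> exists k, first (pre z k).
Proof.
move=> hn; have db := Def_below_.
have [||k [hk mk]] := @N_wf _ hZF (fun n => H (pre z n)); [by def|by exists n|].
exists k; split=> //; have B : forall j, below (pre z j) -> exists i, Nlt i j /\ H (pre z i).
  apply: N_ind => [||j IH]; [by def|by rewrite preO => /belowO|].
  rewrite preS => /below_ch[/IH[i [ij hi]]|h]; last by exists j; split=> //; apply: NltnS.
  by exists i; split=> //; apply/NltS; left.
by move=> /B[i [ik hi]]; apply: (mk i).
Qed.

(** The mass u of the minimal nodes of a set adds up to at most the mass of the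
    root.  The sum runs along the breadth-first enumeration: once the nodes below n
    have been visited, the nodes n, .., 2n are the frontier, and replacing a node of the
    frontier by its children does not increase the mass. *)
Lemma antichain_sum f n : (forall t, first t -> rap f t <= rap u t) ->
  (forall t, ~ first t -> rap f t <= 0) -> sum f n <= rap u O.
Proof.
move=> f1 f2; have [u0 uS] := su; have db := Def_below_.
have [|v vP] := @rlam_ex _ hZF _ hR (fun t => if `[< below t >] then 0 else rap u t); first by def.
have v0 t : 0 <= rap v t by rewrite vP; case: asboolP => _.
have stp t : rap f t + (rap v (ch false t) + rap v (ch true t)) <= rap v t.
  rewrite !vP; have e b : `[< below (ch b t) >] = `[< below t \/ H t >].
    by apply: asbool_equiv_eq; apply: below_ch.
  rewrite !e; case: (asboolP (below t)) => bt.
    rewrite asboolT; last by left.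
    by rewrite !addr0; apply: f2 => -[].
  have [ht|nh] := pselect (H t).
    rewrite asboolT; last by right.
    by rewrite !addr0; apply: f1.
  rewrite asboolF; last by case.
  have h1 : rap f t <= 0 by apply: f2 => -[].
  by have := uS t; lra.
have K : sum f n + (sum v (S (dbl n)) - sum v n) <= rap u O.
  move: n; apply: N_ind => [||n IH]; first by def.
    by rewrite dblO sumS !sumO vP asboolF; [lra|apply: belowO].
  rewrite dblS !sumS; have := stp n; rewrite -[rap v (S (dbl n))]/(rap v (ch false n)).
  by rewrite -[rap v (S (S (dbl n)))]/(rap v (ch true n)); move: IH; rewrite sumS; lra.
by have := sum_dbl n v0; lra.
Qed.

End Antichain.

(** The supremum of the partial sums. *)
Lemma superflow_series (g : N -> N -> F) c : DefT (fun h : unit * N * N => g h.1.2 h.2) ->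
  (forall i t, 0 <= g i t) -> (forall i t, g i (ch false t) + g i (ch true t) <= g i t) ->
  (forall f n, (forall i, rap f i = g i O) -> sum f n <= c) ->
  exists u, superflow u /\ rap u O <= c /\ forall i t, g i t <= rap u t.
Proof.
move=> dg g0 gS gc.
have rowx t : exists f, forall i, rap f i = g i t by apply: rlam_ex; def.
pose row t : SR := projT1 (cid (rowx t)).
have rowE t i : rap (row t) i = g i t := projT2 (cid (rowx t)) i.
have drow : DefT (fun h : unit * N => row h.2).
  apply: (DefT_rfn (hZF := hZF) (hR := hR) (t' := fun (h : unit * N) (i : N) => g i h.2)).
    by case=> a t i; rewrite rowE.
  by def.
have row0 t n : 0 <= sum (row t) n by apply: sum_ge0 => k _; rewrite rowE.
have rowS t n : sum (row (ch false t)) n + sum (row (ch true t)) n <= sum (row t) n.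
  have [|f fP] := @rlam_ex _ hZF _ hR (fun i => g i (ch false t) + g i (ch true t)); first by def.
  rewrite -(@sum_add _ hZF _ hR _ _ f) => [|k]; last by rewrite fP !rowE.
  by apply: sum_le => k _; rewrite fP rowE.
have rowc t n : sum (row t) n <= c.
  move: t; apply: tree_ind => [||b t IH]; first by def.
    by apply: gc => i; rewrite rowE.
  apply: le_trans IH; have := rowS t n; have := row0 (ch false t) n; have := row0 (ch true t) n.
  by case: b; lra.
pose is_sup t (x : F) := (forall n, is_true (sum (row t) n <= x)) /\
  forall y : F, (forall n, is_true (sum (row t) n <= y)) -> is_true (x <= y).
have supx t : exists x, is_sup t x.
  have [|||x [x1 x2]] := @sup_ex _ hZF _ hR (fun x => exists n, x = sum (row t) n); first by def.
  - by exists (sum (row t) O), O.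
  - by exists c => _ [n ->].
  exists x; split=> [n|y yP]; first by apply: x1; exists n.
  by apply: x2 => _ [n ->].
have [|u uP] := @rlam_ex _ hZF _ hR (fun t => projT1 (cid (supx t))).
  apply: (@DefT_unique _ _ _ _ _ (fun (h : unit * N) (x : F) => is_sup h.2 x)).
  - by case=> a t; exact: (projT2 (cid (supx t))).
  - case=> a t x /= [x1 x2]; have [y1 y2] := projT2 (cid (supx t)).
    by apply/eqP; rewrite eq_le x2 //= y2.
  - by rewrite /is_sup; def.
have {}uP t : is_sup t (rap u t) by rewrite uP; exact: (projT2 (cid (supx t))).
exists u; split; [split=> t|split=> [|i t]].
- by have [h _] := uP t; apply: le_trans (h O); rewrite sumO.
- have [h _] := uP t; have [_ h0] := uP (ch false t); have [_ h1] := uP (ch true t).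
  rewrite -lerBrDr; apply: h0 => n; rewrite lerBrDr addrC -lerBrDr; apply: h1 => m.
  rewrite lerBrDr.
  have [k [nk mk]] : exists k, Nle n k /\ Nle m k.
    case: (Nlt_total hZF n m) => [l|[->|l]].
    - by exists m; split; [apply: Nlt_le|apply: Nle_refl].
    - by exists m; split; apply: Nle_refl.
    - by exists n; split; [apply: Nle_refl|apply: Nlt_le].
  apply: le_trans (h k); apply: le_trans (rowS t k); rewrite addrC; apply: lerD.
    by apply: sum_mono nk => j; rewrite rowE.
  by apply: sum_mono mk => j; rewrite rowE.
- by have [_ h] := uP O; apply: h => n; apply: rowc.
- have [h _] := uP t; apply: le_trans (h (S i)); rewrite sumS rowE lerDr //.
Qed.

End FlowSums.

Ltac def_measure :=
  match goal with
  | h : ZF _, r : is_real_field _ |- Def (fun g => is_diam _ _) =>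
      apply: (Def_comp2 (P := @is_diam _ h _ r _) (Def_is_diam_ h r _))
  | h : ZF _, r : is_real_field _ |- Def (fun g => is_pow _ _ _) =>
      apply: (Def_comp3 (P := @is_pow _ h _ r _) (Def_is_pow_ h r _))
  | h : ZF _, r : is_real_field _ |- DefT (fun g => ends _ _ _ _ _ _) =>
      apply: (DefT_comp3 (DefT_ends_ h r _))
  end.
Ltac def_user ::= first [def_pair | def_ap | def_nat | def_tree | def_branch | def_real | def_analysis
  | def_flows | def_log | def_points | def_boxes | def_codes | def_measure].

(** * Covers and superflows *)

Section Transfer.
Context {M : set_structure} (hZF : ZF M) (R : field_data M) (hR : is_real_field R).
Local Notation N := (El (M := M) omega).
Local Notation F := (Real hZF hR).
Local Notation SR := (El (M := M) (fun_set omega (reals R))).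
Local Notation Br := (El (M := M) (fun_set omega omega)).
Local Notation ap := (ap hZF).
Local Notation rap := (rap hZF hR).
Local Notation O := (O hZF).
Local Notation S := (S hZF).
Local Notation Nle := (Nle hZF).
Local Notation ch := (ch hZF).
Local Notation len := (len hZF).
Local Notation pre := (pre hZF).
Local Notation path := (path hZF).
Local Notation nr := (nr hZF hR).
Local Notation half := (half hZF hR).
Local Notation sum := (sum hZF hR).
Local Notation co := (co hZF hR).
Local Notation superflow := (superflow hZF hR).
Local Notation flow := (flow hZF hR).
Local Notation covers := (covers hZF hR).
Local Notation null := (null hZF hR).
Local Notation body := (body hZF).
Local Notation scale := (scale hZF hR).
Variable d' : N.
Local Notation d := (S d').
Local Notation side := (side hZF hR d').
Local Notation Pt := (El (M := M) (fun_set (proj1_sig d) (reals R))).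
Local Notation Set_ := (El (M := M) (power (fun_set (proj1_sig d) (reals R)))).
Local Notation Cov := (El (M := M) (fun_set omega (power (fun_set (proj1_sig d) (reals R))))).
Local Notation in_box := (@in_box M hZF R hR d').
Local Notation codes := (@codes M hZF R hR d').
Local Notation is_diam := (@is_diam M hZF R hR d).
Local Notation is_pow := (@is_pow M hZF R hR d).
Local Notation bounded := (@bounded M hZF R hR d).
Local Notation good_cover := (@good_cover M hZF R hR d).
Local Notation cover_null := (@cover_null M hZF R hR d).
Implicit Types (n k t i : N) (f g u w mu : SR) (z p : Br) (b : bool) (c r s h e : F) (x y : Pt)
  (U : Set_) (A : Pt -> Prop).

Definition pullback A p : Prop := exists x, A x /\ codes x p.
Lemma Def_pullback A : Def (fun h : unit * Pt => A h.2) -> Def (fun h : unit * Br => pullback A h.2).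
Proof. by move=> dA; rewrite /pullback; def. Qed.

Lemma inS_ext U U' : (forall x, inS x U <-> inS x U') -> U = U'.
Proof.
move=> H; apply: El_inj; apply: (zf_extensionality M hZF) => v; split=> hv.
  by have [x e] := in_space hZF hv; subst v; apply/H.
by have [x e] := in_space hZF hv; subst v; apply/H.
Qed.

Lemma set_ex A : Def (fun h : unit * Pt => A h.2) -> exists U, forall x, inS x U <-> A x.
Proof.
move=> dA; pose P (v : M) := exists x : Pt, proj1_sig x = v /\ A x.
have XP (v : M) : v ∈ set_of P <-> P v.
  apply: (set_of_sep hZF (a := fun_set (proj1_sig d) (reals R))) => [_ [x [<- _]]|]; first exact: (proj2_sig x).
  by rewrite /P; def.
have sub : set_of P ∈ power (fun_set (proj1_sig d) (reals R)).
  by apply/(powerP hZF) => v /XP[x [<- _]]; exact: (proj2_sig x).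
exists (exist (fun v => v ∈ power (fun_set (proj1_sig d) (reals R))) (set_of P) sub) => x.
rewrite /inS /=; split=> [/XP[x' [/El_inj -> //]]|ax].
by apply/XP; exists x.
Qed.

(** The boxes of the minimal nodes at which u reaches the capacity cover A; they are
    small because the capacity of the other nodes exceeds u, and antichain_sum bounds
    their total cost. *)
Lemma cover_of_superflow s h e A u w : 0 < s -> 0 < h -> superflow u ->
  (forall t, body t /\ (nr d + 1) * side t <= h -> rap w t = pw (side t) s) ->
  (forall t, ~ (body t /\ (nr d + 1) * side t <= h) -> rap u O < rap w t) ->
  covers w u (pullback A) -> pw (nr d + 1) s * rap u O <= e -> exists C, good_cover s h e A C.
Proof.
move=> s0 h0 su w1 w2 cu ue; have [u0 uS] := su; have n0 := nr_ge0 hZF hR d.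
pose H t := is_true (rap w t <= rap u t).
have dH : Def (fun h : unit * N => H h.2) by rewrite /H; def.
have df := Def_first_ hZF dH; pose fst t := first hZF dH t; rewrite -/fst in df.
have fst_small t : fst t -> body t /\ (nr d + 1) * side t <= h.
  move=> [_ ht]; apply: contrapT => /w2 k.
  by have := le_lt_trans (le_trans ht (superflow_root t su)) k; rewrite ltxx.
have setx t : exists U, forall x, inS x U <-> fst t /\ in_box x t.
  by apply: set_ex; def.
have [|C CP] := @lam_ex _ hZF omega (power (fun_set (proj1_sig d) (reals R))) (fun t => projT1 (cid (setx t))).
  apply: (@DefT_unique _ _ _ _ _ (fun (h : unit * N) U => forall x, inS x U <-> fst h.2 /\ in_box x h.2)).
  - by case=> c t; exact: (projT2 (cid (setx t))).
  - case=> c t U /= hU; apply: inS_ext => x.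
    have hx := projT2 (cid (setx t)) x.
    by split=> [/hU/hx|/hx/hU].
  - by def.
have {}CP t x : inS x (ap C t) <-> fst t /\ in_box x t.
  by rewrite CP; exact: (projT2 (cid (setx t)) x).
have m0 t : 0 <= (nr d + 1) * side t by rewrite mulr_ge0 ?ltW ?side_gt0 //; lra.
have bC t : bounded (ap C t) ((nr d + 1) * side t).
  by split=> // x y /CP[_ hx] /CP[_ hy]; apply: box_dst.
have dC t : exists r, is_diam (ap C t) r /\ r <= h.
  have [ft|nf] := pselect (fst t).
    have [r [rd rl]] := diam_ex (bC t); exists r; split=> //.
    by apply: le_trans rl _; case: (fst_small t ft).
  have [|r [rd rl]] := @diam_ex _ hZF _ hR _ (ap C t) 0; last by exists r; split=> //; lra.
  by split=> // x y /CP[].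
have pC t : exists v, is_pow s (ap C t) v by have [r [/(is_pow_ex s)]] := dC t.
have [|f fP] := @rlam_ex _ hZF _ hR (fun t => projT1 (cid (pC t))).
  apply: (@DefT_unique _ _ _ _ _ (fun (g : unit * N) (v : F) => is_pow s (ap C g.2) v)).
  - by case=> c t /=; exact: (projT2 (cid (pC t))).
  - by case=> c t v /= hv; apply: is_pow_unique hv (projT2 (cid (pC t))).
  - by def.
have {}fP t : is_pow s (ap C t) (rap f t) by rewrite fP; exact: (projT2 (cid (pC t))).
have K0 : 0 < pw (nr d + 1) s by apply: pw_gt0; lra.
exists C; split=> //; split.
  move=> x ax; have [z cz] := coded hR x.
  have [|n hn] := cu z; first by exists x.
  have [k fk] := @first_on_branch _ hZF H dH z n hn.
  exists (pre z k); apply/CP; split=> //.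
  by case: cz => _; apply; case: (fst_small _ fk).
exists f; split=> // n.
have fb t : (fst t -> rap f t <= pw (nr d + 1) s * rap u t) /\ (~ fst t -> rap f t <= 0).
  split=> ft.
    have [bt _] := fst_small t ft.
    apply: (le_trans (y := pw (nr d + 1) s * rap w t)); last by rewrite ler_pM2l //; case: ft.
    rewrite w1; last exact: fst_small.
    rewrite -pwM ?side_gt0 //; last by lra.
    case: (fP t) => [[_ ->]|[_ [r [rd ->]]]]; first exact: pw_ge0.
    by apply: pw_le => //; [case: rd => -[]|case: rd => _; apply].
  by case: (fP t) => [[_ ->]//|[[x /CP[]]]] //.
have [|f' f'P] := @rlam_ex _ hZF _ hR (fun t => rap f t / pw (nr d + 1) s); first by def.
have : sum f' n <= rap u O.
  apply: (@antichain_sum _ _ _ _ _ H su dH) => t ft; rewrite f'P.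
    by rewrite ler_pdivrMr // mulrC; apply: (proj1 (fb t)).
  by rewrite ler_pdivrMr // mul0r; apply: (proj2 (fb t)).
have -> : sum f n = pw (nr d + 1) s * sum f' n.
  by apply: sum_scale => k; rewrite f'P mulrC divfK // gt_eqF.
by move=> hs; apply: le_trans ue; rewrite ler_pM2l.
Qed.

(** A bounded set determines the lower corner of its hull, which serves as a base point
    that need not be chosen. *)
Definition is_low U i r : Prop := (exists x, inS x U) /\
  (forall x, inS x U -> is_true (r <= co x i)) /\
  forall c : F, (forall x, inS x U -> is_true (c <= co x i)) -> is_true (c <= r).
Lemma Def_is_low_ : Def (fun h : unit * Set_ * N * F => is_low h.1.1.2 h.1.2 h.2).
Proof. by rewrite /is_low; def. Qed.
Lemma is_low_unique U i r r' : is_low U i r -> is_low U i r' -> r = r'.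
Proof. by move=> [_ [h1 h2]] [_ [h3 h4]]; apply/eqP; rewrite eq_le h4 // h2. Qed.

Lemma corner_ex U : exists f, forall i,
  is_low U i (rap f i) \/ (~ exists r, is_low U i r) /\ rap f i = 0.
Proof.
have dl := Def_is_low_.
have H i : exists r, is_low U i r \/ (~ exists r, is_low U i r) /\ r = 0.
  have [[r hr]|n] := pselect (exists r, is_low U i r); first by exists r; left.
  by exists 0; right.
have [|f fP] := @rlam_ex _ hZF _ hR (fun i => projT1 (cid (H i))).
  apply: (@DefT_unique _ _ _ _ _ (fun (h : unit * N) (r : F) =>
    is_low U h.2 r \/ (~ exists r, is_low U h.2 r) /\ r = 0)).
  - by case=> c i; exact: (projT2 (cid (H i))).
  - case=> c i r /= hr; case: (projT2 (cid (H i))) hr => [h1|[h1 h1']] [h2|[h2 h2']].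
    + exact: is_low_unique h2 h1.
    + by case: h2; eexists; exact: h1.
    + by case: h1; exists r.
    + by exact: (etrans h2' (esym h1')).
  - by def.
by exists f => i; rewrite fP; exact: (projT2 (cid (H i))).
Qed.
Definition corner U : SR := projT1 (cid (corner_ex U)).
Lemma cornerP U i : is_low U i (rap (corner U) i) \/
  (~ exists r, is_low U i r) /\ rap (corner U) i = 0.
Proof. exact: projT2 (cid (corner_ex U)) i. Qed.
Lemma DefT_corner_ : DefT (fun h : unit * Set_ => corner h.2).
Proof.
have dl := Def_is_low_.
apply: (@DefT_unique _ _ _ _ _ (fun (h : unit * Set_) (f : SR) => forall i,
  is_low h.2 i (rap f i) \/ (~ exists r : F, is_low h.2 i r) /\ rap f i = 0)).
- by case=> c U; apply: cornerP.
- case=> c U f /= hf; apply: rap_ext => i; case: (hf i) (cornerP U i) => [h1|[h1 h1']] [h2|[h2 h2']].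
  + exact: is_low_unique h1 h2.
  + by case: h2; eexists; exact: h1.
  + by case: h1; eexists; exact: h2.
  + by exact: (etrans h1' (esym h2')).
- by def.
Qed.

Lemma corner_bounds U r x i : is_diam U r -> inS x U -> Nlt i d ->
  rap (corner U) i <= co x i /\ co x i <= rap (corner U) i + r.
Proof.
move=> [[r0 rb] _] xU id_.
have B y : inS y U -> co x i - r <= co y i.
  by move=> yU; have [] := co_dst id_ (rb x y xU yU).
case: (cornerP U i) => [[_ [h1 h2]]|[n _]].
  by split; [apply: h1|rewrite -lerBlDr; apply: h2].
case: n; have [|||l [l1 l2]] := @inf_ex _ hZF _ hR (fun a : F => exists y, inS y U /\ a = co y i).
- by def.
- by exists (co x i), x.
- by exists (co x i - r) => _ [y [yU ->]]; apply: B.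
exists l; split; first by exists x.
split=> [y yU|c cP]; first by apply: l1; exists y.
by apply: l2 => _ [y [yU ->]]; apply: cP.
Qed.

(** A set U of diameter at most r lies in the cube of edge r at its lower corner, and a
    branch that codes a point of U passes a box of side between 2 r and 4 r, of mass at
    most (4 r)^s.  So the part of A in U is covered by a hull superflow of mass about r^s,
    and these masses have a small sum.  Diameters that are 0 are replaced by positive
    numbers r_i for which the sum of the r_i^s is small. *)
Lemma cover_null_null mu s s' h A k0 : Def (fun h : unit * Pt => A h.2) ->
  flow mu -> 0 < s -> s' < s -> 0 < h ->
  (forall t, body t /\ (nr d + 1) * side t <= h -> rap mu t <= pw (side t) s) ->
  (forall t, ~ body t -> len t = k0 -> rap mu t = 0) ->
  cover_null s' A -> null mu (pullback A).
Proof.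
move=> dA fm s0 ss h0 mb mk cA eps eps0.
have [m0 mS] := fm; have n0 := nr_ge0 hZF hR d.
have dl := DefT_corner_; have dh := DefT_half_ hZF hR.
(* C bounds the scale of the nodes that matter, T is the mass of a hull with c = 1. *)
pose C : F := gpow 2%:R k0; have C0 : 0 < C by apply: gpow_gt0; lra.
pose T : F := gpow 2%:R d * 2%:R; have T0 : 0 < T by apply: mulr_gt0; [apply: gpow_gt0|]; lra.
pose P4 : F := pw 4%:R s; have P40 : 0 < P4 by apply: pw_gt0; lra.
pose K := C * P4 * T; have K0 : 0 < K by exact: (mulr_gt0 (mulr_gt0 C0 P40) T0).
pose e := eps / (3%:R * K); have e0 : 0 < e by apply: divr_gt0 => //; apply: mulr_gt0 => //; lra.
have [rb [rb0 [rb1 rb2]]] : exists r : F, 0 < r /\ r <= 1 / 2%:R /\ (nr d + 1) * (4%:R * r) <= h.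
  exists (Num.min (1 / 2%:R) (h / ((nr d + 1) * 4%:R))).
  have hp : 0 < (nr d + 1) * 4%:R by nra.
  split; first by rewrite lt_min !divr_gt0 ?ltr01 ?ltr0n.
  split; first by rewrite ge_min lexx.
  have h1 : Num.min (1 / 2%:R) (h / ((nr d + 1) * 4%:R)) <= h / ((nr d + 1) * 4%:R).
    by rewrite ge_min lexx orbT.
  by move: h1; rewrite ler_pdivlMr // mulrC mulrA.
have pr0 : 0 < pw rb s by apply: pw_gt0.
pose th := Num.min e (pw rb s / 2%:R).
have th0 : 0 < th by rewrite /th lt_min e0 divr_gt0 ?ltr0n.
have the : th <= e by rewrite /th ge_min lexx.
have thr : th < pw rb s by apply: (@le_lt_trans _ _ (pw rb s / 2%:R)); [by rewrite /th ge_min lexx orbT|lra].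
have [U [Ud [Uc [f [fP fe]]]]] := cA rb e rb0 e0.
have dd : exists del : SR, forall i, is_diam (ap U i) (rap del i) /\ rap del i <= rb.
  have [|del delP] := @rlam_ex _ hZF _ hR (fun i => projT1 (cid (Ud i))).
    apply: (@DefT_unique _ _ _ _ _ (fun (g : unit * N) (v : F) => is_diam (ap U g.2) v)).
    - by case=> c i /=; case: (projT2 (cid (Ud i))).
    - case=> c i v /= hv; apply: is_diam_unique hv _; by case: (projT2 (cid (Ud i))).
    - by def.
  by exists del => i; rewrite delP; exact: (projT2 (cid (Ud i))).
have [del delP] := dd.
(* The replacement for small diameters: tau i ^ s = th / 2^i. *)
pose tau i : F := exp (log (th * half i) / s).
have tauP i : 0 < tau i /\ pw (tau i) s = th * half i.
  by apply: pw_root => //; rewrite mulr_gt0 ?half_gt0.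
have [|rho rhoP] := @rlam_ex _ hZF _ hR (fun i => Num.max (rap del i) (tau i)).
  by rewrite /tau; def.
have rhod i : rap del i <= rap rho i by rewrite rhoP le_max lexx.
have rho0 i : 0 < rap rho i by rewrite rhoP lt_max; case: (tauP i) => ->; rewrite orbT.
have taur i : tau i <= rb.
  have [t0 tp] := tauP i; rewrite leNgt; apply/negP => /ltW k.
  have := pw_le (ltW rb0) k s0; rewrite tp; have := half_le1 hZF hR i; have := half_gt0 hZF hR i.
  nra.
have rhor i : rap rho i <= rb by rewrite rhoP ge_max taur; case: (delP i) => _ ->.
have f0 i : 0 <= rap f i by exact: is_pow_ge0 (fP i).
have rhop i : pw (rap rho i) s <= rap f i + th * half i.
  have [t0 tp] := tauP i; have [dx dr] := delP i.
  rewrite rhoP /Num.max; case: ltP => k; first by rewrite tp lerDr.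
  have dp : 0 < rap del i by apply: lt_le_trans k.
  apply: (@le_trans _ _ (rap f i)); last by rewrite lerDl mulr_ge0 // ltW // half_gt0.
  case: (fP i) => [[em _]|[_ [r [rd ->]]]].
    have : rap del i <= 0 by case: dx => _; apply; split=> // x y /em.
    lra.
  rewrite -(is_diam_unique dx rd); apply: pw_anti => //; [lra|exact: ltW].
have [|cc ccP] := @rlam_ex _ hZF _ hR (fun i => C * (P4 * pw (rap rho i) s)); first by def.
have c0 i : 0 <= rap cc i by rewrite ccP !mulr_ge0 ?pw_ge0 // ltW.
have bx i : exists g, forall j, rap g j = rap (corner (ap U i)) j + rap rho i.
  by apply: rlam_ex; def.
pose top i : SR := projT1 (cid (bx i)).
have topE i j : rap (top i) j = rap (corner (ap U i)) j + rap rho i := projT2 (cid (bx i)) j.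
have dtop : DefT (fun h : unit * N => top h.2).
  apply: (DefT_rfn (hZF := hZF) (hR := hR) (t' := fun (h : unit * N) (j : N) =>
    rap (corner (ap U h.2)) j + rap rho h.2)).
    by case=> a i j; rewrite topE.
  by def.
have [||||u [su [uO ug]]] := @superflow_series _ hZF _ hR
    (fun i t => hull d' (corner (ap U i)) (top i) (rap cc i) t) eps.
- by rewrite /hull; def.
- by move=> i t; apply: hull_ge0.
- by move=> i t; apply: hull_split.
- move=> g n gP.
  have [|g1 g1P] := @rlam_ex _ hZF _ hR (fun i => rap f i + th * half i); first by def.
  have [|g2 g2P] := @rlam_ex _ hZF _ hR (fun i => half i); first by def.
  have [|g3 g3P] := @rlam_ex _ hZF _ hR (fun i => th * half i); first by def.
  have [|g4 g4P] := @rlam_ex _ hZF _ hR (fun i => K * rap g1 i); first by def.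
  have h1 : sum g n <= sum g4 n.
    apply: sum_le => i _; rewrite gP hull_root g4P ccP g1P.
    rewrite /K -/T; have := rhop i; set a := pw _ _; set b := _ + _ => hab.
    have -> : C * (P4 * a) * T = C * P4 * T * a by ring.
    by rewrite ler_pM2l.
  rewrite (sum_scale (c := K) (f := g1) (h := g4)) // in h1.
  have h2 : sum g1 n = sum f n + sum g3 n by apply: sum_add => i; rewrite g1P g3P.
  have h3 : sum g3 n = th * sum g2 n by apply: sum_scale => i; rewrite g3P g2P.
  have h4 := sum_half n g2P; have h5 := fe n.
  have h6 : sum g1 n <= 3%:R * e by rewrite h2 h3; nra.
  apply: le_trans h1 _; apply: (@le_trans _ _ (K * (3%:R * e))); first by rewrite ler_pM2l.
  by rewrite /e (_ : K * _ = eps) //; field; lra.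
exists u; split=> //; split=> // z [x [ax cx]].
have [u0 _] := su.
have [bk|nk] := pselect (body (pre z k0)); last first.
  by exists k0; rewrite mk ?len_pre.
have [i xi] := Uc x ax.
have ri0 := rho0 i; have rir := rhor i.
have [||n [bn [n1 n2]]] := side_crossing (hR := hR) d' (r := 2%:R * rap rho i) bk; [lra|lra|].
exists n; apply: le_trans (ug i _).
have xn : in_box x (pre z n) by case: cx => _; apply.
have scl : scale (pre z n) <= C.
  have k1 : scale (pre z k0) <= C by rewrite /C -{2}(len_pre hZF z k0); apply: scale_le.
  case: (Nlt_total hZF n k0) => [l|[->//|l]].
    by apply: le_trans k1; apply: scale_mono; apply: Nlt_le.
  by have [_ ->] := body_mono hR (Nlt_le hZF l) bk.
have [dx dr] := delP i.
apply: (@le_trans _ _ (rap cc i / scale (pre z n))); last first.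
  apply: (hull_hit (x := x)) => // j jd; have [h1 h2] := corner_bounds dx xi jd.
  by rewrite topE; have := rhod i; split; [|split]; lra.
have s1 := scale_ge1 hZF hR (pre z n).
rewrite ler_pdivlMr; last by lra.
have h1 : rap mu (pre z n) <= pw (side (pre z n)) s.
  apply: mb; split=> //; apply: le_trans rb2; rewrite ler_pM2l; lra.
have h2 : pw (side (pre z n)) s <= P4 * pw (rap rho i) s.
  rewrite /P4 -pwM ?ltr0n //.
  by apply: pw_le => //; [exact/ltW/side_gt0|lra].
rewrite ccP mulrC; apply: ler_pM => //; first by lra.
exact: le_trans h1 h2.
Qed.

End Transfer.

(** * Wellordered unions *)

Section Ordinals.
Context {M : set_structure} (hZF : ZF M) (theta : M).
Implicit Types a b c : El theta.

Definition below_ord b a : Prop := proj1_sig b ∈ proj1_sig a.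
Lemma Def_below_ord_ : Def (fun h : unit * El theta * El theta => below_ord h.1.2 h.2).
Proof. by rewrite /below_ord; def. Qed.

Lemma minimal_ex (P : El theta -> Prop) : Def (fun h : unit * El theta => P h.2) ->
  (exists a, P a) -> exists a, P a /\ forall b, below_ord b a -> ~ P b.
Proof.
move=> dP [a0 P0]; pose Q (v : M) := exists a, proj1_sig a = v /\ P a.
have [|c cP] := @separation M hZF Q theta; first by rewrite /Q; def.
have [|v [/cP[vt [a [<- Pa]]] vm]] := zf_foundation M hZF c.
  by exists (proj1_sig a0); apply/cP; split; [exact: (proj2_sig a0)|exists a0].
exists a; split=> // b ba Pb; apply: (vm _ ba); apply/cP.
by split; [exact: (proj2_sig b)|exists b].
Qed.

Hypothesis ord : ordinal theta.

Lemma ord_elem a (v : M) : v ∈ proj1_sig a -> exists b, proj1_sig b = v.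
Proof.
move=> va; have vt : v ∈ theta by case: ord => H _; apply: (H _ (proj2_sig a)).
by exists (exist (fun v => v ∈ theta) v vt).
Qed.

Lemma below_trans a b c : below_ord a b -> below_ord b c -> below_ord a c.
Proof. by move=> ab bc; case: ord => _ H; apply: (H _ (proj2_sig c) _ bc). Qed.

Lemma ord_total a b : below_ord a b \/ a = b \/ below_ord b a.
Proof.
have db := Def_below_ord_; pose T a b := below_ord a b \/ a = b \/ below_ord b a.
apply: contrapT => nT.
have [||{nT} a' [[b1 nb] am]] := @minimal_ex (fun a => exists b, ~ T a b); first by rewrite /T; def.
  by exists a, b.
have [||b' [nT bm]] := @minimal_ex (fun b => ~ T a' b); first by rewrite /T; def.
  by exists b1.
apply: (nT); right; left; apply: El_inj; apply: (zf_extensionality M hZF) => v; split=> hv.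
  have [x e] := ord_elem hv; subst v.
  have : T x b' by apply: contrapT => n; apply: (am x hv); exists b'.
  case=> [//|[e|h]]; case: nT; right; right; first by subst x.
  exact: below_trans h hv.
have [y e] := ord_elem hv; subst v.
have : T a' y by apply: contrapT; apply: bm.
case=> [h|[e|//]]; case: nT; left; last by subst y.
exact: below_trans h hv.
Qed.

End Ordinals.

Section Unions.
Context {M : set_structure} (hZF : ZF M) (hAD : AD M) (R : field_data M) (hR : is_real_field R).
Local Notation N := (El (M := M) omega).
Local Notation F := (Real hZF hR).
Local Notation SR := (El (M := M) (fun_set omega (reals R))).
Local Notation Br := (El (M := M) (fun_set omega omega)).
Local Notation ap := (ap hZF).
Local Notation rap := (rap hZF hR).
Local Notation O := (O hZF).
Local Notation S := (S hZF).
Local Notation ch := (ch hZF).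
Local Notation pre := (pre hZF).
Local Notation path := (path hZF).
Local Notation flow := (flow hZF hR).
Local Notation null := (null hZF hR).
Local Notation positive := (positive hZF hR).
Implicit Types (n t : N) (mu : SR) (x y z p : Br).

Lemma subpair_swap mu (k : N -> N -> F) : subpair mu k -> subpair mu (fun s t => k t s).
Proof.
move=> [k1 k2 k3 k4 k5 k6]; split=> //.
- by def.
- by move=> s t; rewrite mulrC.
- by move=> s t; apply: le_trans (k4 t s) _; lra.
- by move=> a b s t; apply: k5.
Qed.

Variable theta : M.
Hypothesis ord : ordinal theta.
Local Notation below_ord := (@below_ord M theta).
Variable X : El theta -> Br -> Prop.
Hypothesis dX : Def (fun h : unit * El theta * Br => X h.1.2 h.2).

Definition before a p : Prop := exists b, below_ord b a /\ X b p.

(** If the union over J is not null, it carries a flow h.  Let E x y mean that x appears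
    in the union no later than y.  For an index b of y, the x with E x y are in the union up
    to b, and for an index b of x, the y without E x y appear before b; both sets are
    null, which contradicts Fubini for E or for its complement. *)
Lemma segment_null mu (J : El theta -> Prop) : Def (fun h : unit * El theta => J h.2) ->
  flow mu -> (forall a, null mu (X a)) -> (forall a, J a -> null mu (before a)) ->
  null mu (fun p => exists a, J a /\ X a p).
Proof.
move=> dJ fm nX nB; apply: contrapT => nn; have db := Def_below_ord_ theta.
have dY : Def (fun h : unit * Br => exists a, J a /\ X a h.2) by def.
have [h [fh [h0 [hm hY]]]] := flow_in_not_null hAD dY (proj1 fm) nn.
have {}nX a : null h (X a) by apply: null_sub (nX a).
have {}nB a : J a -> null h (before a) by move=> /nB; apply: null_sub.
pose E x y := forall b, J b -> X b y -> exists c, (below_ord c b \/ c = b) /\ X c x.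
have dE : Def (fun h : unit * Br * Br => E h.1.2 h.2) by rewrite /E; def.
case: (product_dichotomy hAD dE fh h0) => [[k [sk kE]]|[k [sk kE]]].
- have [y [yp]] := fubini fh sk; case.
  have [b [Jb Xb]] := hY y yp.
  apply: (null_sub (X := fun p => before b p \/ X b p)) (nullU (nB b Jb) (nX b)) => // z hz.
  have [c [[cb|->] Xc]] := kE z y hz b Jb Xb; last by right.
  by left; exists c.
- have [y [yp]] := fubini fh (subpair_swap sk); case.
  have [b [Jb Xb]] := hY y yp.
  apply: null_sub (nB b Jb) => // z hz.
  have := kE y z hz; move=> /existsNP[c /not_implyP[Jc /not_implyP[Xc nc]]].
  exists c; split=> //; case: (ord_total hZF ord c b) => [//|[e|bc]]; case: nc.
    by exists b; split=> //; right.
  by exists b; split=> //; left.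
Qed.

(** J consists of the indices below a minimal one whose initial union is not null, or of
    all the indices if there is none. *)
Theorem wellordered_null mu : flow mu -> (forall a, null mu (X a)) ->
  null mu (fun p => exists a, X a p).
Proof.
move=> fm nX; have db := Def_below_ord_ theta.
have dn : Def (fun h : unit * El theta => ~ null mu (before h.2)).
  by rewrite /null /before /superflow /covers; def.
have [ex|nex] := pselect (exists a, ~ null mu (before a)).
  have [a [na am]] := minimal_ex hZF dn ex; case: na.
  apply: segment_null => //; first by def.
  by move=> b ba; apply: contrapT; apply: am.
have {}nex a : null mu (before a) by apply: contrapT => n; apply: nex; exists a.
apply: (null_sub (X := fun p => exists a, True /\ X a p) (mu := mu)) => //.
  by move=> z [a Xa]; exists a.
by apply: segment_null => //; def.
Qed.

End Unions.

(** * The dimension of a wellordered union *)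

Section Conclusion.
Context {M : set_structure} (hZF : ZF M) (hAD : AD M) (R : field_data M) (hR : is_real_field R).
Local Notation N := (El (M := M) omega).
Local Notation F := (Real hZF hR).
Local Notation SR := (El (M := M) (fun_set omega (reals R))).
Local Notation Br := (El (M := M) (fun_set omega omega)).
Local Notation ap := (ap hZF).
Local Notation rap := (rap hZF hR).
Local Notation O := (O hZF).
Local Notation S := (S hZF).
Local Notation ch := (ch hZF).
Local Notation len := (len hZF).
Local Notation pre := (pre hZF).
Local Notation path := (path hZF).
Local Notation nr := (nr hZF hR).
Local Notation flow := (flow hZF hR).
Local Notation null := (null hZF hR).
Local Notation body := (body hZF).
Variable d' : N.
Local Notation d := (S d').
Local Notation side := (side hZF hR d').
Local Notation Pt := (El (M := M) (fun_set (proj1_sig d) (reals R))).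
Local Notation cover_null := (@cover_null M hZF R hR d).
Local Notation pullback := (@pullback M hZF R hR d').
Implicit Types (n k t i : N) (z p : Br) (x y : Pt) (s r : F).

(** The branch 1..1.. codes no point, and its prefixes are the only spine nodes. *)
Lemma spine_vanish (mu : SR) (A : Pt -> Prop) : (forall t, 0 <= rap mu t) ->
  (forall z, (forall n, 0 < rap mu (pre z n)) -> pullback A (path z)) ->
  exists k0, forall t, ~ body t -> len t = k0 -> rap mu t = 0.
Proof.
move=> m0 mA; have [|z zP] := @lam_ex _ hZF omega omega (fun _ => S O); first by def.
have spine t : ~ body t -> t = pre z (len t).
  move: t; apply: tree_ind => [||b t IH]; first by def.
    by rewrite lenO preO.
  move=> /body_ch nb; have nt : ~ body t by move=> h; apply: nb; left.
  have bt : b by case: b nb => // nb; case: nb; right.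
  rewrite len_ch preS -IH // bt zP; congr ch; symmetry; exact: (bit_if hZF true).
have nbz n : ~ body (pre z n).
  move: n; apply: N_ind => [||n IH]; first by def.
    by rewrite preO; apply: bodyO.
  rewrite preS zP => /body_ch[//|]; by rewrite (bit_if hZF true).
apply: contrapT => /forallNP nk.
have [|x [_ [[n bn] _]]] := mA z; last exact: nbz bn.
move=> n; rewrite lt_neqAle m0 andbT; apply/negP => /eqP e; apply: (nk n) => t nt ln.
by rewrite (spine t nt) ln.
Qed.

Section Union.
Variable theta : M.
Hypothesis ord : ordinal theta.
Variable A : El theta -> Pt -> Prop.
Hypothesis dA : Def (fun h : unit * El theta * Pt => A h.1.2 h.2).

(** The capacity is side^s on the small boxes and too large to be reached elsewhere.  If
    a superflow covers the union, it yields the required cover; otherwise the union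
    carries a flow, for which all the A a, and hence their union, are null. *)
Theorem cover_null_union s : 0 < s ->
  (forall a, exists s', s' < s /\ cover_null s' (A a)) ->
  cover_null s (fun x => exists a, A a x).
Proof.
move=> s0 HA h e h0 e0.
have dU : Def (fun h : unit * Pt => exists a, A a h.2) by def.
have dcU : Def (fun h : unit * Br => pullback (fun x => exists a, A a x) h.2) by apply: Def_pullback.
have n0 := nr_ge0 hZF hR d.
have K0 : 0 < pw (nr d + 1) s by apply: pw_gt0; lra.
pose v := e / (2%:R * pw (nr d + 1) s).
have v0 : 0 < v by apply: divr_gt0 => //; apply: mulr_gt0 => //; lra.
have [|w wP] := @rlam_ex _ hZF _ hR (fun t =>
    if `[< body t /\ is_true ((nr d + 1) * side t <= h) >] then pw (side t) s else 2%:R * v + 1).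
  by def.
have w0 t : 0 <= rap w t.
  by rewrite wP; case: asboolP => _; [apply/pw_ge0/ltW/side_gt0|lra].
have [[mu [fm [mO [mw mA]]]]|K] := flow_or_cover hAD dcU w0 v0; last first.
  have [u [su [uO cu]]] := K v v0.
  apply: (cover_of_superflow s0 h0 su (w := w)) => //.
  - by move=> t ht; rewrite wP asboolT.
  - by move=> t ht; rewrite wP asboolF //; lra.
  - apply: (@le_trans _ _ (pw (nr d + 1) s * (2%:R * v))); first by rewrite ler_pM2l //; lra.
    have -> : pw (nr d + 1) s * (2%:R * v) = e by rewrite /v; field; rewrite gt_eqF.
    exact: lexx.
have [m0 _] := fm; have [k0 k0P] := spine_vanish m0 mA.
have mb t : body t /\ (nr d + 1) * side t <= h -> rap mu t <= pw (side t) s.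
  by move=> ht; have := mw t; rewrite wP asboolT.
have nA a : null mu (pullback (A a)).
  have [s' [ss ca]] := HA a; apply: (cover_null_null _ fm s0 ss h0 mb k0P ca); by def.
have dX : Def (fun h : unit * El theta * Br => pullback (A h.1.2) h.2).
  by rewrite /pullback; def.
case: (@flow_not_null _ hZF _ hR mu (fun p => exists a, pullback (A a) p) fm).
- by rewrite mO.
- by move=> z /mA[x [[a Aa] cx]]; exists a, x.
- exact: (wellordered_null hAD ord dX fm nA).
Qed.

End Union.
End Conclusion.

Local Close Scope ring_scope.

Theorem theorem6 (M : set_structure) (hZF : ZF M) (hAD : AD M)
    (R : field_data M) (hR : is_real_field R)
    (d : M) (hd : d ∈ omega) (hd1 : d <> empty)
    (delta : M) (hdelta : delta ∈ reals R)
    (theta : M) (htheta : ordinal theta)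
    (hdeg : rle R (rzero R) delta \/ theta <> empty)
    (A : M) (hA : is_fun theta (power (space R d)) A)
    (hHD : forall alpha : M, alpha ∈ theta ->
       ele R (HD R d (app A alpha)) (Some delta)) :
  ele R (HD R d (set_of (fun x => exists alpha, alpha ∈ theta /\ x ∈ app A alpha)))
    (Some delta).
Proof.
have [d' ed] : exists d' : El omega, d = proj1_sig (S hZF d').
  case: (N_case hZF (exist (fun v => v ∈ omega) d hd)) => [e|[d' e]].
    by case: hd1; move/(congr1 (@proj1_sig _ _)): e.
  by exists d'; rewrite -e.
have [r er] := real_of hZF hR hdelta; subst d delta.
set D := proj1_sig (S hZF d').
pose A' : El (fun_set theta (power (space R D))) :=
  exist _ A (proj2 (fun_setP hZF _ _ A) hA).
have AE (a : El theta) : app A (proj1_sig a) = proj1_sig (ap hZF A' a) by rewrite val_ap.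
pose P (a : El theta) (x : El (fun_set D (reals R))) : Prop := inS x (ap hZF A' a).
have dP : Def (fun h : unit * El theta * El (fun_set D (reals R)) => P h.1.2 h.2).
  by rewrite /P; def.
have subA (a : El theta) : subset (app A (proj1_sig a)) (space R D).
  by apply/(powerP hZF); rewrite AE; exact: (proj2_sig (ap hZF A' a)).
set U := set_of _.
have UP v : v ∈ U <-> exists alpha, alpha ∈ theta /\ v ∈ app A alpha.
  apply: (set_of_sep hZF (a := space R D)) => [u [a [at_ va]]|].
    exact: (subA (exist (fun v => v ∈ theta) a at_)).
  apply: (@Def_ext _ _ _ (fun h : unit * M => exists a : El theta, h.2 ∈ proj1_sig (ap hZF A' a))).
    case=> c u /=; split=> [[a va]|[a [at_ va]]].
      by exists (proj1_sig a); rewrite AE; split=> //; exact: (proj2_sig a).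
    by exists (exist (fun v => v ∈ theta) a at_); rewrite -AE.
  by def.
have subU : subset U (space R D).
  move=> v /UP[a [at_ va]]; exact: (subA (exist (fun v => v ∈ theta) a at_)).
have HA (a : El theta) := HD_inv (subA a) (hHD _ (proj2_sig a)).
have r0 : (0 <= r)%R.
  case: hdeg => [h|ne]; first by apply/(rleP (hZF := hZF) (hR := hR)); rewrite code_0.
  have [a ta] : exists a, a ∈ theta.
    by apply: contrapT => n; apply: ne; apply: (empty_eq hZF) => v vt; apply: n; exists v.
  by case: (HA (exist (fun v => v ∈ theta) a ta)).
apply: (HD_intro subU r0) => s rs.
have -> : (fun p : El (fun_set D (reals R)) => proj1_sig p ∈ U) = (fun p => exists a, P a p).
  apply: funext => p; apply: propext; split=> [/UP[a [at_ pa]]|[a pa]].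
    by exists (exist (fun v => v ∈ theta) a at_); rewrite /P /inS -AE.
  by apply/UP; exists (proj1_sig a); rewrite AE; split=> //; exact: (proj2_sig a).
apply: (cover_null_union hAD htheta dP); first exact: Order.POrderTheory.le_lt_trans r0 rs.
move=> a; have [_ /(_ s rs)[s' [_ [ss cs]]]] := HA a; exists s'; split=> //.
Qed.
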